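(* For $n\geqslant 2$ and $c\in(0,1]$, the polytope $$PA_{n,c}= \Delta_{[n+1]}+\sum_{\beta\in \mathcal{A}_1} \Delta_{\bigcup\beta}+ \sum_{\beta\in \mathcal{A}_2} \bigl(P_{\mathcal{B}_\beta}\cap \pi_{\beta,c}^{\geqslant}\bigr)\subseteq\mathbf{R}^{n+1}$$ is an $n$-dimensional Minkowski-realisation of the simplicial complex $C$, which is normally equivalent to $\mathbf{PA}_n$.
   Context: **Polytopes.** A polytope is the convex hull of a finite nonempty set of points; $\mathcal{M}_N$ is the collection of all polytopes in $\mathbf{R}^N$; $\mathcal{V}(P)$ is the vertex set of $P$; $[k]=\{1,\dots,k\}$; $\subset$ is proper inclusion. Sums of polytopes are Minkowski sums. $\Delta_I=conv\{e_i\mid i\in I\}\subseteq\mathbf{R}^{n+1}$ for $\emptyset\neq I\subseteq[n+1]$, with $e_i$ the standard basis vectors. For a hyperplane $\pi$ given by an equation, $\pi^{\geqslant}$ (resp. $\pi^{>}$) is the set obtained by replacing $=$ by $\geqslant$ (resp. $>$). A truncation $\mathrm{tr}_FP$ of $P$ in a proper nonempty face $F$ that is not a facet is a polytope $P\cap\pi^{\geqslant}$ such that every vertex of $P$ not in $F$ lies in $\pi^{>}$ and no vertex of $F$ lies in $\pi^{\geqslant}$. The normal cone of $P\in\mathcal{M}_N$ at a nonempty face $F$ is $N_F(P)=\{v\in\mathbf{R}^N\mid \langle v,y\rangle=\max_{z\in P}\langle v,z\rangle\ \forall y\in F\}$; the normal fan is $\mathcal{N}(P)=\{N_F(P)\mid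 F\text{ a nonempty face of }P\}$; $P\simeq Q$ (normally equivalent) means $\mathcal{N}(P)=\mathcal{N}(Q)$. **Truncators.** $P_2$ is a truncator summand for $P_1$ if there is a truncation $\mathrm{tr}_FP_1$ of $P_1$ in a proper face $F$ with $P_1+P_2\simeq \mathrm{tr}_FP_1$. An indexed set $\{P_i\}_{i\in[m]}$ is a truncator set of summands for $S_0$ if for every $i\in[m]$, $P_i$ is a truncator summand for $S_{i-1}$, where $S_i=S_{i-1}+P_i$. **Building sets, nested sets.** A building set of $\mathcal{P}(V)$ ($V$ finite) is a collection of nonempty subsets of $V$ containing all singletons and closed under unions of pairs of intersecting members. A building set of a simplicial complex $K$ (which contains $\emptyset$) is a collection $\mathcal{B}$ of simplices of $K$ such that $\mathcal{B}\cap\mathcal{P}(V_i)$ is a building set of $\mathcal{P}(V_i)$ for every maximal simplex $V_i$ of $K$. For a family $N$ of sets, an $N$-antichain is a subset $\{X_1,\dots,X_m\}\subseteq N$, $m\geqslant2$, of mutually incomparable (for inclusion) sets. $N\subseteq\mathcal{B}$ is nested with respect to $\mathcal{B}$ if the union of every $N$-antichain is an element of $K-\mathcal{B}$. Nested sets form a simplicial complex. A polytope $P$ realises a simplicial complex $K$ if its face lattice with the empty face removed is isomorphic to $(K,\supseteq)$. **The complex $C$.** $C_0=\mathcal{P}([n+1])-\{[n+1]\}$; $\mathcal{B}_0=C_0-\{\emptyset\}$; $C_1$ is the complex of all nested sets with respect to the building set $\mathcal{B}_0$ of $C_0$. $\mathcal{B}_1\subseteq C_1$ is the family of all sets $$\beta=\bigl\{\{i_{k+l},\ldots,i_k,\ldots,i_1\},\ldots,\{i_{k+l},\ldots,i_k,i_{k-1}\},\{i_{k+l},\ldots,i_k\}\bigr\},\qquad(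 * )$$ where $1\leqslant k\leqslant k+l\leqslant n$ and $i_1,\dots,i_{k+l}$ are distinct elements of $[n+1]$ (so $|\beta|=k$). It is a building set of $C_1$, and $C$ is the complex of all nested sets with respect to $\mathcal{B}_1$. $\mathcal{A}_1$ is the set of one-element members of $\mathcal{B}_1$ and $\mathcal{A}_2=\mathcal{B}_1-\mathcal{A}_1$. **Minkowski-realisation.** Let $K$ be the complex of all nested sets with respect to a building set $\mathcal{B}$, and let $\{\mathcal{A}_1,\mathcal{A}_2\}$ be the partition of $\mathcal{B}$ with $\mathcal{A}_1$ the collection of singleton elements. An $n$-polytope $P\subseteq \mathbf{R}^{n+1}$ is an $n$-dimensional Minkowski-realisation of $K$ if: (i) $P$ realises $K$; (ii) there is a function $\varphi:\mathcal{B}\to\mathcal{M}_{n+1}$ with $P=\Delta_{[n+1]}+\sum_{\beta\in\mathcal{B}}\varphi(\beta)$; (iii) for every bijective indexing $x:[m]\to\mathcal{A}_2$ such that $|x(i)|\geqslant|x(j)|$ for all $i<j$, the indexed set $\{\varphi(x(i))\}_{i\in[m]}$ is a truncator set of summands for $\Delta_{[n+1]}+\sum_{\beta\in\mathcal{A}_1}\varphi(\beta)$. **The summands.** For $\beta\in\mathcal{A}_2$ as in $( * )$ (so $k>1$), let $\beta_{min}=\{i_{k+l},\ldots,i_k\}$, $\beta_{max}=\{i_{k+l},\ldots,i_1\}$ and $$\mathcal{B}_\beta=\{\emptyset\ne B\subseteq[n+1]\mid B\in\beta\text{ or }B\subset\beta_{min}\text{ or }\beta_{max}\subset B\}\cup\{\{v\}\mid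 v\in[n+1]\},$$ $P_{\mathcal{B}_\beta}=\sum_{B\in\mathcal{B}_\beta}\Delta_B$. Let $\kappa_\beta(x)=\sum_{B\in\beta}\sum_{i\in B}x_i=x_{i_1}+2x_{i_2}+\ldots+k(x_{i_k}+\ldots+x_{i_{k+l}})$ and $m_\beta=\min_{v\in\mathcal{V}(P_{\mathcal{B}_\beta})}\kappa_\beta(v)$. The hyperplane $\pi_{\beta,c}$ is $\kappa_\beta(x)=m_\beta+c$. **The polytope $\mathbf{PA}_n$.** For $1\leqslant k\leqslant k+l\leqslant n$ let $\kappa(k,l)=\frac{3^{k+l+1}-3^{l+1}}{2}+\frac{3^k-3k}{3^n-n-1}$. For $\beta\in\mathcal{B}_1$ as in $( * )$, $\pi_\beta$ is the hyperplane $x_{i_1}+2x_{i_2}+\ldots+k(x_{i_k}+\ldots+x_{i_{k+l}})=\kappa(k,l)$ in $\mathbf{R}^{n+1}$. With $\pi$ the hyperplane $x_1+\ldots+x_{n+1}=3^{n+1}$, $\mathbf{PA}_n=\bigl(\bigcap_{\beta\in\mathcal{B}_1}\pi_\beta^{\geqslant}\bigr)\cap\pi$. *)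

(* Defs.v *)
From HB Require Import structures.
From mathcomp Require Import all_boot all_order all_algebra.

Set Implicit Arguments.
Unset Strict Implicit.
Unset Printing Implicit Defensive.

Section NestedSets.
Variable T : finType.
Implicit Types (K B N A : {set {set T}}) (V X Y : {set T}).

Definition antichain A : bool :=
  (1 < #|A|) &&
  [forall X in A, forall Y in A, (X != Y) ==> ~~ (X \subset Y)].

Definition power_building_set V B : Prop :=
  [/\ forall X, X \in B -> X != set0 /\ X \subset V,
      forall v, v \in V -> [set v] \in B
    & forall X Y, X \in B -> Y \in B -> X :&: Y != set0 -> X :|: Y \in B].

Definition building_set K B : Prop :=
  B \subset K /\
  forall V, maxset [in K] V -> power_building_set V (B :&: powerset V).

Definition nested_complex K B : {set {set {set T}}} :=
  [set N : {set {set T}} | (N \subset B) &&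
    [forall A : {set {set T}},
       (A \subset N) && antichain A ==> (cover A \in K :\: B)]].

Definition singletons_of B : {set {set T}} := [set b in B | #|b| == 1].
Definition nonsingletons_of B : {set {set T}} := B :\: singletons_of B.

End NestedSets.

Section ComplexC.
Variable n : nat.
Local Notation I := 'I_n.+1.

Definition C0 : {set {set I}} := powerset [set: I] :\ [set: I].
Definition B0 : {set {set I}} := C0 :\ set0.
Definition C1 : {set {set {set I}}} := nested_complex C0 B0.

(* The ground set [n+1] is 'I_n.+1. If i lists i_1, ..., i_(k+l) in this order
   (so that i_j is the entry of index j - 1), then [drop j i] lists
   i_(j+1), ..., i_(k+l), and [chain k i] is the set
   {{i_(k+l), ..., i_1}, ..., {i_(k+l), ..., i_(k-1)}, {i_(k+l), ..., i_k}}. *)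
Definition chain (k : nat) (i : seq I) : {set {set I}} :=
  [set [set x in drop (j : 'I_k) i] | j in 'I_k].

Definition B1 : {set {set {set I}}} :=
  [set b : {set {set I}} |
    [exists k : I, exists l : I, exists i : (k + l).-tuple I,
       [&& 0 < k, k + l <= n, uniq i & b == chain k i]]].

Definition C : {set {set {set {set I}}}} := nested_complex C1 B1.

Definition A1 : {set {set {set I}}} := singletons_of B1.
Definition A2 : {set {set {set I}}} := nonsingletons_of B1.

(* A member b of B1 is a chain for inclusion, so its least and greatest
   members are its intersection and its union. *)
Definition beta_min (b : {set {set I}}) : {set I} := \bigcap_(B in b) B.
Definition beta_max (b : {set {set I}}) : {set I} := \bigcup_(B in b) B.

Lemma beta_min_chain (k : nat) (i : seq I) :
  0 < k -> beta_min (chain k i) = [set x in drop k.-1 i].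
Proof.
case: k => // k _; apply/setP => x; apply/bigcapP/idP => [|].
  by apply; apply/imsetP; exists ord_max.
rewrite inE => xk _ /imsetP[j _ ->]; rewrite inE; move: xk => /=.
have -> : drop k i = drop (k - j) (drop j i) by rewrite drop_drop subnK // -ltnS.
exact: mem_drop.
Qed.

Lemma beta_max_chain (k : nat) (i : seq I) :
  0 < k -> beta_max (chain k i) = [set x in i].
Proof.
case: k => // k _; apply/setP => x; apply/bigcupP/idP => [[_ /imsetP[j _ ->]]|].
  by rewrite !inE => /mem_drop.
by move=> xi; exists [set x in i] => //; apply/imsetP; exists ord0; rewrite ?drop0.
Qed.

Definition B_of (b : {set {set I}}) : {set {set I}} :=
  [set B : {set I} | (B != set0) &&
     [|| B \in b, B \proper beta_min b | beta_max b \proper B]]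
  :|: [set [set v] | v in I].

End ComplexC.

From mathcomp Require Import all_classical all_reals all_analysis.
Import Order.TTheory GRing.Theory Num.Theory.
Local Open Scope classical_set_scope.
Local Open Scope ring_scope.

Section Polytopes.
Variables (R : realType) (N : nat).
Local Notation V := 'rV[R]_N.
Implicit Types (A B P Q F : set V) (a v x y : V).

Definition dot x y : R := \sum_j x 0 j * y 0 j.

Definition conv_hull A : set V := smallest (@convex_set R V) A.

Definition polytope P : Prop :=
  exists A : set V, [/\ finite_set A, A !=set0 & P = conv_hull A].

Definition minksum A B : set V := [set x + y | x in A & y in B].

Lemma minksumA : associative minksum.
Proof.
move=> A B D; apply/seteqP; split=> z /=.
  move=> [x Ax [_ [y By [w Dw <-]] <-]].
  by exists (x + y); [exists x => //; exists y | exists w; rewrite ?addrA].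
move=> [_ [x Ax [y By <-]] [w Dw <-]].
by exists x => //; exists (y + w); [exists y => //; exists w | rewrite addrA].
Qed.

Lemma minksumC : commutative minksum.
Proof.
move=> A B; apply/seteqP; split=> z [x Ax [y By <-]];
  by exists y => //; exists x; rewrite 1?addrC.
Qed.

Lemma minksum0 : left_id [set 0] minksum.
Proof.
move=> A; apply/seteqP; split=> z /=; first by move=> [_ -> [y Ay <-]]; rewrite add0r.
by move=> Az; exists 0 => //; exists z; rewrite ?add0r.
Qed.

HB.instance Definition _ := Monoid.isComLaw.Build (set V) [set 0] minksum
  minksumA minksumC minksum0.

Definition maximizes v P y : Prop :=
  P y /\ forall z, P z -> dot v z <= dot v y.

Definition face P F : Prop :=
  F !=set0 /\ exists v, F = [set y | maximizes v P y].

Definition vertices P : set V := [set x | face P [set x]].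

(* The dimension of a set is that of the direction space of its affine hull;
   here this space is the row space of the matrix U. *)
Definition affine_hull A : set V :=
  [set x | exists m (p : 'I_m -> V) (w : 'I_m -> R),
     [/\ forall i, A (p i), \sum_i w i = 1 & x = \sum_i w i *: p i]].

Definition has_dim A (d : nat) : Prop :=
  exists (x : V) (U : 'M[R]_N),
    affine_hull A = [set x + u | u in [set u : V | (u <= U)%MS]] /\
    \rank U = d.

Definition facet P F : Prop :=
  face P F /\ exists d, has_dim P d.+1 /\ has_dim F d.

Definition normal_cone P F : set V :=
  [set v | forall y, F y -> maximizes v P y].

Definition normal_fan P : set (set V) :=
  [set normal_cone P F | F in face P].

Definition normally_equivalent P Q : Prop := normal_fan P = normal_fan Q.

Definition truncation P F Q : Prop :=
  [/\ face P F, F <> P, ~ facet P F, polytope Q &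
   exists (a : V) (b : R),
     [/\ a != 0, Q = P `&` [set x | b <= dot a x],
         forall v, vertices P v -> ~ F v -> b < dot a v
       & forall v, vertices F v -> ~ (b <= dot a v)]].

Definition truncator_summand P1 P2 : Prop :=
  exists F Q, truncation P1 F Q /\ normally_equivalent (minksum P1 P2) Q.

Fixpoint partial_minksum (S0 : set V) (P : nat -> set V) (i : nat) : set V :=
  if i is j.+1 then minksum (partial_minksum S0 P j) (P j) else S0.

(* The summands are numbered P 0, ..., P (m - 1). *)
Definition truncator_set (S0 : set V) (m : nat) (P : nat -> set V) : Prop :=
  forall i, (i < m)%N -> truncator_summand (partial_minksum S0 P i) (P i).

Definition realises P (T : finType) (K : {set {set T}}) : Prop :=
  exists f : {set T} -> set V,
    set_bij [set` K] (face P) f /\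
    forall s t, s \in K -> t \in K -> (f s `<=` f t <-> t \subset s).

End Polytopes.

Section MinkowskiRealisation.
Variables (R : realType) (n : nat).
Local Notation V := 'rV[R]_n.+1.

Definition simplex (I : {set 'I_n.+1}) : set V :=
  conv_hull [set delta_mx 0 i | i in [set` I]].

(* P is a Minkowski-realisation of the complex L of all nested sets with
   respect to the building set B of the complex K. *)
Definition minkowski_realisation (T : finType) (K B : {set {set T}})
    (L : {set {set {set T}}}) (P : set V) : Prop :=
  [/\ building_set K B /\ L = nested_complex K B,
      polytope P, has_dim P n, realises P L &
      exists phi : {set T} -> set V,
      [/\ forall b, b \in B -> polytope (phi b),
          P = minksum (simplex [set: 'I_n.+1]%SET)
                   (\big[@minksum R n.+1/[set 0]]_(b in B) phi b)
        & forall (m : nat) (x : nat -> {set T}),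
            set_bij `I_m [set` nonsingletons_of B] x ->
            (forall i j, (i < j < m)%N -> (#|x j| <= #|x i|)%N) ->
            truncator_set
              (minksum (simplex [set: 'I_n.+1]%SET)
                    (\big[@minksum R n.+1/[set 0]]_(b in singletons_of B) phi b))
              m (fun i => phi (x i))]].

Definition P_B (b : {set {set 'I_n.+1}}) : set V :=
  \big[@minksum R n.+1/[set 0]]_(B in B_of b) simplex B.

Definition kappa (b : {set {set 'I_n.+1}}) (x : V) : R :=
  \sum_(B in b) \sum_(i in B) x 0 i.

(* The vertex set is finite and nonempty, so that inf is its minimum. *)
Definition m_of (b : {set {set 'I_n.+1}}) : R :=
  inf [set kappa b v | v in vertices (P_B b)].

Definition PA_c (c : R) : set V :=
  minksum (minksum (simplex [set: 'I_n.+1]%SET)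
             (\big[@minksum R n.+1/[set 0]]_(b in A1 n) simplex (finset.cover b)))
       (\big[@minksum R n.+1/[set 0]]_(b in A2 n)
          (P_B b `&` [set x | m_of b + c <= kappa b x])).

Definition kappa_kl (k l : nat) : R :=
  (3 ^+ (k + l + 1) - 3 ^+ (l + 1)) / 2
  + (3 ^+ k - 3 * k%:R) / (3 ^+ n - n%:R - 1).

(* As i_j has index j - 1 in i, its weight min(j, k) is written with j.+1. *)
Definition PA : set V :=
  [set x | \sum_j x 0 j = 3 ^+ n.+1 /\
     forall (k l : nat) (i : (k + l).-tuple 'I_n.+1),
       (0 < k)%N -> (k + l <= n)%N -> uniq i ->
       kappa_kl k l <= \sum_(j < k + l) (minn j.+1 k)%:R * x 0 (tnth i j)].

End MinkowskiRealisation.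

Arguments PA_c R n c : clear implicits.
Arguments PA R n : clear implicits.

(* Main.v *)
(* Up to a constant, every functional on R^(n+1) is minus a sum of a_B 1_B, where
   a >= 0 is supported on a chain of nonempty proper subsets (a flag function).
   The normal fan of a polytope is determined by the relation "the face in
   direction a is contained in the face in direction b", and for a Minkowski sum
   this relation is the intersection of those of the summands.  The simplices
   contribute supp b <= supp a.  The truncated summand of beta contributes
   argmin_beta a <= argmin_beta b: for t = min_beta a, its face in direction a is
   the section, by the truncating hyperplane if t > 0, of the face of P_(B_beta)
   in direction a - t 1_beta.  If all larger chains have been treated already,
   then both adding this summand and truncating the face of beta amount to the
   stellar subdivision of the fan at the ray 1_beta, whence the truncator
   property.  In the end, 1_beta lies in the cone of the sum of the 1_gamma,
   gamma in N, exactly if beta belongs to N, for every nested set N; this gives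
   the face lattice.  The same criterion decides which inequalities of PA_n are
   tight at the following point: along a flag containing N, distribute the second
   differences of 3^k - 3k, one for each interval of the flag, over the members
   of that interval where the number of elements of N containing them is least. *)

(* The main obstacle is that the truncated summand and the truncation of the current sum do not
   reduce a direction by the same amount. For the summand the whole of [min_beta a] is removed from
   [a]. For the current sum the amount stops at the boundary of the star of [1_beta], which depends
   on the chains treated before. The lemma [subdivision] controls this second amount. Its hypotheses
   on unions of tests hold because larger chains come first: the union of [beta] with a treated
   chain that meets it, if it is a chain at all, is a larger member of [B1]. The range of [c] comes
   from integrality. The simplices have integral vertices and [kappa] has integral coefficients, so
   off the lowest face the generators of P_(B_beta) lie at least 1 higher. Hence [c > 0] cuts off
   the lowest face, and [c <= 1] keeps every generator outside it. In [PA] the denominator 3^n - n -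
   1 exceeds 3^n - 3n, so the masses spread over a flag add up to less than 1. An inequality that
   involves a set off the flag gains more than that at the chosen point, so it is never tight
   there. *)
Require Import Defs.
From HB Require Import structures.
From mathcomp Require Import all_boot all_order all_algebra.
From mathcomp Require Import zify ring lra.
Set Implicit Arguments.
Unset Strict Implicit.
Unset Printing Implicit Defensive.
Import Order.TTheory GRing.Theory Num.Theory.
Local Open Scope ring_scope.

(** * Saturated chains and nested sets *)

Section SaturatedChains.
Local Open Scope nat_scope.
Variable n : nat.
Local Notation I := 'I_n.+1.
Local Notation T := {set I}.
Implicit Types (B D E : T) (g h : {set T}) (i : seq I).

Definition set_chain g : bool :=
  [forall B in g, forall D in g, (B \subset D) || (D \subset B)].

Lemma set_chainP g :
  reflect (forall B D, B \in g -> D \in g -> (B \subset D) || (D \subset B))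
    (set_chain g).
Proof.
apply: (iffP forall_inP) => H B.
  by move=> D Bg Dg; have /forall_inP := H B Bg; apply.
by move=> Bg; apply/forall_inP => D; exact: H.
Qed.

Lemma set_chainS g h : g \subset h -> set_chain h -> set_chain g.
Proof.
by move=> /subsetP gh /set_chainP hc; apply/set_chainP => B D /gh ? /gh; exact: hc.
Qed.

Lemma set_chain_leq g B D : set_chain g -> B \in g -> D \in g ->
  #|B| <= #|D| -> B \subset D.
Proof.
move=> /set_chainP gc Bg Dg le; have /orP[//|DB] := gc _ _ Bg Dg.
by have /eqP -> : D == B by rewrite eqEcard DB.
Qed.

Lemma set_chain_inj g B D : set_chain g -> B \in g -> D \in g ->
  #|B| = #|D| -> B = D.
Proof.
move=> gc Bg Dg e; apply/eqP; rewrite eqEsubset.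
by rewrite !(set_chain_leq gc) // e.
Qed.

(** An index-free description of the members of [B1] (see [B1P]): chains whose cardinalities fill an
    interval. It makes unions and subchains tractable without listing elements. *)
Definition saturated g : Prop :=
  [/\ g != set0, forall B, B \in g -> (B != set0) && (B != [set: I]),
      set_chain g & forall B D j, B \in g -> D \in g -> #|B| <= j <= #|D| ->
        exists2 E, E \in g & #|E| = j].

Lemma card_set_drop j i : uniq i -> #|[set x in drop j i]| = (size i - j)%N.
Proof. by move=> ui; rewrite cardsE (card_uniqP _) ?drop_uniq // size_drop. Qed.

Lemma in_chain k i B : reflect (exists2 j, j < k & B = [set x in drop j i])
  (B \in Defs.chain k i).
Proof.
apply: (iffP imsetP) => [[j _ ->]|[j jk ->]]; first by exists j.
by exists (Ordinal jk).
Qed.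

Lemma B1_chainP g : g \in B1 n <-> exists k i,
  [/\ (0 < k <= size i)%N, (size i <= n)%N, uniq i & g = Defs.chain k i].
Proof.
rewrite inE; split.
  move=> /existsP[k /existsP[l /existsP[i /and4P[k0 kl ui /eqP ->]]]].
  by exists k, i; rewrite k0 size_tuple leq_addr.
move=> [k [i [/andP[k0 ki] sn ui ->]]].
have kn : k < n.+1 by rewrite ltnS (leq_trans ki).
have ln : size i - k < n.+1 by rewrite ltnS (leq_trans (leq_subr _ _)).
have si : size i == k + (size i - k) by rewrite subnKC.
apply/existsP; exists (Ordinal kn); apply/existsP; exists (Ordinal ln).
by apply/existsP; exists (Tuple si); rewrite /= k0 subnKC // sn ui eqxx.
Qed.

Lemma chain_saturated k i : 0 < k <= size i -> size i <= n -> uniq i ->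
  saturated (Defs.chain k i).
Proof.
move=> /andP[k0 ki] sn ui; split.
- by apply/set0Pn; exists [set x in drop 0 i]; apply/in_chain; exists 0%N.
- move=> _ /in_chain[j jk ->]; rewrite -cards_eq0 card_set_drop // subn_eq0.
  rewrite -ltnNge (leq_trans jk) //= eqEcard negb_and orbC cardsT card_ord.
  by rewrite -ltnNge card_set_drop // ltnS (leq_trans (leq_subr _ _)).
- have mono a b : a <= b -> [set x in drop b i] \subset [set x in drop a i].
    move=> ab; apply/subsetP => x; rewrite !inE.
    by rewrite -(subnK ab) -drop_drop => /mem_drop.
  apply/set_chainP => _ _ /in_chain[a _ ->] /in_chain[b _ ->].
  by have [/mono->|/ltnW/mono->] := leqP a b; rewrite ?orbT.
- move=> _ _ j /in_chain[a ak ->] /in_chain[b bk ->].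
  rewrite !card_set_drop // => /andP[aj jb].
  exists [set x in drop (size i - j) i]; last by rewrite card_set_drop //; lia.
  by apply/in_chain; exists (size i - j)%N => //; lia.
Qed.

Lemma set_enum_drop0 B : [set x in drop 0 (enum B)] = B.
Proof. by apply/setP => x; rewrite drop0 inE mem_enum. Qed.

(** Induction on the number of members: without its largest member [D] the chain is some
    [chain k i], and [D] has just one further element [z], which is put in front of [i]. *)
Lemma saturated_chain g : saturated g -> exists k i,
  [/\ (0 < k <= size i)%N, (size i <= n)%N, uniq i & g = Defs.chain k i].
Proof.
move: {2}(#|g|) (erefl #|g|) => m; elim: m g => [|m IH] g.
  by move/eqP; rewrite cards_eq0 => /eqP -> [/eqP].
move=> gm [g0 gne gc gs].
have [D0 D0g] := set0Pn _ g0.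
pose D := [arg max_(D > D0 in g) #|D|].
have [Dg Dmax] : D \in g /\ forall E, E \in g -> #|E| <= #|D|.
  by rewrite /D; case: arg_maxnP => // E.
have DnT : #|D| <= n.
  have /andP[_ DT] := gne D Dg; have := max_card (mem D); rewrite card_ord.
  rewrite leq_eqVlt => /predU1P[e|//]; case/eqP: DT; apply/eqP.
  by rewrite eqEcard subsetT cardsT card_ord e /=.
have [gD|gD] := eqVneq (g :\ D) set0.
  exists 1%N, (enum D); rewrite -cardE DnT enum_uniq; split=> //.
    by have /andP[] := gne D Dg; rewrite -card_gt0 => ->.
  apply/setP => B; apply/idP/in_chain => [Bg|[[|//] _ ->]]; last first.
    by rewrite set_enum_drop0.
  exists 0%N => //; rewrite set_enum_drop0; apply/eqP; apply: contraT => BD.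
  by have := in_set0 B; rewrite -gD !inE BD Bg.
have ltD E : E \in g :\ D -> #|E| < #|D|.
  rewrite !inE => /andP[ED Eg]; rewrite ltn_neqAle Dmax // andbT.
  by apply: contra ED => /eqP e; apply/eqP; exact: (set_chain_inj gc Eg Dg e).
have [] := IH (g :\ D).
- by apply/eqP; rewrite -eqSS -gm [X in _ == X](cardsD1 D) Dg.
- split=> //; first by move=> B /setD1P[_]; exact: gne.
    by apply: set_chainS gc; exact: subsetDl.
  move=> B E j Bg Eg jb; have /setD1P[_ Bg'] := Bg; have /setD1P[_ Eg'] := Eg.
  have [F Fg Fj] := gs B E j Bg' Eg' jb; exists F => //.
  rewrite !inE Fg andbT; apply/eqP => FD; have := ltD E Eg.
  by rewrite -FD Fj; case/andP: jb => _; rewrite ltnNge => ->.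
move=> k [i [/andP[k0 ki] sn ui gE]].
pose M := [set x in drop 0 i].
have cM : #|M| = size i by rewrite card_set_drop // subn0.
have Mg' : M \in g :\ D by rewrite gE; apply/in_chain; exists 0%N.
have Mg : M \in g by case/setD1P: Mg'.
have leM E : E \in g :\ D -> #|E| <= #|M|.
  by rewrite gE => /in_chain[j _ ->]; rewrite cM card_set_drop // leq_subr.
(* [M] is the second largest member, so the member that saturation provides one size above it can
   only be [D]. *)
have [E Eg cE] : exists2 E, E \in g & #|E| = #|M|.+1.
  by apply: (gs M D) => //; rewrite leqnSn ltD.
have ED : E = D.
  apply/eqP; apply: contraT => ED; have : E \in g :\ D by rewrite !inE ED.
  by move/leM; rewrite cE ltnn.
have MD : M \subset D by apply: (set_chain_leq gc) => //; rewrite -ED cE.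
have : #|D :\: M| == 1%N.
  by rewrite cardsD (setIidPr MD) -ED cE subSnn.
move=> /cards1P[z zE].
have zD : z \in D /\ z \notin M.
  by have := set11 z; rewrite -zE inE => /andP[].
have DE : D = [set x in z :: i].
  apply/setP => x; rewrite !inE; have := in_set1 x z; rewrite -zE !inE drop0.
  have := subsetP MD x; rewrite !inE drop0.
  by case: (x \in i) => [/(_ isT) -> _|_ /= ->]; rewrite ?orbT ?orbF.
exists k.+1, (z :: i); split=> //=.
- by rewrite -cM -cE ED.
- by rewrite ui andbT; case: zD => _; rewrite inE drop0.
- apply/setP => B; apply/idP/in_chain => [Bg|].
    have [->|BD] := eqVneq B D; first by exists 0%N.
    have : B \in g :\ D by rewrite !inE BD.
    by rewrite gE => /in_chain[j jk ->]; exists j.+1.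
  move=> [[|j] jk ->]; first by rewrite -DE.
  by have /setD1P[] : [set x in drop j i] \in g :\ D by rewrite gE; apply/in_chain; exists j.
Qed.

Lemma B1P g : g \in B1 n <-> saturated g.
Proof.
rewrite B1_chainP; split=> [[k [i [ki sn ui ->]]]|]; last exact: saturated_chain.
exact: chain_saturated.
Qed.

(** The cardinalities of [g] and of [h] form intervals that overlap or are adjacent, so one passes
    from one chain to the other at [B] and [D] without missing a size. *)
Lemma saturatedU g h B D : saturated g -> saturated h -> set_chain (g :|: h) ->
  B \in g -> D \in h -> #|B| <= #|D|.+1 -> #|D| <= #|B|.+1 ->
  saturated (g :|: h).
Proof.
move=> [g0 gne gc gs] [h0 hne hc hs] ghc Bg Dh BD DB; split=> //.
- by apply/set0Pn; exists B; rewrite inE Bg.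
- by move=> E; rewrite inE => /orP[/gne|/hne].
- have sub (X : {set T}) Y j (P : X \subset g :|: h) :
    (exists2 E, E \in X & #|E| = j) -> Y = j -> exists2 E, E \in g :|: h & #|E| = Y.
    by move=> [E EX Ej] ->; exists E => //; exact: (subsetP P).
  have subg := subsetUl g h; have subh := subsetUr g h.
  move=> X Y j; rewrite !inE => /orP[Xg|Xh] /orP[Yg|Yh] /andP[Xj jY].
  + by apply: (sub g _ j) => //; apply: (gs X Y) => //; rewrite Xj.
  + have [jB|Bj] := leqP j #|B|.
      by apply: (sub g _ j) => //; apply: (gs X B) => //; rewrite Xj.
    by apply: (sub h _ j) => //; apply: (hs D Y) => //; rewrite jY (leq_trans DB).
  + have [jD|Dj] := leqP j #|D|.
      by apply: (sub h _ j) => //; apply: (hs X D) => //; rewrite Xj.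
    by apply: (sub g _ j) => //; apply: (gs B Y) => //; rewrite jY (leq_trans BD).
  + by apply: (sub h _ j) => //; apply: (hs X Y) => //; rewrite Xj.
Qed.

Lemma saturated1 B : B != set0 -> B != [set: I] -> saturated [set B].
Proof.
move=> B0 BT; split.
- by apply/set0Pn; exists B; rewrite inE.
- by move=> D /set1P ->; rewrite B0.
- by apply/set_chainP => D E /set1P -> /set1P ->; rewrite subxx.
- move=> D E j /set1P -> /set1P -> /andP[? ?]; exists B; rewrite ?inE //.
  by apply/eqP; rewrite eqn_leq; apply/andP.
Qed.

(** Discrete intermediate value principle: the predicate switches between two members of consecutive
    sizes. Both size bounds are stated because either of [E] and [F] may be the larger one, and
    [touching_B1] asks for both. *)
Lemma saturated_step g (p : pred T) B D : saturated g -> B \in g -> D \in g ->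
  p B -> ~~ p D -> exists E F, [/\ E \in g, F \in g, p E & ~~ p F] /\
    (#|E| <= #|F|.+1 /\ #|F| <= #|E|.+1).
Proof.
move=> gS; have [_ _ gc gs] := gS.
have up (q : pred T) m X Y : X \in g -> Y \in g -> #|Y| = (#|X| + m)%N ->
    q X != q Y -> exists E F, [/\ E \in g, F \in g & q E != q F] /\ #|F| = #|E|.+1.
  elim: m X => [|m IH] X Xg Yg e qXY.
    by move: qXY; rewrite (set_chain_inj gc Xg Yg) ?eqxx // e addn0.
  have [E Eg cE] := gs X Y #|X|.+1 Xg Yg ltac:(lia).
  have [qE|qE] := eqVneq (q X) (q E); last by exists X, E.
  by apply: IH Eg Yg _ _; rewrite ?cE ?e ?addSnnS // -qE.
move=> Bg Dg pB pD.
have [E [F [[Eg Fg EF] cF]]] : exists E F,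
    [/\ E \in g, F \in g & p E != p F] /\ #|F| = #|E|.+1.
  have [BD|DB] := leqP #|B| #|D|.
    by apply: (up p (#|D| - #|B|)%N B D); rewrite ?subnKC // pB (negPf pD).
  by apply: (up p (#|B| - #|D|)%N D B); rewrite ?subnKC ?(ltnW DB) // pB (negPf pD).
have [EF1 FE1] : #|E| <= #|F|.+1 /\ #|F| <= #|E|.+1.
  by rewrite cF; split=> //; do 2 apply: leqW.
by case pE: (p E) EF; case pF: (p F) => // _; [exists E, F|exists F, E];
  rewrite pE pF.
Qed.

End SaturatedChains.

(** * Pairwise criteria for nestedness *)

Section NestedComplexes.
Variable n : nat.
Local Notation I := 'I_n.+1.
Local Notation T := {set I}.
Implicit Types (B D E : T) (g h N V : {set T}) (M : {set {set T}}).

Lemma sub_cover (K : finType) (A : {set {set K}}) X : X \in A -> X \subset cover A.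
Proof. by move=> XA; apply/subsetP => x xX; apply/bigcupP; exists X. Qed.

Lemma in_B0 B : (B \in B0 n) = (B != set0) && (B != [set: I]).
Proof. by rewrite !inE subsetT andbT. Qed.

Lemma antichain2 (K : finType) (A B : {set K}) :
  ~~ (A \subset B) -> ~~ (B \subset A) -> antichain [set A; B].
Proof.
move=> AB BA; have nAB : A != B by apply: contraNneq AB => ->.
rewrite /antichain cards2 nAB /=.
apply/forall_inP => X /set2P[->|->]; apply/forall_inP => Y /set2P[->|->];
  by rewrite ?eqxx // ?AB ?BA ?implybT.
Qed.

(** The only element of [C0] outside [B0] is the empty set, which is not the union of an antichain
    of nonempty sets; so no antichain is allowed at all. *)
Lemma in_C1 N : (N \in C1 n) = (N \subset B0 n) && set_chain N.
Proof.
rewrite inE; case: (boolP (N \subset B0 n)) => //= /subsetP NB.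
apply/forallP/set_chainP => [H B D BN DN|NC A].
  apply: contraT; rewrite negb_or => /andP[BD DB].
  have /implyP := H [set B; D]; rewrite antichain2 // andbT.
  have -> : [set B; D] \subset N by rewrite subUset !sub1set BN.
  move=> /(_ isT); rewrite /B0 !inE => /andP[].
  case: eqP => [e _ _|] /=; last by case: (_ && _).
  have : B \subset set0.
    by rewrite -e; apply/subsetP => x xB; apply/bigcupP; exists B; rewrite ?set21.
  by rewrite subset0 => B0'; have := NB B BN; rewrite in_B0 B0'.
apply/implyP => /andP[/subsetP AN /andP[/card_gt1P[X [Y [XA YA XY]]] /forall_inP H]].
have /forall_inP /(_ Y YA) := H X XA; rewrite XY /= => /negPf nXY.
have /forall_inP /(_ X XA) := H Y YA; rewrite eq_sym XY /= => /negPf nYX.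
by have := NC X Y (AN _ XA) (AN _ YA); rewrite nXY nYX.
Qed.

Lemma B1_C1 g : g \in B1 n -> g \in C1 n.
Proof.
move=> /B1P[_ gne gc _]; rewrite in_C1 gc andbT; apply/subsetP => B /gne.
by rewrite in_B0.
Qed.

Lemma touching_B1 g h B D : g \in B1 n -> h \in B1 n -> set_chain (g :|: h) ->
  B \in g -> D \in h -> (#|B| <= #|D|.+1)%N -> (#|D| <= #|B|.+1)%N ->
  g :|: h \in B1 n.
Proof. by move=> /B1P gS /B1P hS gh Bg Dh BD DB; apply/B1P; exact: saturatedU DB. Qed.

Lemma meeting_B1 g h B : g \in B1 n -> h \in B1 n -> set_chain (g :|: h) ->
  B \in g -> B \in h -> g :|: h \in B1 n.
Proof. by move=> gB hB gh Bg Bh; apply: (touching_B1 gB hB gh Bg Bh); exact: leqnSn. Qed.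

Lemma set1_B1 B : B \in B0 n -> [set B] \in B1 n.
Proof. by rewrite in_B0 => /andP[B0 BT]; apply/B1P; exact: saturated1. Qed.

Lemma building_set_B1 : building_set (C1 n) (B1 n).
Proof.
split; first by apply/subsetP => g; exact: B1_C1.
move=> V /maxsetP[]; rewrite in_C1 => /andP[/subsetP VB Vc] _; split.
- by move=> X /setIP[/B1P[? _ _ _]]; rewrite powersetE.
- move=> v vV; apply/setIP; rewrite powersetE sub1set; split=> //.
  by rewrite set1_B1 // VB.
- move=> X Y /setIP[XB]; rewrite powersetE => XV /setIP[YB]; rewrite powersetE => YV.
  move=> /set0Pn[B /setIP[BX BY]]; apply/setIP; rewrite powersetE subUset XV YV.
  split=> //; apply: (meeting_B1 XB YB _ BX BY); apply: set_chainS Vc.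
  by rewrite subUset XV.
Qed.

(** Pairs suffice. Suppose that the union of an antichain were saturated, and let [g] be its member
    through the smallest set [L], with largest set [D]. Another member has a set larger than [D], so
    some member [k] has a set of size one more than [D]. Then [g] and [k] touch, hence are
    comparable, hence equal, against the choice of [D]. *)
Lemma in_C M : reflect
  [/\ M \subset B1 n, set_chain (cover M) &
      forall g h, g \in M -> h \in M -> g :|: h \in B1 n ->
        (g \subset h) || (h \subset g)] (M \in C n).
Proof.
rewrite inE; apply: (iffP andP) => [[MB /forallP H]|[MB Mc Mn]].
  have H2 g h : g \in M -> h \in M -> ~~ (g \subset h) -> ~~ (h \subset g) ->
      (g :|: h \in C1 n) && (g :|: h \notin B1 n).
    move=> gM hM gh hg; have /implyP := H [set g; h].
    rewrite antichain2 // subUset !sub1set gM hM => /(_ isT).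
    have -> : cover [set g; h] = g :|: h.
      rewrite /cover bigcup_setU !big_set1 //.
    by rewrite inE andbC.
  split=> // [|g h gM hM gh]; last first.
    apply: contraT; rewrite negb_or => /andP[n1 n2].
    by have /andP[_] := H2 g h gM hM n1 n2; rewrite gh.
  apply/set_chainP => B D /bigcupP[g gM Bg] /bigcupP[h hM Dh].
  have gC k : k \in M -> set_chain k.
    by move=> kM; have /B1P[_ _ ? _] := subsetP MB k kM.
  suff /set_chainP : set_chain (g :|: h) by apply; rewrite inE ?Bg ?Dh ?orbT.
  case: (boolP (g \subset h)) => [/setUidPr ->|n1]; first exact: gC.
  case: (boolP (h \subset g)) => [/setUidPl ->|n2]; first exact: gC.
  by have /andP[] := H2 g h gM hM n1 n2; rewrite in_C1 => /andP[].
split=> //; apply/forallP => A; apply/implyP => /andP[AM].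
move=> /andP[/card_gt1P[X [Y [XA YA XY]]] /forall_inP Aa].
have anti g h : g \in A -> h \in A -> (g \subset h) || (h \subset g) -> g = h.
  move=> gA hA; apply: contraTeq => gh; rewrite negb_or.
  have /forall_inP /(_ h hA) /implyP -> // := Aa g gA.
  by have /forall_inP /(_ g gA) /implyP -> // := Aa h hA; rewrite eq_sym.
have AB g : g \in A -> g \in B1 n by move=> gA; rewrite (subsetP MB) // (subsetP AM).
have Ac : set_chain (cover A).
  by apply: set_chainS Mc; apply/bigcupsP => g gA; apply: bigcup_sup; rewrite (subsetP AM).
have cA g B : g \in A -> B \in g -> B \in cover A.
  by move=> gA Bg; apply/bigcupP; exists g.
rewrite inE in_C1 Ac andbT; apply/andP; split; last first.
  apply/bigcupsP => g /AB /B1_C1; by rewrite in_C1 => /andP[].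
apply/negP => /B1P[_ _ _ cs].
have [B0 B0X] : exists B, B \in X by have /B1P[/set0Pn[B ?] _ _ _] := AB _ XA; exists B.
pose L := [arg min_(B < B0 in cover A) #|B|].
have [LA Lmin] : L \in cover A /\ forall E, E \in cover A -> (#|L| <= #|E|)%N.
  by rewrite /L; case: arg_minnP => //; exact: cA B0X.
have /bigcupP[g gA Lg] := LA.
pose D := [arg max_(B > L in g) #|B|].
have [Dg Dmax] : D \in g /\ forall E, E \in g -> (#|E| <= #|D|)%N.
  by rewrite /D; case: arg_maxnP.
have [h hA hg] : exists2 h, h \in A & h != g.
  by have [e|] := eqVneq X g; [exists Y => //; rewrite -e eq_sym|exists X].
have [G Gh Gg] : exists2 G, G \in h & G \notin g.
  apply/subsetPn; apply: contra hg => hg; apply/eqP; apply: anti => //.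
  by rewrite hg.
have DG : (#|D| < #|G|)%N.
  rewrite ltnNge; apply: contra Gg => GD.
  have /B1P[_ _ _ gs] := AB g gA.
  have [|E Eg EG] := gs L D #|G| Lg Dg.
    by rewrite GD andbT; apply: Lmin; exact: cA Gh.
  by rewrite -(set_chain_inj Ac (cA _ _ gA Eg) (cA _ _ hA Gh) EG).
have [E /bigcupP[k kA Ek] cE] := cs D G #|D|.+1 (cA _ _ gA Dg) (cA _ _ hA Gh)
  (introT andP (conj (leqnSn _) DG)).
have gk : g = k.
  apply: anti => //; apply: Mn; rewrite ?(subsetP AM) //.
  apply: (touching_B1 (AB _ gA) (AB _ kA) _ Dg Ek); rewrite ?cE ?leqnSn //.
    apply: set_chainS Ac; rewrite subUset.
    by apply/andP; split; apply: bigcup_sup.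
  exact: leqW.
by have := Dmax E; rewrite gk cE ltnn => /(_ Ek).
Qed.

End NestedComplexes.

(** * The order given by inclusion of minimum sets *)

Section ArgminOrder.
Variables (R : realFieldType) (T : finType).
Implicit Types (a b : T -> R) (g h : {set T}) (test : pred {set T}) (B D : T).

Definition argmin a g B : Prop := B \in g /\ forall D, D \in g -> a B <= a D.

(** Geometrically, [b] lies in the closed cone of the fan that has [a] in its relative interior. *)
Definition argmin_le test b a : Prop :=
  forall g, test g -> forall B, argmin a g B -> argmin b g B.

Definition indicator g B : R := (B \in g)%:R.

Definition add_mul a (t : R) b B : R := a B + t * b B.

Lemma argmin_ex a g : g != set0 -> exists B, argmin a g B.
Proof.
move=> /set0Pn[B0 B0g].
have [B Bg Bmin] := @Order.TotalTheory.arg_minP _ R T B0 (mem g) a B0g.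
by exists B.
Qed.

Lemma argmin_eq a g B D : argmin a g B -> argmin a g D -> a B = a D.
Proof. by move=> [Bg BM] [Dg DM]; apply/eqP; rewrite eq_le BM ?DM. Qed.

Lemma argmin_le_trans test b a c :
  argmin_le test a b -> argmin_le test b c -> argmin_le test a c.
Proof. by move=> ab bc g tg B /(bc g tg); exact: ab. Qed.

Lemma argmin_le_add test a b c (t : R) : 0 <= t ->
  argmin_le test b a -> argmin_le test c a -> argmin_le test (add_mul b t c) a.
Proof.
move=> t0 ba ca g tg B Bm.
have [Bg bB] := ba g tg B Bm; have [_ cB] := ca g tg B Bm.
by split=> // D Dg; rewrite lerD ?bB // ler_wpM2l // cB.
Qed.

(* The functions a with argmin_le test (indicator g) a form the star of the ray
   spanned by the indicator of g; lemma subdivision retracts it along this ray. *)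
Section Subdivision.
Variables (test : pred {set T}) (g : {set T}).
Hypothesis g_neq0 : g != set0.
Hypothesis test_join : forall h, test h -> h :&: g != set0 ->
  ~~ (h \subset g) /\ test (h :|: g).
Hypothesis test_union : forall h k, test h -> test k -> g \subset h ->
  g \subset k -> test (h :|: k).
Variable z : T.
Hypothesis test_z : test (z |: g).
Local Notation le := (argmin_le test).
Local Notation "a '<=g' b" := (forall B, argmin b g B -> argmin a g B)
  (at level 70).

(** On such a test the indicator takes the value 0, so its minimisers, and with them those of [a],
    avoid [g]. *)
Lemma indic_le_argmin a h B : le (indicator g) a -> test h -> ~~ (h \subset g) ->
  argmin a h B -> B \notin g.
Proof.
move=> ga th /subsetPn[D Dh Dg] /(ga h th)[_ /(_ D Dh)].
by rewrite /indicator (negPf Dg) lern0 eqb0.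
Qed.

Lemma not_indic_le a : ~ le (indicator g) a -> exists h B,
  [/\ test h, argmin a h B & B \in g].
Proof.
move=> H.
case: (boolP [exists h : {set T}, test h &&
   [exists B in g, (B \in h) && [forall D in h, a B <= a D]]]) => [|/negP nex].
  move=> /existsP[h /andP[th /exists_inP[B Bg /andP[Bh /forall_inP Bm]]]].
  by exists h, B; split.
case: H => h th B [Bh Bm].
have Bg : B \notin g.
  apply/negP => Bg; apply: nex; apply/existsP; exists h; rewrite th /=.
  by apply/exists_inP; exists B => //; rewrite Bh; apply/forall_inP.
by split=> // D _; rewrite /indicator (negPf Bg) ler0n.
Qed.

(** Off the star of [g] the condition for [g] follows from the tests: if [a] has a minimiser on the
    test [h] that lies in [g], then the minimisers of [a] on [g] are also minimisers on [h :|: g],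
    which is a test. *)
Lemma refine_of_le a b : ~ le (indicator g) a -> le b a -> b <=g a.
Proof.
move=> /not_indic_le[h [B [th Bm Bg]]] ba D [Dg Dm].
have hg : h :&: g != set0 by apply/set0Pn; exists B; rewrite inE Bg andbT; case: Bm.
have [_ thg] := test_join th hg.
split=> // E Eg; have [|_] := ba _ thg D; last by apply; rewrite inE Eg orbT.
split=> [|F]; rewrite inE ?Dg ?orbT // => /orP[Fh|]; last exact: Dm.
by apply: (le_trans (Dm B Bg)); case: Bm => _; apply.
Qed.

(* The amount t of the indicator of g that can be removed from a is limited by
   a test k containing g with the largest possible minimum of a. *)
Lemma subdivision a : (forall B, 0 <= a B) -> a z = 0 -> le (indicator g) a ->
  exists t, [/\ 0 < t, forall B, B \in g -> t <= a B,
    le (add_mul a (- t) (indicator g)) a,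
    ~ le (indicator g) (add_mul a (- t) (indicator g)) &
    forall b, (forall B, 0 <= b B) -> le b a -> b <=g a ->
      exists s, [/\ 0 <= s, forall B, B \in g -> s <= b B &
        le (add_mul b (- s) (indicator g)) (add_mul a (- t) (indicator g))]].
Proof.
move=> a0 az ga.
have [Z Zm] := argmin_ex a g_neq0; have [Zg ZM] := Zm.
pose P (hB : {set T} * T) := [&& test hB.1, g \subset hB.1, hB.2 \in hB.1 &
  [forall D in hB.1, a hB.2 <= a D]].
have zg0 : P (z |: g, z).
  rewrite /P test_z subsetUr setU11; apply/forall_inP => D _.
  by rewrite az a0.
have [[k K] kP kmax] := @Order.TotalTheory.arg_maxP _ R _ (z |: g, z) P
  (fun hB => a hB.2) zg0.
have /and4P[/= tk gk Kk /forall_inP KM] := kP.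
have Km : argmin a k K by split.
have kmaxE h B : test h -> g \subset h -> argmin a h B -> a B <= a K.
  move=> th gh [Bh Bm]; apply: (kmax (h, B)).
  by rewrite /P /= th gh Bh; apply/forall_inP.
have meet h B : B \in h -> B \in g -> h :&: g != set0.
  by move=> Bh Bg; apply/set0Pn; exists B; rewrite inE Bh.
have nsub h : test h -> g \subset h -> ~~ (h \subset g).
  by move=> th gh; case: (test_join th (meet h Z (subsetP gh _ Zg) Zg)).
have out h B : test h -> h :&: g != set0 -> argmin a h B -> B \notin g.
  by move=> th hg; apply: indic_le_argmin => //; case: (test_join th hg).
have kg : k :&: g != set0 by apply: (meet k Z) => //; exact: (subsetP gk).
have Kg : K \notin g by exact: out Km.
have joinm h B : test h -> h :&: g != set0 -> argmin a h B ->
    argmin a (h :|: g) B.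
  move=> th hg Bm; have [_ thg] := test_join th hg.
  have hgn0 : h :|: g != set0 by apply/set0Pn; exists Z; rewrite inE Zg orbT.
  have [E Em] := argmin_ex a hgn0.
  have hgg : (h :|: g) :&: g != set0.
    by apply: (meet _ Z); rewrite // inE Zg orbT.
  have /negPf Eg := out _ _ thg hgg Em.
  have [Bh BM] := Bm; split; first by rewrite inE Bh.
  move=> D Dhg; have [Ehg EM] := Em; apply: le_trans (EM D Dhg).
  by apply: BM; move: Ehg; rewrite inE Eg orbF.
have ZK : a K < a Z.
  rewrite lt_neqAle; case: Km => _ /(_ Z) -> //; last exact: (subsetP gk).
  rewrite andbT; apply/eqP => e; have : Z \notin g; last by rewrite Zg.
  apply: out kg _ => //; split; first exact: (subsetP gk).
  by move=> D /KM; rewrite e.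
(* Removing [t] lowers the minimum over [g] to [a K]. This gives [k] a minimiser in [g], so the star
   is left; it does not fall below the minimum of any test containing [g], since [a K] is the
   largest of these. *)
pose t := a Z - a K.
have aE B : add_mul a (- t) (indicator g) B = if B \in g then a B - t else a B.
  by rewrite /add_mul /indicator; case: ifP => _; rewrite ?mulr1 ?mulr0 ?addr0.
have K0 : 0 <= a K := a0 K.
exists t; split.
- by rewrite subr_gt0.
- by move=> B Bg; have := ZM B Bg; rewrite /t; lra.
- move=> h th B Bm; have [Bh BM] := Bm; split=> // D Dh; rewrite !aE.
  case: (boolP (D \in g)) => Dg; last first.
    case: ifP => Bg; last exact: BM.
    by have := out _ _ th (meet h B Bh Bg) Bm; rewrite Bg.
  have hg := meet h D Dh Dg; rewrite (negPf (out _ _ th hg Bm)).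
  have [_ thg] := test_join th hg.
  have := kmaxE _ _ thg (subsetUr _ _) (joinm _ _ th hg Bm).
  by have := ZM D Dg; rewrite /t; lra.
- move=> H; have : argmin (add_mul a (- t) (indicator g)) k Z.
    split; first exact: (subsetP gk).
    move=> D Dk; rewrite !aE Zg /t subKr; have := KM D Dk.
    by case: ifP => // Dg _; have := ZM D Dg; lra.
  by move/(indic_le_argmin H tk (nsub _ tk gk)); rewrite Zg.
- move=> b b0 ba bg.
  have bZ : argmin b g Z := bg Z Zm.
  have bK : argmin b k K := ba k tk K Km.
  have bKZ : b K <= b Z by case: bK => _; apply; exact: (subsetP gk).
  (* [Z] and [K] also minimise [b] on [g] and on [k], so the amount for [b] is read off at the same
     places. *)
  pose s := b Z - b K.
  have bE B : add_mul b (- s) (indicator g) B = if B \in g then b B - s else b B.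
    by rewrite /add_mul /indicator; case: ifP => _; rewrite ?mulr1 ?mulr0 ?addr0.
  have b0K : 0 <= b K := b0 K.
  exists s; split; first by rewrite subr_ge0.
    by move=> B Bg; case: bZ => _ /(_ B Bg); rewrite /s; lra.
  move=> h th B [Bh BM]; split=> // D Dh.
  have BMD E : E \in h -> (if B \in g then a B - t else a B) <=
      (if E \in g then a E - t else a E) by move=> Eh; rewrite -!aE; exact: BM.
  case: (boolP (h :&: g == set0)) => [/eqP hg0|hg].
    have ng E : E \in h -> E \in g = false.
      by move=> Eh; apply/negP => Eg; have := in_set0 E; rewrite -hg0 inE Eh Eg.
    rewrite !bE !ng //; have [|_] := ba h th B; last by apply.
    by split=> // E Eh; have := BMD E Eh; rewrite !ng.
  have [nhg thg] := test_join th hg.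
  have [C Cm] : exists C, argmin a h C.
    by apply: argmin_ex; apply/set0Pn; exists B.
  have Cg := out _ _ th hg Cm; have [Ch CM] := Cm.
  have CK := kmaxE _ _ thg (subsetUr _ _) (joinm _ _ th hg Cm).
  have bZle E : E \in g -> b Z <= b E by case: bZ => _; apply.
  (* [b C] and [b K] belong to different tests; the union of these tests is again a test and allows
     them to be compared. *)
  have thk := test_union thg tk (subsetUr h g) gk.
  have Cmk : argmin a (h :|: g :|: k) C.
    split; first by rewrite !inE Ch.
    move=> E; rewrite inE => /orP[|Ek].
      by case: (joinm _ _ th hg Cm) => _; apply.
    by apply: le_trans CK _; exact: KM.
  have bCm : argmin b (h :|: g :|: k) C := ba _ thk _ Cmk.
  have bCK : b C <= b K by case: bCm => _; apply; rewrite inE Kk orbT.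
  have bC E : E \in h -> b C <= b E by move=> Eh; case: bCm => _; apply; rewrite !inE Eh.
  have BC := BMD C Ch; rewrite (negPf Cg) in BC.
  (* A minimiser of the reduced [a] inside [g] forces [a B = a Z] and [a C = a K]; the corresponding
     equalities for [b] follow from the conditions on [g] and on the joint test. *)
  rewrite !bE; case: (boolP (B \in g)) BC => Bg BC.
    have eZ : a B = a Z by apply/eqP; rewrite eq_le ZM // andbT; move: BC; rewrite /t; lra.
    have eC : a C = a K.
      by apply/eqP; rewrite eq_le CK; move: BC; rewrite /t; lra.
    have bBZ : b B = b Z.
      by apply: argmin_eq bZ; apply: bg; split=> // E Eg; rewrite eZ ZM.
    have bKC : b K = b C.
      apply: argmin_eq bCm; apply: (ba _ thk); split; first by rewrite inE Kk orbT.
      by move=> E /(proj2 Cmk); rewrite eC.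
    rewrite bBZ /s subKr bKC; case: ifP => [Dg|_]; last exact: bC.
    by have := bZle D Dg; lra.
  have eBC : a B = a C by apply/eqP; rewrite eq_le BC CM.
  have bBC : b B = b C.
    apply: argmin_eq bCm; apply: (ba _ thk); split; first by rewrite !inE Bh.
    by move=> E /(proj2 Cmk); rewrite eBC.
  rewrite bBC; case: ifP => [Dg|_]; last exact: bC.
  by have := bZle D Dg; rewrite /s; lra.
Qed.

End Subdivision.

End ArgminOrder.

(** * Flag functions *)

Section FlagFunctions.
Variables (R : realFieldType) (n : nat).
Local Notation I := 'I_n.+1.
Local Notation T := {set I}.
Implicit Types (a b : T -> R) (B D E : T) (g h : {set T}) (M X : {set {set T}}).

Definition flag_fun a : Prop :=
  [/\ forall B, 0 <= a B,
      forall B D, 0 < a B -> 0 < a D -> (B \subset D) || (D \subset B),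
      a set0 = 0 & a [set: I] = 0].

(* Besides the members of X, families that contain the empty set or are not
   chains: there the minimum of a flag function is 0. *)
Definition test_set X g : bool := [|| g \in X, set0 \in g | ~~ set_chain g].

Lemma pos_neq0 a B : (forall D, 0 <= a D) -> (0 < a B) = (a B != 0).
Proof. by move=> a0; rewrite lt_neqAle a0 andbT eq_sym. Qed.

Lemma flag_funS a b : flag_fun a -> (forall B, 0 <= b B) ->
  (forall B, a B = 0 -> b B = 0) -> flag_fun b.
Proof.
move=> [a0 ac a00 aT] b0 ba; split=> // [B D|| ]; try exact: ba.
by rewrite !pos_neq0 // => bB bD; apply: ac; rewrite pos_neq0 //;
  [apply: contra_neq bB|apply: contra_neq bD]; apply: ba.
Qed.

Lemma argmin_le_support X a b : flag_fun a -> flag_fun b ->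
  argmin_le (test_set X) b a -> forall B, a B = 0 -> b B = 0.
Proof.
move=> [a0 _ a00 _] [b0 _ b00 _] ba B aB.
(* As [a] is nonnegative, a zero [B] of [a] minimises it on this pair; then [b B] is at most
   [b set0], which is 0. *)
have [||_ H] := ba [set B; set0] _ B.
- by rewrite /test_set set22 orbT.
- by split=> [|D]; rewrite ?set21 // aB.
- by apply/eqP; rewrite eq_le b0 andbT -b00; apply: H; rewrite set22.
Qed.

Lemma argmin_leP X a b : flag_fun a -> flag_fun b ->
  argmin_le (test_set X) b a <->
  (forall B, a B = 0 -> b B = 0) /\
  (forall g, g \in X -> forall B, argmin a g B -> argmin b g B).
Proof.
move=> aF bF; split=> [ba|[sup ba] g].
  split; first exact: argmin_le_support ba.
  by move=> g gX; apply: ba; rewrite /test_set gX.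
have [a0 ac a00 _] := aF; have [b0 _ b00 _] := bF.
case/or3P => [/ba //|g0|gc] B [Bg Bm].
  have bB : b B = 0 by apply: sup; apply/eqP; rewrite eq_le a0 -{1}a00 Bm.
  by split=> // D _; rewrite bB.
suff aB : a B = 0 by split=> // D _; rewrite sup.
case: (boolP [exists D in g, a D == 0]) => [/exists_inP[D Dg /eqP aD]|].
  by apply/eqP; rewrite eq_le a0 -{1}aD Bm.
move=> /exists_inPn nz; case/negP: gc; apply/set_chainP => D E Dg Eg.
by apply: ac; rewrite pos_neq0 // nz.
Qed.

Lemma flag_fun_indic g : g \in B1 n -> flag_fun (indicator R g).
Proof.
move=> /B1P[_ gne /set_chainP gc _].
have pos B : 0 < indicator R g B -> B \in g by rewrite /indicator ltr0n lt0b.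
split=> [B|B D /pos Bg /pos Dg||]; [exact: ler0n|exact: gc| |];
  by rewrite /indicator; case: (boolP (_ \in g)) => // /gne; rewrite eqxx ?andbF.
Qed.

(** The coordinate at [i] of the functional that is the sum of the a_B 1_B. *)
Definition rank_of a (i : I) : R := \sum_(B : T | i \in B) a B.

(** A set of the support that contains [j] is not inside [D], so it contains [D] and thus [i]; the
    set [D] itself makes the inequality strict. *)
Lemma rank_of_sep a D i j : flag_fun a -> 0 < a D -> i \in D -> j \notin D ->
  rank_of a j < rank_of a i.
Proof.
move=> [a0 ac _ _] aD iD jD; rewrite /rank_of [ltRHS](bigD1 D) //=.
rewrite -[ltLHS]add0r ltr_leD //.
rewrite big_mkcond [leRHS]big_mkcond /=; apply: ler_sum => B _.
case: (boolP (j \in B)) => jB; last by case: ifP.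
case: (boolP ((i \in B) && (B != D))) => // nB.
rewrite leNgt; apply: contra nB => aB.
have BD : B != D by apply: contraNneq jD => <-.
rewrite BD andbT; have /orP[BsD|/subsetP/(_ i iD) //] := ac B D aB aD.
by case/negP: jD; exact: (subsetP BsD).
Qed.

(** A set containing [i] but not [j] would separate them strictly if [a] were positive there; so
    [a], and with it [b], vanishes on all such sets. *)
Lemma rank_of_le a b i j : flag_fun a -> (forall B, 0 <= b B) ->
  (forall B, a B = 0 -> b B = 0) ->
  rank_of a i <= rank_of a j -> rank_of b i <= rank_of b j.
Proof.
move=> aF b0 sup ij; have [a0 _ _ _] := aF.
rewrite /rank_of big_mkcond [leRHS]big_mkcond /=; apply: ler_sum => B _.
case: ifP => iB; case: ifP => jB //.
rewrite sup //; apply/eqP; move: ij; apply: contraTT; rewrite -pos_neq0 // -ltNge.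
by move=> aB; apply: (rank_of_sep aF aB iB); rewrite jB.
Qed.

(** Converse of [rank_of_sep]. Take [i] lowest in [D] and [j] highest outside. If [i] were strictly
    above [j], some set of the support would separate them, and by [rank_of_sep] that set could only
    be [D]. *)
Lemma rank_of_unsep a D : flag_fun a -> D != set0 -> D != [set: I] -> a D = 0 ->
  exists i j, [/\ i \in D, j \notin D & rank_of a i <= rank_of a j].
Proof.
move=> aF /set0Pn[i0 i0D] DT aD.
have [j0 j0D] : exists j, j \notin D.
  by move: DT; rewrite -subTset => /subsetPn[j _ jD]; exists j.
have [i iD imin] := @Order.TotalTheory.arg_minP _ R _ i0 (mem D) (rank_of a) i0D.
have j0C : j0 \in ~: D by rewrite inE.
have [j jC jmax] := @Order.TotalTheory.arg_maxP _ R _ j0 (mem (~: D)) (rank_of a) j0C.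
have {}jC : j \in ~: D by []. have jD : j \notin D by rewrite inE in jC.
exists i, j; split=> //; rewrite leNgt; apply/negP => ji.
have [E [aE iE jE]] : exists E, [/\ 0 < a E, i \in E & j \notin E].
  case: (boolP [exists E : T, [&& 0 < a E, i \in E & j \notin E]]).
    by move=> /existsP[E /and3P[? ? ?]]; exists E.
  move=> /existsPn H; move: ji; rewrite ltNge => /negP[].
  have [a0 _ _ _] := aF.
  rewrite /rank_of big_mkcond [leRHS]big_mkcond /=; apply: ler_sum => B _.
  case: ifP => iB; case: ifP => jB //.
  by have := H B; rewrite iB jB !andbT -leNgt.
suff ED : E = D by rewrite ED aD ltxx in aE.
apply/setP => k; apply/idP/idP => [kE|kD]; apply: contraT => nk.
  have := rank_of_sep aF aE kE jE; rewrite ltNge => /negP[]; apply: jmax.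
  by change (k \in ~: D); rewrite inE.
by have := rank_of_sep aF aE iE nk; rewrite ltNge => /negP[]; exact: imin.
Qed.

(** The sum of the rays of the cone of [M] ([count_ofE]), which serves as its interior point. *)
Definition count_of M B : R := #|[set g in M | B \in g]|%:R.

Lemma count_ofE M B : count_of M B = \sum_(g in M) indicator R g B.
Proof.
rewrite /count_of -sum1_card natr_sum big_mkcond [RHS]big_mkcond /=.
apply: eq_bigr => g _; rewrite inE /indicator; case: (g \in M) => //=.
by case: (B \in g).
Qed.

Lemma count_of_gt0 M B : (0 < count_of M B) = (B \in cover M).
Proof.
rewrite /count_of ltr0n card_gt0; apply/set0Pn/bigcupP => [[g]|[g gM Bg]].
  by rewrite inE => /andP[gM Bg]; exists g.
by exists g; rewrite inE gM.
Qed.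

Lemma flag_fun_count M : M \in C n -> flag_fun (count_of M).
Proof.
move=> /in_C[MB Mc _].
have c0 B : 0 <= count_of M B by exact: ler0n.
have z B : B \notin B0 n -> count_of M B = 0.
  move=> nB; apply/eqP; apply: contraNT nB; rewrite -pos_neq0 // count_of_gt0.
  move=> /bigcupP[g gM Bg]; have /B1P[_ gne _ _] := subsetP MB g gM.
  by rewrite in_B0 gne.
split=> // [B D||]; last 2 first.
- by apply: z; rewrite in_B0 eqxx.
- by apply: z; rewrite in_B0 eqxx andbF.
by rewrite !count_of_gt0 => BM DM; have /set_chainP := Mc; apply.
Qed.

(** A member of [M] through [D] touches [g], hence is comparable with it, hence contains it. So it
    is counted at [E] too, where [g] itself is counted in addition. *)
Lemma count_of_neighbour M g B D : M \in C n -> g \in M -> B \in g ->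
  D \in cover M -> D \notin g -> (#|D| <= #|B|.+1)%N -> (#|B| <= #|D|.+1)%N ->
  forall E, E \in g -> count_of M D < count_of M E.
Proof.
move=> /in_C[MB Mc Mn] gM Bg DM Dg DB BD E Eg.
rewrite /count_of ltr_nat; apply: proper_card; apply/properP; split; last first.
  by exists g; rewrite !inE gM ?Eg ?(negPf Dg).
apply/subsetP => h; rewrite !inE => /andP[hM Dh]; rewrite hM /=.
have /orP[/subsetP -> //|/subsetP hg] : (g \subset h) || (h \subset g).
  apply: Mn => //; apply: (touching_B1 _ _ _ Bg Dh) => //; try exact: (subsetP MB).
  apply: set_chainS Mc; rewrite subUset.
  by apply/andP; split; apply: bigcup_sup.
by rewrite hg in Dg.
Qed.

(** If [g] is in [M], a minimiser in [g] on a test that leaves [g] would have a neighbour with a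
    smaller count. Conversely, let [B] minimise the count on [g], and let [h] be the smallest member
    of [M] through [B]. Then [h] contains [g]; if it were larger, enlarging [g] by an adjacent set
    [F] of [h] would give a test in [A2] that fails. *)
Lemma indic_le_count M g : M \in C n -> g \in B1 n ->
  argmin_le (test_set (A2 n)) (indicator R g) (count_of M) <-> g \in M.
Proof.
move=> MC gB; have /in_C[MB Mc Mn] := MC.
have [/set0Pn[Bg0 Bg0g] gne gc gs] : saturated g by exact/B1P.
rewrite argmin_leP; [|exact: flag_fun_count|exact: flag_fun_indic].
have c0 B : 0 <= count_of M B by exact: ler0n.
have nM B : B \notin cover M -> count_of M B = 0.
  by rewrite -count_of_gt0 pos_neq0 // negbK => /eqP.
split=> [[sup H]|gM]; last first.
  split=> [B /eqP|h hA B [Bh Bm]].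
    rewrite /indicator; case: (boolP (B \in g)) => // Bg; apply: contraTeq => _.
    by rewrite -pos_neq0 // count_of_gt0; apply/bigcupP; exists g.
  split=> // D Dh; rewrite /indicator; case: (boolP (B \in g)) => Bg; last by rewrite ler0n.
  case: (boolP (D \in g)) => // Dg.
  have Bp : 0 < count_of M B by rewrite count_of_gt0; apply/bigcupP; exists g.
  have hM E : E \in h -> E \in cover M.
    by move=> Eh; rewrite -count_of_gt0 (lt_le_trans Bp) // Bm.
  have hS : saturated h by apply/B1P; move: hA; rewrite inE => /andP[].
  have [E [F [[Eh Fh Eg Fg] [EF FE]]]] := saturated_step (p := mem g) hS Bh Dh Bg Dg.
  have := count_of_neighbour MC gM Eg (hM _ Fh) Fg FE EF Bg.
  by rewrite ltNge Bm.
have gcov B : B \in g -> B \in cover M.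
  move=> Bg; rewrite -count_of_gt0 pos_neq0 //; apply/eqP => /sup.
  by rewrite /indicator Bg => /eqP; rewrite oner_eq0.
have [B [Bg Bm]] : exists B, argmin (count_of M) g B.
  by apply: argmin_ex; apply/set0Pn; exists Bg0.
(* Otherwise [g] has a set next to [h] but outside it, with a smaller count than [B]. *)
have sup_g h : h \in M -> B \in h -> g \subset h.
  move=> hM Bh; apply: contraT => /subsetPn[D Dg Dh].
  have gS : saturated g by apply/B1P.
  have [E [F [[Eg Fg Eh Fh] [EF FE]]]] := saturated_step (p := mem h) gS Bg Dg Bh Dh.
  have := count_of_neighbour MC hM Eh (gcov _ Fg) Fh FE EF Bh.
  by rewrite ltNge Bm.
have /bigcupP[h0 h0M Bh0] := gcov B Bg.
pose h := [arg min_(k < h0 | (k \in M) && (B \in k)) #|k|].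
have [/andP[hM Bh] hmin] : ((h \in M) && (B \in h)) /\
    forall k, k \in M -> B \in k -> (#|h| <= #|k|)%N.
  rewrite /h; case: arg_minnP => [|k kP kmin]; first by rewrite h0M.
  by split=> // k' k'M Bk'; apply: kmin; rewrite k'M.
have gh := sup_g h hM Bh.
have [hg|/subsetPn[D Dh Dg]] := boolP (h \subset g).
  by have -> : g = h by apply/eqP; rewrite eqEsubset gh.
have hS : saturated h by apply/B1P; exact: (subsetP MB).
have [E [F [[Eh Fh Eg Fg] [EF FE]]]] := saturated_step (p := mem g) hS Bh Dh Bg Dg.
have {}Fg : F \notin g by [].
(* Members of [M] through [B] meet, so nestedness makes them comparable, and [h] is the least. Hence
   the count at [F] is no smaller than at [B]. *)
have hsub k : k \in M -> B \in k -> h \subset k.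
  move=> kM Bk; have kh : k :|: h \in B1 n.
    apply: (meeting_B1 _ _ _ Bk Bh); try exact: (subsetP MB).
    apply: set_chainS Mc; rewrite subUset; apply/andP.
    by split; apply: sub_cover.
  have /orP[kh'|//] := Mn _ _ kM hM kh.
  by have /eqP -> : k == h by rewrite eqEcard kh' hmin.
have cF : count_of M B <= count_of M F.
  rewrite /count_of ler_nat; apply: subset_leq_card; apply/subsetP => k.
  by rewrite !inE => /andP[kM Bk]; rewrite kM (subsetP (hsub k kM Bk)).
have FB0 : F \in B0 n by rewrite in_B0; case: hS => _ -> .
have gF : g :|: [set F] \in B1 n.
  apply: (touching_B1 gB (set1_B1 FB0) _ Eg (set11 _)) => //.
  by apply: set_chainS (let: And4 _ _ c _ := hS in c); rewrite subUset gh sub1set.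
have gFA : g :|: [set F] \in A2 n.
  rewrite inE gF andbT inE gF /= setUC cardsU1 Fg.
  by rewrite eqSS cards_eq0; apply/set0Pn; exists B.
have Bm' : argmin (count_of M) (g :|: [set F]) B.
  by split; [rewrite inE Bg|move=> D'; rewrite !inE => /orP[/Bm|/eqP ->]].
have [_ /(_ F)] := H _ gFA B Bm'.
by rewrite /indicator !inE eqxx orbT Bg (negPf Fg) lern0 => /(_ isT).
Qed.

Lemma count_of_sub M M' : M \in C n -> M' \in C n ->
  argmin_le (test_set (A2 n)) (count_of M') (count_of M) <-> M' \subset M.
Proof.
move=> MC M'C; split=> [le|/subsetP sub].
  apply/subsetP => g gM'; have /in_C[MB _ _] := M'C.
  apply/(indic_le_count MC); first exact: (subsetP MB).
  apply: argmin_le_trans le; apply/(indic_le_count M'C) => //.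
  exact: (subsetP MB).
move=> h th B Bm; split; first by case: Bm.
move=> D Dh; rewrite !count_ofE; apply: ler_sum => g gM'.
have /in_C[MB _ _] := M'C.
have /(indic_le_count MC (subsetP MB g gM')) := sub g gM'.
by move=> /(_ h th B Bm)[_]; exact.
Qed.

(** Greedy: subtract the minimum along a maximal saturated chain [g] in the support. The support
    shrinks, and by maximality a later chain whose union with [g] is in [B1] lies inside [g], which
    gives nestedness. *)
Lemma flag_fun_decomp a : flag_fun a -> exists M (l : {set T} -> R),
  [/\ M \in C n, forall g, g \in M -> 0 < l g &
      forall B, a B = \sum_(g in M) l g * indicator R g B].
Proof.
move=> aF.
(* The additional clause keeps the later chains inside the support in which [g] is maximal. *)
suff [M [l [MC lp aE _]]] : exists M (l : {set T} -> R),
    [/\ M \in C n, forall g, g \in M -> 0 < l g,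
      forall B, a B = \sum_(g in M) l g * indicator R g B &
      forall B, B \in cover M -> 0 < a B] by exists M, l; split.
move: {2}(#|_|) (leqnn #|[set B | 0 < a B]|) => m.
elim: m a aF => [|m IH] a aF.
  rewrite leqn0 cards_eq0 => /eqP a0; exists set0, (fun=> 1); split=> //.
  - apply/in_C; split; rewrite ?sub0set //; last by move=> g; rewrite inE.
    by apply/set_chainP => B D; rewrite /cover big_set0 inE.
  - move=> B; rewrite big_set0; have [ap _ _ _] := aF.
    by apply/eqP; rewrite eq_le ap andbT leNgt; have := in_set0 B; rewrite -a0 inE => ->.
  - by move=> B; rewrite /cover big_set0 inE.
have [ap ac a00 aT] := aF; set S := [set B | 0 < a B] => cS.
have Sc : set_chain S by apply/set_chainP => B D; rewrite !inE; exact: ac.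
have [S0|/set0Pn[Y YS]] := eqVneq S set0.
  by apply: IH => //; rewrite -/S S0 cards0.
have SB B : B \in S -> B \in B0 n.
  rewrite inE in_B0 => aB; apply/andP; split; apply: contraTneq aB => ->;
  by rewrite ?a00 ?aT ltxx.
pose p g := (g \in B1 n) && (g \subset S).
have p0 : p [set Y] by rewrite /p set1_B1 ?SB // sub1set.
have [g /maxsetP[/andP[gB gS] gmax] _] := maxset_exists p0.
have gn0 : g != set0 by have /B1P[] := gB.
have [Z [Zg Zm]] := argmin_ex a gn0.
have aZ : 0 < a Z by have := subsetP gS Z Zg; rewrite inE.
pose a' := add_mul a (- a Z) (indicator R g).
have a'E B : a' B = if B \in g then a B - a Z else a B.
  by rewrite /a' /add_mul /indicator; case: ifP => _; rewrite ?mulr1 ?mulr0 ?addr0.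
have a'0 B : 0 <= a' B by rewrite a'E; case: ifP => // Bg; rewrite subr_ge0 Zm.
have a'a B : a B = 0 -> a' B = 0.
  rewrite a'E; case: ifP => // Bg aB; have := subsetP gS B Bg.
  by rewrite inE aB ltxx.
have a'F : flag_fun a' := flag_funS aF a'0 a'a.
have S'S : [set B | 0 < a' B] \proper S.
  apply/properP; split; last first.
    by exists Z; [rewrite inE|rewrite inE a'E Zg subrr ltxx].
  apply/subsetP => B; rewrite !inE !pos_neq0 //; apply: contra_neq; exact: a'a.
have [|M [l [MC lp a'D Mp]]] := IH a' a'F.
  by rewrite -ltnS; apply: leq_trans cS; exact: proper_card.
have /in_C[MB Mc Mn] := MC.
have gM : g \notin M.
  apply/negP => gM; have : Z \in cover M by apply/bigcupP; exists g.
  by move/Mp; rewrite a'E Zg subrr ltxx.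
have covS : cover (g |: M) \subset S.
  rewrite /cover bigcup_setU big_set1 subUset gS /=; apply/subsetP => B BM.
  by apply: (subsetP (proper_sub S'S)); rewrite inE; exact: Mp.
exists (g |: M), (fun h => if h == g then a Z else l h); split.
- apply/in_C; split.
  + by rewrite subUset sub1set gB.
  + exact: set_chainS Sc.
  + have gcmp h : h \in M -> g :|: h \in B1 n -> h \subset g.
      move=> hM gh; suff -> : g = g :|: h by exact: subsetUr.
      apply/esym/gmax; rewrite ?subsetUl // /p gh /= subUset gS.
      by apply: subset_trans covS; apply: bigcup_sup; rewrite inE hM orbT.
    move=> h k /setU1P[->|hM] /setU1P[->|kM].
    * by rewrite subxx.
    * by move/(gcmp k kM) => ->; rewrite orbT.
    * by rewrite setUC => /(gcmp h hM) ->.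
    * exact: Mn.
- by move=> h; case: ifP => [//|hg]; rewrite !inE hg; exact: lp.
- move=> B; rewrite big_setU1 //= eqxx.
  have -> : a B = a Z * indicator R g B + a' B by rewrite /a' /add_mul; ring.
  congr (_ + _); rewrite a'D; apply: eq_bigr => h hM.
  by case: eqP => // hg; rewrite -hg hM in gM.
- by move=> B BM; have := subsetP covS B BM; rewrite inE.
Qed.

End FlagFunctions.

Section FlagDecomposition.
Variables (R : realFieldType) (n : nat).
Local Notation I := 'I_n.+1.
Local Notation T := {set I}.
Implicit Types (a b : T -> R) (B D E : T) (g h : {set T}) (M : {set {set T}})
  (l : {set T} -> R).
Local Notation le := (argmin_le (test_set (A2 n))).

(** The positive coefficients do not affect the cone: on each test a minimiser of the count
    minimises all indicators at once, so a minimiser of [a] must reach equality in every term. *)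
Lemma le_count_decomp M l a : M \in C n -> (forall g, g \in M -> 0 < l g) ->
  (forall B, a B = \sum_(g in M) l g * indicator R g B) ->
  le a (count_of R M) /\ le (count_of R M) a.
Proof.
move=> MC lp aE; have /in_C[MB _ _] := MC.
have iM g : g \in M -> le (indicator R g) (count_of R M).
  by move=> gM; apply/indic_le_count => //; exact: (subsetP MB).
have aM : le a (count_of R M).
  move=> h th B Bm; split=> [|D Dh]; first by case: Bm.
  rewrite !aE; apply: ler_sum => g gM; rewrite ler_pM2l ?lp //.
  by have [_] := iM g gM h th B Bm; apply.
split=> // h th B [Bh BM].
have [D Dm] : exists D, argmin (count_of R M) h D.
  by apply: argmin_ex; apply/set0Pn; exists B.
have Dg g : g \in M -> argmin (indicator R g) h D by move=> gM; exact: iM Dm.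
have [Dh _] := Dm; have /eqP : a B - a D = 0.
  by apply/eqP; rewrite subr_eq0 eq_le BM // (proj2 (aM h th D Dm)).
rewrite !aE -sumrB; under eq_bigr do rewrite -mulrBr.
rewrite psumr_eq0 => [|g gM]; last first.
  by rewrite mulr_ge0 ?(ltW (lp g gM)) // subr_ge0 (proj2 (Dg g gM)).
move=> /allP eBD; split=> // E Eh; rewrite !count_ofE; apply: ler_sum => g gM.
have := eBD g (mem_index_enum g); rewrite gM /= mulf_eq0 gt_eqF ?lp //=.
by rewrite subr_eq0 => /eqP ->; exact: (proj2 (Dg g gM)).
Qed.

Lemma le_decomp M M' l l' a b : M \in C n -> M' \in C n ->
  (forall g, g \in M -> 0 < l g) -> (forall g, g \in M' -> 0 < l' g) ->
  (forall B, a B = \sum_(g in M) l g * indicator R g B) ->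
  (forall B, b B = \sum_(g in M') l' g * indicator R g B) ->
  le b a <-> M' \subset M.
Proof.
move=> MC M'C lp l'p aE bE.
have [aM Ma] := le_count_decomp MC lp aE.
have [bM Mb] := le_count_decomp M'C l'p bE.
rewrite -(count_of_sub R MC M'C); split=> [ba|MM].
  exact: argmin_le_trans Mb (argmin_le_trans ba aM).
exact: argmin_le_trans bM (argmin_le_trans MM Ma).
Qed.

End FlagDecomposition.

(** * Complete flags through the support of a flag function *)

Section SortedFlag.
Variables (R : realFieldType) (n : nat).
Local Notation I := 'I_n.+1.
Local Notation T := {set I}.
Implicit Types (a : T -> R) (B D E : T) (g h : {set T}) (s : seq I).

Definition prefix_set s j : T := [set x in take j s].

Definition prefixes s : {set T} := [set prefix_set s j.+1 | j : 'I_n].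

Lemma sorted_prefix (r : I -> R) s D : sorted (fun i j => r j <= r i) s ->
  (forall i j, i \in D -> j \notin D -> r j < r i) ->
  take (count [in D] s) s = filter [in D] s.
Proof.
move=> + H; elim: s => //= i s IH ss; have /IH {}IH := path_sorted ss.
case: (boolP (i \in D)) => iD /=; first by rewrite IH.
have nD : all [predC D] s.
  move: ss; rewrite path_sortedE => [/andP[/allP ri _]|j k m kj jm]; last exact: le_trans jm kj.
  apply/allP => j js; apply/negP => jD.
  by have := ri j js; rewrite leNgt H.
have -> : filter [in D] s = [::].
  by apply/eqP; rewrite -(negbK (_ == _)) -has_filter -all_predC.
have -> // : count [in D] s = 0%N.
by apply/eqP; rewrite -leqn0 leqNgt -has_count -all_predC.
Qed.

(** Sort the ground set by decreasing rank: by [rank_of_sep] each set of the support lies strictly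
    above its complement, so it is a prefix. *)
Lemma flag_seq_ex a : flag_fun a -> exists s, [/\ uniq s, size s = n.+1 &
  forall D, 0 < a D -> D = prefix_set s #|D|].
Proof.
move=> aF; pose r := rank_of a; pose s := sort (fun i j => r j <= r i) (enum I).
have us : uniq s by rewrite sort_uniq enum_uniq.
exists s; split=> //; first by rewrite size_sort -cardE card_ord.
move=> D aD; apply/setP => x; rewrite inE.
have ss : sorted (fun i j => r j <= r i) s.
  by apply: sort_sorted => i j; exact: le_total.
have cD : count [in D] s = #|D|.
  have /permP -> : perm_eq s (enum I) by rewrite perm_sort.
  by rewrite -sum1_count -sum1_card big_enum_cond; apply: eq_bigl => i; rewrite inE.
rewrite -cD (sorted_prefix ss) => [|i j iD jD]; last exact: (rank_of_sep aF aD).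
by rewrite mem_filter /= mem_sort mem_enum andbT.
Qed.

Variable s : seq I.
Hypothesis us : uniq s.
Hypothesis ss : size s = n.+1.

Lemma mem_flag_seq i : i \in s.
Proof.
suff : [set x in s] = [set: I] by move=> /setP/(_ i); rewrite !inE.
by apply/eqP; rewrite eqEcard subsetT cardsT card_ord cardsE (card_uniqP us) ss leqnn.
Qed.

Lemma in_prefix_set i j : (i \in prefix_set s j) = (index i s < j)%N.
Proof.
rewrite inE; have [jn|nj] := leqP j (size s).
  by rewrite in_take_leq ?mem_flag_seq.
by rewrite take_oversize ?(ltnW nj) // mem_flag_seq (ltn_trans _ nj) // index_mem mem_flag_seq.
Qed.

Lemma card_prefix_set j : (j <= n.+1)%N -> #|prefix_set s j| = j.
Proof.
move=> jn; rewrite cardsE (card_uniqP _) ?take_uniq // size_takel ?ss //.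
Qed.

Lemma prefix_setP B : reflect (exists2 j, (0 < j <= n)%N & B = prefix_set s j)
  (B \in prefixes s).
Proof.
apply: (iffP imsetP) => [[j _ ->]|[[//|j] jn ->]]; first by exists j.+1 => //=.
by exists (Ordinal jn).
Qed.

Lemma in_prefixes B : (B \in prefixes s) =
  [&& B != set0, B != [set: I] & B == prefix_set s #|B|].
Proof.
apply/prefix_setP/and3P => // [[j /andP[j0 jn] ->]|[B0 BT /eqP BE]].
  rewrite -card_gt0 card_prefix_set ?(leqW jn) // j0 eqxx; split=> //.
  apply/eqP => e; have := card_prefix_set (leqW jn).
  by rewrite e cardsT card_ord => ej; rewrite -ej ltnn in jn.
exists #|B| => //; rewrite card_gt0 B0 /=.
have := max_card (mem B); rewrite card_ord leq_eqVlt => /predU1P[e|//].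
by case/negP: BT; rewrite eqEcard subsetT cardsT card_ord e /=.
Qed.

Lemma prefix_set_sub i j : (i <= j)%N -> prefix_set s i \subset prefix_set s j.
Proof. by move=> ij; apply/subsetP => x; rewrite !in_prefix_set => /leq_trans; apply. Qed.

Lemma prefixes_chain : set_chain (prefixes s).
Proof.
apply/set_chainP => _ _ /prefix_setP[i _ ->] /prefix_setP[j _ ->].
by have [ij|/ltnW ji] := leqP i j; [rewrite prefix_set_sub|rewrite orbC prefix_set_sub].
Qed.

Lemma prefixes_B1 : (0 < n)%N -> prefixes s \in B1 n.
Proof.
move=> n0; apply/B1P; split.
- apply/set0Pn; exists (prefix_set s 1); apply/prefix_setP; exists 1%N => //.
- by move=> B; rewrite in_prefixes => /and3P[-> ->].
- exact: prefixes_chain.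
- move=> _ _ j /prefix_setP[i /andP[i0 iN] ->] /prefix_setP[k /andP[k0 kn] ->].
  rewrite !card_prefix_set ?leqW // => /andP[ij jk].
  exists (prefix_set s j); last by rewrite card_prefix_set // leqW // (leq_trans jk).
  by apply/prefix_setP; exists j => //; rewrite (leq_trans i0) // (leq_trans jk).
Qed.

Lemma card_prefixes : #|prefixes s| = n.
Proof.
have ck (k : 'I_n) : #|prefix_set s k.+1| = k.+1.
  by apply: card_prefix_set; exact: leqW (ltn_ord k).
rewrite card_imset ?card_ord // => i j e; apply/val_inj/succn_inj.
by rewrite -[LHS]ck e ck.
Qed.

(** By telescoping, a point can be prescribed through its coordinate sums along the flag. *)
Lemma sum_prefix (G : nat -> R) j : (j <= n.+1)%N ->
  \sum_(i in prefix_set s j) (G (index i s).+1 - G (index i s)) = G j - G 0%N.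
Proof.
move=> jn.
have -> : \sum_(i in prefix_set s j) (G (index i s).+1 - G (index i s)) =
    \sum_(i <- take j s) (G (index i s).+1 - G (index i s)).
  by rewrite big_uniq ?take_uniq //=; apply: eq_bigl => i; rewrite inE.
rewrite -(big_map (index^~ s) xpredT (fun m => G m.+1 - G m)).
have -> : [seq index i s | i <- take j s] = iota 0 j.
  have sz : size (take j s) = j by rewrite size_takel ?ss.
  apply: (@eq_from_nth _ 0%N); rewrite ?size_map ?size_iota // sz => m mj.
  rewrite (nth_map ord0) ?sz // nth_take // nth_iota // index_uniq //.
  by rewrite ss (leq_trans mj).
by rewrite -(telescope_sumr G (leq0n j)) /index_iota subn0.
Qed.

End SortedFlag.

(** * Weights of the saturated subchains of a chain *)

Section IntervalWeights.
Variables (R : realFieldType) (n : nat).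
Local Notation I := 'I_n.+1.
Local Notation T := {set I}.
Implicit Types (B D E : T) (g h : {set T}).

(* The second difference of the function k |-> 3 ^ k - 3 k, taken to be 0 at k = 0. *)
Definition weight (k : nat) : R := 4 * 3 ^+ (k - 2) - (k == 2)%:R.

Lemma weight_gt0 k : (1 < k)%N -> 0 < weight k.
Proof.
case: k => [|[|k]] // _; rewrite /weight subn2 /=.
have : 1 <= 3 ^+ k :> R by rewrite exprn_ege1 // ler1n.
by case: eqP => _ /=; lra.
Qed.

Lemma saturatedS g (lo hi : nat) E : saturated g -> E \in g ->
  (lo <= #|E| <= hi)%N -> saturated [set F in g | (lo <= #|F| <= hi)%N].
Proof.
move=> [_ gne gc gs] Eg Elh; split.
- by apply/set0Pn; exists E; rewrite inE Eg.
- by move=> B; rewrite inE => /andP[/gne].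
- by apply: set_chainS gc; apply/subsetP => B; rewrite inE => /andP[].
- move=> B D j; rewrite !inE => /andP[Bg /andP[Bl Bh]] /andP[Dg /andP[Dl Dh]].
  move=> /andP[Bj jD]; have [F Fg Fj] := gs B D j Bg Dg (introT andP (conj Bj jD)).
  by exists F; rewrite // inE Fg Fj (leq_trans Bl Bj) (leq_trans jD Dh).
Qed.

Lemma A2P g : reflect (g \in B1 n /\ (1 < #|g|)%N) (g \in A2 n).
Proof.
apply: (iffP idP) => [|[gB g1]]; rewrite in_setD.
  rewrite inE => /andP[ng gB]; split=> //; rewrite gB /= in ng.
  have [/set0Pn[B Bg] _ _ _] : saturated g by apply/B1P.
  have g0 : (0 < #|g|)%N by rewrite card_gt0; apply/set0Pn; exists B.
  by rewrite ltn_neqAle eq_sym ng.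
by rewrite gB inE gB andbT /= eq_sym neq_ltn g1.
Qed.

Definition weight_below g : R := \sum_(h in A2 n) (h \subset g)%:R * weight #|h|.

(** Inclusion-exclusion: a saturated subchain that contains both the largest member [D] and the
    smallest member [E] is [g] itself, and any other misses [D] or [E]. So the weight of [g] must be
    a second difference of the total. *)
Lemma weight_belowE g : saturated g -> weight_below g = 3 ^+ #|g| - 3 * #|g|%:R.
Proof.
move: {2}(#|g|) (leqnn #|g|) => m; elim: m g => [|m IH] g.
  by rewrite leqn0 cards_eq0 => /eqP -> [/eqP].
move=> gm gS; have [/set0Pn[B0' B0g] gne gc gs] := gS.
pose D := [arg max_(B > B0' in g) #|B|].
have [Dg Dmax] : D \in g /\ forall F, F \in g -> (#|F| <= #|D|)%N.
  by rewrite /D; case: arg_maxnP.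
pose E := [arg min_(B < B0' in g) #|B|].
have [Eg Emin] : E \in g /\ forall F, F \in g -> (#|E| <= #|F|)%N.
  by rewrite /E; case: arg_minnP.
have small h : (#|h| <= 1)%N -> weight_below h = 0.
  move=> h1; apply: big1 => k /A2P[_ k1]; case: (boolP (k \subset h)) => [kh|_].
    by have := leq_ltn_trans (subset_leq_card kh) (leq_ltn_trans h1 k1); rewrite ltnn.
  by rewrite mul0r.
have [DE|DE] := eqVneq D E.
  have g1 : #|g| = 1%N.
    apply/eqP/cards1P; exists D; apply/setP => F; rewrite inE.
    apply/idP/eqP => [Fg|-> //]; apply: (set_chain_inj gc) => //.
    by apply/eqP; rewrite eqn_leq Dmax // DE Emin.
  by rewrite small g1 //; ring.
have win (lo hi : nat) : (forall F, F \in g -> (lo <= #|F| <= hi)%N ->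
    saturated [set F in g | (lo <= #|F| <= hi)%N]).
  by move=> F Fg; exact: saturatedS Fg.
have ltED : (#|E| < #|D|)%N.
  rewrite ltn_neqAle Emin // andbT; apply: contra DE => /eqP e.
  by apply/eqP/esym; exact: (set_chain_inj gc).
have D0 : (0 < #|D|)%N := leq_ltn_trans (leq0n _) ltED.
have gDE : g :\ D = [set F in g | (#|E| <= #|F| <= #|D|.-1)%N].
  apply/setP => F; rewrite !inE andbC; case: (boolP (F \in g)) => //= Fg.
  rewrite Emin //= -ltnS (prednK D0) ltn_neqAle Dmax // andbT.
  congr (~~ _); apply/eqP/eqP => [-> //|e]; exact: (set_chain_inj gc).
have gEE : g :\ E = [set F in g | (#|E|.+1 <= #|F| <= #|D|)%N].
  apply/setP => F; rewrite !inE andbC; case: (boolP (F \in g)) => //= Fg.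
  rewrite Dmax // andbT ltn_neqAle Emin // andbT; congr (~~ _).
  apply/eqP/eqP => [-> //|e]; exact: (set_chain_inj gc).
have gDS : saturated (g :\ D).
  by rewrite gDE; apply: (win _ _ E) => //; rewrite leqnn -ltnS (prednK D0).
have gES : saturated (g :\ E).
  by rewrite gEE; apply: (win _ _ D) => //; rewrite ltED leqnn.
have cD : #|g| = #|g :\ D|.+1 by rewrite (cardsD1 D g) Dg.
have cE : #|g| = #|g :\ E|.+1 by rewrite (cardsD1 E g) Eg.
have cDE : #|g| = #|g :\ D :\ E|.+2.
  by rewrite cD (cardsD1 E) !inE eq_sym DE Eg.
have split_sum : weight_below g = weight #|g| + weight_below (g :\ D) +
    weight_below (g :\ E) - weight_below (g :\ D :\ E).
  have gA : g \in A2 n by apply/A2P; rewrite cDE; split=> //; apply/B1P.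
  have -> : weight #|g| = \sum_(h in A2 n) (h == g)%:R * weight #|h|.
    rewrite (bigD1 g) //= eqxx mul1r big1 ?addr0 // => h /andP[_ /negPf ->].
    by rewrite mul0r.
  rewrite -!big_split -sumrB; apply: eq_bigr => h /A2P[/B1P[_ _ _ hs] _] /=.
  rewrite -!mulrDl -mulrBl; congr (_ * _); rewrite !subsetD1.
  case: (boolP (h \subset g)) => hg /=; last first.
    by case: eqP => [hE|_]; [rewrite hE subxx in hg | rewrite /=; ring].
  case: (boolP (D \in h)) => Dh /=; case: (boolP (E \in h)) => Eh /=.
  - suff -> : h == g by rewrite /=; ring.
    rewrite eqEsubset hg; apply/subsetP => F Fg.
    have [F' F'h e] := hs E D #|F| Eh Dh (introT andP (conj (Emin F Fg) (Dmax F Fg))).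
    by rewrite -(set_chain_inj gc (subsetP hg _ F'h) Fg e).
  - by case: eqP => [hE|_]; [rewrite hE Eg in Eh | rewrite /=; ring].
  - by case: eqP => [hE|_]; [rewrite hE Dg in Dh | rewrite /=; ring].
  - by case: eqP => [hE|_]; [rewrite hE Dg in Dh | rewrite /=; ring].
have gDm : (#|g :\ D| <= m)%N by rewrite -ltnS -cD.
have gEm : (#|g :\ E| <= m)%N by rewrite -ltnS -cE.
rewrite split_sum (IH _ gDm gDS) (IH _ gEm gES).
(* At size 0 the formula would give 1 while the total weight is 0; this is the origin of the
   correction at 2 in [weight]. *)
have -> : weight_below (g :\ D :\ E) = 3 ^+ #|g :\ D :\ E| - 3 * #|g :\ D :\ E|%:R
    - (#|g :\ D :\ E| == 0%N)%:R.
  have [e0|n0] := eqVneq #|g :\ D :\ E| 0%N; first by rewrite small e0 //=; ring.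
  rewrite IH; first by rewrite subr0.
    by move: gm; rewrite cDE => /ltnW.
  have /set0Pn[F Fg] : g :\ D :\ E != set0 by rewrite -card_gt0 lt0n.
  have -> : g :\ D :\ E = [set F in g | (#|E|.+1 <= #|F| <= #|D|.-1)%N].
    apply/setP => F'; have := congr1 (fun A : {set T} => F' \in A) gDE.
    have := congr1 (fun A : {set T} => F' \in A) gEE; rewrite !inE => h1 h2.
    rewrite h2 andbA; case: (boolP (F' \in g)) h1 => F'g; last by rewrite !andbF.
    rewrite !andbT /= => ->; rewrite Emin // Dmax // andbT //.
  have [Fg' FlD] : F \in g /\ (#|E|.+1 <= #|F| <= #|D|.-1)%N.
    move: Fg; rewrite !inE => /and3P[FE FD Fg]; split=> //; apply/andP; split.
      rewrite ltn_neqAle Emin // andbT; apply: contra FE => /eqP e.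
      by apply/eqP/esym; exact: (set_chain_inj gc).
    rewrite -ltnS (prednK D0) ltn_neqAle Dmax // andbT.
    by apply: contra FD => /eqP e; apply/eqP; exact: (set_chain_inj gc).
  exact: win FlD.
have -> : #|g :\ D| = #|g :\ D :\ E|.+1 by apply: succn_inj; rewrite -cD.
have -> : #|g :\ E| = #|g :\ D :\ E|.+1 by apply: succn_inj; rewrite -cE.
rewrite cDE; move: #|_| => k.
rewrite /weight subn2 /= eqSS eqSS !exprS -!natr1; case: eqP => [->|_] /=; ring.
Qed.

End IntervalWeights.

From mathcomp Require Import all_classical all_reals all_analysis.
Import Order.TTheory GRing.Theory Num.Theory.
Local Open Scope ring_scope.

(** * Polytopes and their faces *)

Section ConvexHulls.
Local Open Scope classical_set_scope.
Variables (R : realType) (N : nat).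
Local Notation V := 'rV[R]_N.
Implicit Types (P Q S : set V) (u v x y z : V).

Lemma dotDr v x y : dot v (x + y) = dot v x + dot v y.
Proof. by rewrite -big_split; apply: eq_bigr => j _; rewrite mxE mulrDr. Qed.

Lemma dotZr v t x : dot v (t *: x) = t * dot v x.
Proof. by rewrite mulr_sumr; apply: eq_bigr => j _; rewrite mxE mulrCA. Qed.

Lemma dotC v x : dot v x = dot x v.
Proof. by apply: eq_bigr => j _; rewrite mulrC. Qed.

Lemma dotDl u v x : dot (u + v) x = dot u x + dot v x.
Proof. by rewrite ![dot _ x]dotC dotDr. Qed.

Lemma dotZl t v x : dot (t *: v) x = t * dot v x.
Proof. by rewrite ![dot _ x]dotC dotZr. Qed.

Lemma dotNl v x : dot (- v) x = - dot v x.
Proof. by rewrite -scaleN1r dotZl mulN1r. Qed.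

Lemma dotNr v x : dot v (- x) = - dot v x.
Proof. by rewrite dotC dotNl dotC. Qed.

Lemma dot_sumr (T : finType) v (w : T -> R) (p : T -> V) :
  dot v (\sum_i w i *: p i) = \sum_i w i * dot v (p i).
Proof.
elim/big_ind2: _ => [|x a y b <- <-|i _]; last by rewrite dotZr.
- by rewrite /dot big1 // => j _; rewrite mxE mulr0.
- by rewrite dotDr.
Qed.

Definition segment_closed S : Prop :=
  forall x y (t : R), 0 <= t <= 1 -> S x -> S y -> S (t *: x + (1 - t) *: y).

Lemma segment_closedP S : @convex_set R V S <-> segment_closed S.
Proof.
split=> [cS x y t t01 Sx Sy|cS x y t /set_mem Sx /set_mem Sy].
  have [t0 t1] := andP t01.
  have tI : Itv.spec (@Itv.num_sem R) (Itv.Real (Interval (BLeft 0%Z) (BRight 1%Z))) t.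
    by rewrite /= /Itv.num_sem /= in_itv /= t0 t1 ger0_real.
  by have /set_mem := cS x y (Itv.mk tI) (mem_set Sx) (mem_set Sy).
by apply: mem_set; apply: cS => //; rewrite ge0 le1.
Qed.

Definition convex_combs (T : finType) (p : T -> V) : set V :=
  [set x | exists w : T -> R,
     [/\ forall i, 0 <= w i, \sum_i w i = 1 & x = \sum_i w i *: p i]].

Lemma segment_convex_combs (T : finType) (p : T -> V) :
  segment_closed (convex_combs p).
Proof.
move=> _ _ t /andP[t0 t1] [w [w0 w1 ->]] [w' [w'0 w'1 ->]].
exists (fun i => t * w i + (1 - t) * w' i); split.
- by move=> i; rewrite addr_ge0 ?mulr_ge0 ?subr_ge0.
- by rewrite big_split /= -!mulr_sumr w1 w'1; ring.
- rewrite !scaler_sumr -big_split; apply: eq_bigr => i _ /=.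
  by rewrite !scalerA -scalerDl.
Qed.

Lemma convex_combs_gen (T : finType) (p : T -> V) i : convex_combs p (p i).
Proof.
exists (fun j => (j == i)%:R); split.
- by move=> j; rewrite ler0n.
- by rewrite (bigD1 i) //= eqxx big1 ?addr0 // => j /negPf ->.
- rewrite (bigD1 i) //= eqxx scale1r big1 ?addr0 // => j /negPf ->.
  by rewrite scale0r.
Qed.

Lemma convex_combs_sub (T : finType) (p : T -> V) S :
  segment_closed S -> (forall i, S (p i)) -> convex_combs p `<=` S.
Proof.
move=> cS Sp _ [w [w0 w1 ->]].
(* Partial sums are divided by their total weight, so that each step of the induction is a
   combination of two points of [S]. *)
suff H (s : seq T) : 0 < \sum_(i <- s) w i ->
    S ((\sum_(i <- s) w i)^-1 *: \sum_(i <- s) w i *: p i).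
  by have := H (index_enum T); rewrite w1 ltr01 invr1 scale1r; exact.
elim: s => [|i s IH]; first by rewrite big_nil ltxx.
rewrite !big_cons; set W := \sum_(j <- s) w j; set X := \sum_(j <- s) _.
have W0 : 0 <= W by apply: sumr_ge0.
move=> wW; have wWn : w i + W != 0 by rewrite gt_eqF.
have [W00|Wn] := eqVneq W 0.
  have -> : X = 0.
    rewrite /X big_seq big1 // => j js.
    have : \sum_(j <- s) w j == 0 by rewrite -/W W00.
    rewrite psumr_eq0 // => /allP /(_ j js) /= /eqP ->; exact: scale0r.
  rewrite W00 !addr0 in wW wWn *.
  by rewrite scalerA mulVf // scale1r.
have Wp : 0 < W by rewrite lt_neqAle eq_sym Wn.
have := cS (p i) (W^-1 *: X) (w i / (w i + W)) _ (Sp i) (IH Wp).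
have e : 1 - w i / (w i + W) = W / (w i + W) by field.
rewrite e !scalerA.
have -> : W / (w i + W) / W = (w i + W)^-1 by field; rewrite Wn wWn.
rewrite scalerDr scalerA [w i / _]mulrC; apply.
rewrite mulrC divr_ge0 ?(ltW wW) //= ler_pdivrMr // mul1r.
by rewrite lerDl.
Qed.

Lemma conv_hullE (T : finType) (p : T -> V) :
  conv_hull (range p) = convex_combs p.
Proof.
apply/seteqP; split=> x.
  apply: smallest_sub => [|_ [i _ <-]]; last exact: convex_combs_gen.
  exact/segment_closedP/segment_convex_combs.
move=> px S [cS pS]; move: px; apply: convex_combs_sub.
  exact/segment_closedP.
by move=> i; apply: pS; exists i.
Qed.

Lemma polytopeP P :
  polytope P <-> exists (T : finType) (p : T -> V), inhabited T /\
                   P = convex_combs p.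
Proof.
split=> [[A [/finite_seqP [s ->] [x xs] ->]]|[T [p [[t] ->]]]].
  exists 'I_(size s), (tnth (in_tuple s)); split.
    by move: xs => /=; case: s => // y s _; constructor; exact: ord0.
  rewrite -conv_hullE; congr conv_hull; apply/seteqP; split=> y /=.
    by move=> ys; have /tnthP[i ->] : y \in in_tuple s by []; exists i.
  by move=> [i _ <-]; have := mem_tnth i (in_tuple s).
exists (range p); split; last by rewrite conv_hullE.
- exact: finite_image.
- by exists (p t), t.
Qed.

Lemma segment_polytope P : polytope P -> segment_closed P.
Proof. by move=> /polytopeP[T [p [_ ->]]]; exact: segment_convex_combs. Qed.

Lemma polytope_neq0 P : polytope P -> P !=set0.
Proof.
by move=> /polytopeP[T [p [[t] ->]]]; exists (p t); exact: convex_combs_gen.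
Qed.

Definition max_face v P : set V := [set y | maximizes v P y].

Lemma convex_combs_le (T : finType) (p : T -> V) v M :
  (forall i, dot v (p i) <= M) -> forall x, convex_combs p x -> dot v x <= M.
Proof.
move=> pM x [w [w0 w1 ->]]; rewrite dot_sumr -[M]mul1r -w1 mulr_suml.
by apply: ler_sum => i _; rewrite ler_wpM2l.
Qed.

Lemma max_face_gen_ex (T : finType) (p : T -> V) v :
  inhabited T -> exists i, max_face v (convex_combs p) (p i).
Proof.
case=> t; have [i _ iM] := @Order.TotalTheory.arg_maxP _ R T t xpredT (fun i => dot v (p i)) isT.
exists i; split; first exact: convex_combs_gen.
by apply: convex_combs_le => j; apply: iM.
Qed.

Lemma max_face_neq0 v P : polytope P -> max_face v P !=set0.
Proof.
move=> /polytopeP[T [p [T0 ->]]].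
by have [i ?] := max_face_gen_ex p v T0; exists (p i).
Qed.

Lemma face_max_face v P : polytope P -> face P (max_face v P).
Proof. by move=> PP; split; [exact: max_face_neq0 | exists v]. Qed.

(** The nonnegative defects of the generators have weighted mean 0, so only generators in the face
    carry weight. *)
Lemma max_face_weights (T : finType) (p : T -> V) v x :
  max_face v (convex_combs p) x -> exists w : T -> R,
    [/\ forall i, 0 <= w i, \sum_i w i = 1, x = \sum_i w i *: p i &
        forall i, w i = 0 \/ max_face v (convex_combs p) (p i)].
Proof.
move=> [Px xmax]; have [w [w0 w1 xE]] := Px; exists w; split=> // i.
have s0 : \sum_i w i * (dot v x - dot v (p i)) = 0.
  under eq_bigr do rewrite mulrBr.
  by rewrite sumrB -mulr_suml w1 mul1r -dot_sumr -xE subrr.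
move/eqP: s0; rewrite psumr_eq0 => [/allP /(_ i)|j _]; last first.
  by rewrite mulr_ge0 // subr_ge0; apply: xmax; exact: convex_combs_gen.
rewrite mem_index_enum mulf_eq0 => /(_ isT)/= /orP[/eqP|]; first by left.
rewrite subr_eq0 => /eqP vi; right; split; first exact: convex_combs_gen.
by rewrite -vi.
Qed.

(** A face is spanned by the generators in it, so a failing inclusion is already seen at one of
    finitely many points; the gap arguments rely on this. *)
Lemma max_face_sub_gen (T : finType) (p : T -> V) u v :
  ~ (max_face v (convex_combs p) `<=` max_face u (convex_combs p)) ->
  exists2 i, max_face v (convex_combs p) (p i) &
    ~ max_face u (convex_combs p) (p i).
Proof.
set P := convex_combs p => nsub; apply: contrapT => H; apply: nsub.
move=> x xv; have [w [w0 w1 xE wv]] := max_face_weights xv.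
have T0 : inhabited T.
  apply: contrapT => nT; move: w1; rewrite big1 => [/eqP|i _].
    by rewrite eq_sym oner_eq0.
  by case: nT; constructor.
have [i0 [_ i0max]] := max_face_gen_ex p u T0.
have E : dot u x = dot u (p i0).
  rewrite xE dot_sumr -[RHS]mul1r -w1 mulr_suml; apply: eq_bigr => i _.
  have [->|vi] := wv i; first by rewrite !mul0r.
  congr (_ * _); apply: contrapT => ui; apply: H; exists i => // -[_ imax].
  apply: ui; apply/eqP; rewrite eq_le i0max ?imax //; exact: convex_combs_gen.
by split=> [|z Pz]; [case: xv | rewrite E; exact: i0max].
Qed.

Lemma max_face_segment v P x y (t : R) :
  P x -> P y -> 0 < t <= 1 -> max_face v P (t *: x + (1 - t) *: y) ->
  max_face v P x.
Proof.
move=> Px Py /andP[t0 t1] [_]; rewrite dotDr !dotZr => M.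
suff E : dot v x = t * dot v x + (1 - t) * dot v y by split=> // z /M; rewrite -E.
have := M x Px; have := M y Py; move: (dot v x) (dot v y) => a b *.
by apply/eqP; rewrite eq_le; apply/andP; split; nra.
Qed.

Lemma segment_max_face v P : segment_closed P -> segment_closed (max_face v P).
Proof.
move=> cP x y t t01 [Px xM] [Py yM]; split; first exact: cP.
move=> z Pz; have := xM _ Pz; have := yM _ Pz; have := xM _ Py; have := yM _ Px.
by rewrite dotDr !dotZr; case/andP: t01 => *; nra.
Qed.

Lemma max_face_value v P x y :
  max_face v P x -> max_face v P y -> dot v x = dot v y.
Proof. by move=> [Px xM] [Py yM]; apply/eqP; rewrite eq_le yM // xM. Qed.

(* The longest generator x in the face is exposed by x + M k for large M. *)
Lemma vertex_in_face P k : polytope P ->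
  exists2 x, vertices P x & max_face k P x.
Proof.
move=> PP; have /polytopeP[T [p [T0 PE]]] := PP.
have [i0 i0k] := max_face_gen_ex p k T0.
have [i /asboolP ik imax] := @Order.TotalTheory.arg_maxP _ R T i0
  (fun i => `[< max_face k (convex_combs p) (p i) >]) (fun i => dot (p i) (p i))
  (asboolT i0k).
set x := p i in ik *; rewrite PE; exists x => //.
have [_ kmax] := ik.
have kp j : 0 <= dot k x - dot k (p j).
  by rewrite subr_ge0; apply: kmax; exact: convex_combs_gen.
(* The sum dominates the threshold of every generator off the face. For generators in the face the
   denominator is 0, and so is the quotient by convention. *)
pose M := \sum_j (`|dot x (p j)| + `|dot x x| + 1) / (dot k x - dot k (p j)).
have M0 : 0 <= M by apply: sumr_ge0 => j _; rewrite divr_ge0 // !addr_ge0.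
have far j : ~ max_face k (convex_combs p) (p j) ->
    dot x (p j) + M * dot k (p j) < dot x x + M * dot k x.
  move=> njk; have d0 : 0 < dot k x - dot k (p j).
    rewrite lt_neqAle kp andbT eq_sym subr_eq0; apply/eqP => e; apply: njk.
    by split; [exact: convex_combs_gen | rewrite -e].
  have : (`|dot x (p j)| + `|dot x x| + 1) / (dot k x - dot k (p j)) <= M.
    rewrite /M (bigD1 j) //= lerDl; apply: sumr_ge0 => l _.
    by rewrite divr_ge0 // !addr_ge0.
  rewrite ler_pdivrMr // => H.
  have := ler_norm (dot x (p j)); have := ler_norm (- dot x x); rewrite normrN.
  by move: H; rewrite mulrBr; lra.
have near j : max_face k (convex_combs p) (p j) -> p j <> x ->
    dot x (p j) < dot x x.
  move=> jk jx; have := imax j (asboolT jk); rewrite /= -/x.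
  (* Expanding this square and using that [x] is longest bounds the product of [x] and [p j]
     strictly by that of [x] with itself. *)
  have : 0 < dot (p j - x) (p j - x).
    have [l jl] : exists l, p j 0 l != x 0 l.
      apply: contrapT => nl; apply: jx; apply/rowP => l; apply/eqP.
      by apply: contrapT => ne; apply: nl; exists l; apply/negP.
    rewrite /dot (bigD1 l) //= ltr_pwDl ?sumr_ge0 // => [|l' _].
      by rewrite lt_neqAle eq_sym mulf_neq0 ?sqr_ge0 // !mxE subr_eq0.
    exact: sqr_ge0.
  by rewrite dotDr !dotDl !dotNr !dotNl [dot (p j) x]dotC => ? ?; lra.
have xbest j : p j <> x ->
    dot (x + M *: k) (p j) < dot (x + M *: k) x.
  rewrite !dotDl !dotZl => jx.
  have [jk|njk] := pselect (max_face k (convex_combs p) (p j)); last exact: far.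
  by rewrite (max_face_value jk ik) ltrD2r; exact: near.
have xm : max_face (x + M *: k) (convex_combs p) x.
  split; first exact: convex_combs_gen.
  apply: convex_combs_le => j; have [->//|/eqP jx] := eqVneq (p j) x.
  exact/ltW/xbest.
split; first by exists x.
exists (x + M *: k); apply/seteqP; split=> [_ -> //|y ym].
have [w [_ w1 -> wm]] := max_face_weights ym.
rewrite /= -[x]scale1r -w1 scaler_suml; apply: eq_bigr => j _.
have [->|jm] := wm j; first by rewrite !scale0r.
congr (_ *: _); apply: contrapT => /xbest.
by rewrite (max_face_value jm xm) ltxx.
Qed.

(** The normal cone of the face in direction [v] consists of the [u] whose face contains it, so
    inclusions between faces determine the fan. *)
Lemma normally_equivalentP P Q :
  (forall v, max_face v P !=set0) -> (forall v, max_face v Q !=set0) ->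
  (forall u v, max_face v P `<=` max_face u P <->
               max_face v Q `<=` max_face u Q) ->
  normally_equivalent P Q.
Proof.
have sub P1 P2 : (forall v, max_face v P1 !=set0) ->
    (forall v, max_face v P2 !=set0) ->
    (forall u v, max_face v P1 `<=` max_face u P1 <->
                 max_face v P2 `<=` max_face u P2) ->
    normal_fan P1 `<=` normal_fan P2.
  move=> n1 n2 e _ [_ [_ [v ->]] <-].
  exists (max_face v P2); first by split; [exact: n2 | exists v].
  by apply/seteqP; split=> u; apply e.
by move=> nP nQ e; apply/seteqP; split; apply: sub => // u v; split=> /e.
Qed.

End ConvexHulls.

Section MinkowskiSums.
Local Open Scope classical_set_scope.
Variables (R : realType) (N : nat).
Local Notation V := 'rV[R]_N.
Implicit Types (P Q S : set V) (u v x y z : V).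

(** Product weights give one inclusion, marginals of weights on pairs the other. *)
Lemma minksum_convex_combs (T U : finType) (p : T -> V) (q : U -> V) :
  minksum (convex_combs p) (convex_combs q) =
  convex_combs (fun ij : T * U => p ij.1 + q ij.2).
Proof.
apply/seteqP; split=> x.
  move=> [_ [w [w0 w1 ->]] [_ [w' [w'0 w'1 ->]] <-]].
  exists (fun ij => w ij.1 * w' ij.2); split.
  - by move=> i; rewrite mulr_ge0.
  - rewrite -(pair_bigA _ (fun i j => w i * w' j)) /= -w1; apply: eq_bigr => i _.
    by rewrite -mulr_sumr w'1 mulr1.
  - rewrite -(pair_bigA _ (fun i j => (w i * w' j) *: (p i + q j))) /=.
    under [RHS]eq_bigr => i _ do
      (under eq_bigr do rewrite scalerDr; rewrite big_split /=).
    rewrite big_split /=; congr (_ + _).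
      apply: eq_bigr => i _; rewrite -scaler_suml -mulr_sumr w'1 mulr1 //.
    rewrite exchange_big; apply: eq_bigr => j _ /=.
    by rewrite -scaler_suml -mulr_suml w1 mul1r.
move=> [w [w0 w1 ->]].
exists (\sum_i (\sum_j w (i, j)) *: p i).
  exists (fun i => \sum_j w (i, j)); split=> //.
  - by move=> i; apply: sumr_ge0.
  - by rewrite pair_bigA -w1; apply: eq_bigr => -[].
exists (\sum_j (\sum_i w (i, j)) *: q j).
  exists (fun j => \sum_i w (i, j)); split=> //.
  - by move=> i; apply: sumr_ge0.
  - by rewrite exchange_big pair_bigA -w1; apply: eq_bigr => -[].
under eq_bigr do rewrite scaler_suml.
under [X in _ + X]eq_bigr do rewrite scaler_suml.
rewrite [X in _ + X]exchange_big !pair_bigA -big_split /=.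
by apply: eq_bigr => -[i j] _; rewrite scalerDr.
Qed.

Lemma polytope_minksum P Q : polytope P -> polytope Q -> polytope (minksum P Q).
Proof.
move=> /polytopeP[T [p [[t] ->]]] /polytopeP[U [q [[u] ->]]]; apply/polytopeP.
exists (T * U)%type, (fun ij => p ij.1 + q ij.2); split; first by constructor.
exact: minksum_convex_combs.
Qed.

Lemma convex_combs_unit x : convex_combs (fun _ : unit => x) = [set x].
Proof.
apply/seteqP; split=> [|_ ->]; last exact: (convex_combs_gen (fun _ => x) tt).
apply: convex_combs_sub => // _ _ t _ -> -> /=.
by rewrite -scalerDl addrC subrK scale1r.
Qed.

Lemma polytope_set1 x : polytope [set x].
Proof.
apply/polytopeP; exists unit, (fun=> x); split; first exact: (inhabits tt).
by rewrite convex_combs_unit.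
Qed.

Definition lattice_polytope P : Prop :=
  exists (T : finType) (p : T -> V), [/\ inhabited T, P = convex_combs p &
    forall i j, p i 0 j \is a Num.int].

Lemma lattice_polytope_set0 : lattice_polytope [set 0].
Proof.
exists unit, (fun=> 0); split; first exact: (inhabits tt).
- by rewrite convex_combs_unit.
- by move=> i j; rewrite mxE rpred0.
Qed.

Lemma lattice_polytope_minksum P Q :
  lattice_polytope P -> lattice_polytope Q -> lattice_polytope (minksum P Q).
Proof.
move=> [T [p [[t] -> pZ]]] [U [q [[u] -> qZ]]].
exists (T * U)%type, (fun ij => p ij.1 + q ij.2); split.
- exact: (inhabits (t, u)).
- exact: minksum_convex_combs.
- by move=> i j; rewrite mxE rpredD.
Qed.

Lemma lattice_polytopeW P : lattice_polytope P -> polytope P.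
Proof. by move=> [T [p [? ? _]]]; apply/polytopeP; exists T, p. Qed.

Lemma max_face_minksum v P Q :
  max_face v (minksum P Q) = minksum (max_face v P) (max_face v Q).
Proof.
apply/seteqP; split=> [_ [[x Px [y Qy <-]] M]|_ [x [Px xM] [y [Qy yM] <-]]].
  exists x.
    split=> // z Pz; have := M (z + y); rewrite !dotDr lerD2r; apply.
    by exists z => //; exists y.
  exists y => //; split=> // z Qz; have := M (x + z); rewrite !dotDr lerD2l.
  by apply; exists x => //; exists z.
split; first by exists x => //; exists y.
by move=> _ [x' Px' [y' Qy' <-]]; rewrite !dotDr lerD ?xM ?yM.
Qed.

Lemma max_face_minksum_sub P Q u v : polytope P -> polytope Q ->
  max_face v (minksum P Q) `<=` max_face u (minksum P Q) <->
  max_face v P `<=` max_face u P /\ max_face v Q `<=` max_face u Q.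
Proof.
move=> PP PQ; rewrite !max_face_minksum; split=> [H|[HP HQ] _ [x xv [y yv <-]]].
  have K x y : max_face v P x -> max_face v Q y ->
      max_face u P x /\ max_face u Q y.
    move=> xv yv; have : minksum (max_face v P) (max_face v Q) (x + y).
      by exists x => //; exists y.
    move/H; rewrite -max_face_minksum => -[_ M].
    case: xv yv => [Px _] [Qy _]; split; split=> // z Pz.
      have := M (z + y); rewrite !dotDr lerD2r; apply.
      by exists z => //; exists y.
    have := M (x + z); rewrite !dotDr lerD2l; apply.
    by exists x => //; exists z.
  have [[x0 x0v] [y0 y0v]] := (max_face_neq0 v PP, max_face_neq0 v PQ).
  by split=> [x xv|y yv]; [case: (K x y0) | case: (K x0 y)].
by exists x; [exact: HP | exists y; [exact: HQ|]].
Qed.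

Section BigSums.
Variables (K : finType) (f : K -> set V) (A : {set K}).
Local Notation sumA := (\big[@minksum R N/[set 0]]_(b in A) f b).

Lemma polytope_big_minksum : (forall b, b \in A -> polytope (f b)) ->
  polytope sumA.
Proof.
move=> fP; elim/big_ind: _ => //; [exact: polytope_set1|exact: polytope_minksum].
Qed.

Lemma lattice_polytope_big_minksum :
  (forall b, b \in A -> lattice_polytope (f b)) -> lattice_polytope sumA.
Proof.
move=> fP; elim/big_ind: _ => //; first exact: lattice_polytope_set0.
exact: lattice_polytope_minksum.
Qed.

Lemma max_face_big_minksum_sub u v : (forall b, b \in A -> polytope (f b)) ->
  max_face v sumA `<=` max_face u sumA <->
  forall b, b \in A -> max_face v (f b) `<=` max_face u (f b).
Proof.
rewrite -big_enum => fP.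
have -> : (forall b, b \in A -> max_face v (f b) `<=` max_face u (f b)) <->
    (forall b, b \in enum A -> max_face v (f b) `<=` max_face u (f b)).
  by split=> H b; have := H b; rewrite mem_enum.
have {}fP : forall b, b \in enum A -> polytope (f b).
  by move=> b; rewrite mem_enum; exact: fP.
elim: (enum A) fP => [fP|b s IH fP].
  rewrite big_nil; split=> // _ _ [-> _]; split=> // _ ->; exact: lexx.
have fbs c : c \in s -> polytope (f c) by move=> cs; apply: fP; rewrite in_cons cs orbT.
have fb : polytope (f b) by apply: fP; rewrite mem_head.
rewrite big_cons max_face_minksum_sub //; last first.
  rewrite big_seq; elim/big_ind: _ => //; first exact: polytope_set1.
  exact: polytope_minksum.
rewrite IH //; split=> [[Hb Hs] c|H].
  by rewrite in_cons => /predU1P[->|/Hs].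
by split=> [|c cs]; apply: H; rewrite ?mem_head // in_cons cs orbT.
Qed.

End BigSums.

End MinkowskiSums.

Section HalfSpaces.
Local Open Scope classical_set_scope.
Variables (R : realType) (N : nat).
Local Notation V := 'rV[R]_N.
Implicit Types (P Q S : set V) (u v x y z : V).

(* New vertices arise where segments between generators on different sides meet
   the hyperplane; the mass of the negative side is matched with the proportion
   neg / pos of the mass of the positive side. *)
Lemma polytope_halfspace P a (b : R) :
  polytope P -> (P `&` [set x | b <= dot a x]) !=set0 ->
  polytope (P `&` [set x | b <= dot a x]).
Proof.
move=> PP [x0 [Px0 /= x0b]]; have cP := segment_polytope PP.
have /polytopeP[T [p [_ PE]]] := PP.
pose h i := dot a (p i) - b.
(* The point where the segment from [p i] to [p j] crosses the hyperplane; pairs in any other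
   position are sent to the point [x0] of the section. *)
pose q i j : V := if (0 <= h i) && (h j < 0)
  then (- h j / (h i - h j)) *: p i + (h i / (h i - h j)) *: p j else x0.
pose g (k : T + T * T) : V := match k with
  | inl i => if 0 <= h i then p i else x0
  | inr ij => q ij.1 ij.2
  end.
apply/polytopeP; exists (T + T * T)%type, g; split.
  move: (Px0); rewrite PE => -[w [_ w1 _]].
  apply: contrapT => nT; move: w1; rewrite big1 => [/eqP|i _].
    by rewrite eq_sym oner_eq0.
  by case: nT; constructor; left.
apply/seteqP; split=> [x [Px /= xb]|]; last first.
  apply: convex_combs_sub.
    move=> x y t t01 [Px /= xb] [Py /= yb]; split; first exact: cP.
    by rewrite /= dotDr !dotZr; case/andP: t01 => *; nra.
  have Pp i : P (p i) by rewrite PE; exact: convex_combs_gen.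
  move=> [i|[i j]] /=; rewrite ?/q.
    by case: ifPn => // hi; split=> //=; rewrite -subr_ge0.
  case: ifPn => // /andP[hi hj]; have hp : 0 < h i - h j by lra.
  have e : h i / (h i - h j) = 1 - (- h j / (h i - h j)).
    by field; rewrite gt_eqF.
  split.
    rewrite e; apply: cP => //; rewrite divr_ge0 ?(ltW hp) ?oppr_ge0 ?(ltW hj) //=.
    by rewrite ler_pdivrMr // mul1r lerDr.
  rewrite /= dotDr !dotZr -subr_ge0.
  suff -> : - h j / (h i - h j) * dot a (p i) + h i / (h i - h j) * dot a (p j)
    - b = 0 by [].
  by move: hp; rewrite /h => hp; field; rewrite gt_eqF.
move: Px; rewrite PE => -[w [w0 w1 xE]].
pose wp i := if 0 <= h i then w i else 0.
pose wn i := if h i < 0 then w i else 0.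
have wE i : w i = wp i + wn i by rewrite /wp /wn ltNge; case: (0 <= h i); rewrite /= ?addr0 ?add0r.
have wp0 i : 0 <= wp i by rewrite /wp; case: ifP.
have wn0 i : 0 <= wn i by rewrite /wn; case: ifP.
pose pos := \sum_i wp i * h i; pose neg := \sum_i wn i * - h i.
have neg0 : 0 <= neg.
  apply: sumr_ge0 => i _; rewrite /wn; case: ifP => hi; rewrite ?mul0r //.
  by rewrite mulr_ge0 // oppr_ge0 ltW.
have pn : pos - neg = dot a x - b.
  rewrite xE dot_sumr -[b in RHS]mul1r -w1 mulr_suml -!sumrB.
  by apply: eq_bigr => i _; rewrite wE /h; ring.
have gp i j : wp i * wn j *: ((h i - h j) *: q i j) =
    wp i * wn j *: (- h j *: p i + h i *: p j).
  rewrite /wp /wn /q; case: ifPn => hi /=; last by rewrite mul0r !scale0r.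
  case: ifPn => hj /=; last by rewrite mulr0 !scale0r.
  congr (_ *: _); rewrite scalerDr !scalerA.
  by congr (_ *: _ + _ *: _); field; rewrite gt_eqF // subr_gt0; lra.
have gl i : wp i *: g (inl i) = wp i *: p i.
  by rewrite /wp /=; case: ifP => hi //; rewrite !scale0r.
have sw : \sum_i wp i + \sum_i wn i = 1.
  by rewrite -w1 -big_split; apply: eq_bigr => i _ /=; rewrite -wE.
have [neg00|negn] := eqVneq neg 0.
  have wn_0 i : wn i = 0.
    have : neg == 0 by rewrite neg00.
    rewrite psumr_eq0 => [/allP /(_ i)|j _]; last first.
      rewrite /wn; case: ifP => hj; rewrite ?mul0r //.
      by rewrite mulr_ge0 // oppr_ge0 ltW.
    rewrite mem_index_enum => /(_ isT) /=; rewrite mulf_eq0 => /orP[/eqP //|].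
    by rewrite /wn oppr_eq0 => /eqP ->; rewrite ltxx.
  exists (fun k => if k is inl i then wp i else 0); split.
  - by case.
  - rewrite big_sumType /= [X in _ + X]big1 // addr0 -sw.
    by rewrite [X in _ + X]big1 ?addr0.
  - rewrite big_sumType /= [X in _ + X]big1 ?addr0 => [|k _]; last exact: scale0r.
    by rewrite xE; apply: eq_bigr => i _; have := gl i; rewrite /= => ->; rewrite wE wn_0 addr0.
have negp : 0 < neg by rewrite lt_neqAle eq_sym negn.
have posp : 0 < pos by move: xb; lra.
have posn : pos != 0 by rewrite gt_eqF.
have e2 i j : (wp i * wn j * (h i - h j) / pos) *: q i j =
    (pos^-1 * wp i * (wn j * - h j)) *: p i + (pos^-1 * (wp i * h i) * wn j) *: p j.
  rewrite mulrC -[_ *: q i j]scalerA -[_ *: q i j]scalerA gp !scalerDr !scalerA.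
  by congr (_ *: _ + _ *: _); ring.
have e1 i j : wp i * wn j * (h i - h j) / pos =
    wp i * h i / pos * wn j + wp i / pos * (wn j * - h j).
  by field.
exists (fun k => match k with
  | inl i => wp i * (1 - neg / pos)
  | inr ij => wp ij.1 * wn ij.2 * (h ij.1 - h ij.2) / pos end); split.
- case=> [i|[i j]].
    by rewrite mulr_ge0 // subr_ge0 ler_pdivrMr // mul1r; move: xb; lra.
  rewrite divr_ge0 ?(ltW posp) // /wp /wn; case: ifP => hi; last by rewrite !mul0r.
  case: ifP => hj; last by rewrite mulr0 mul0r.
  by rewrite !mulr_ge0 //; lra.
- rewrite big_sumType /= -mulr_suml.
  rewrite -(pair_bigA _ (fun i j => wp i * wn j * (h i - h j) / pos)) /=.
  under [X in _ + X]eq_bigr => i _.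
    under eq_bigr => j _ do rewrite e1.
    rewrite big_split /= -!mulr_sumr -/neg; over.
  rewrite big_split /= -!mulr_suml -/pos divff // mul1r -{2}sw.
  by field.
- rewrite big_sumType /=.
  under eq_bigr => i _ do (rewrite mulrC -scalerA; have /= -> := gl i).
  rewrite -scaler_sumr.
  rewrite -(pair_bigA _ (fun i j => (wp i * wn j * (h i - h j) / pos) *: q i j)) /=.
  under [X in _ + X]eq_bigr => i _.
    under eq_bigr do rewrite e2.
    rewrite big_split /= -scaler_suml -mulr_sumr -/neg.
    under [X in _ + X]eq_bigr do rewrite -scalerA.
    rewrite -scaler_sumr; over.
  rewrite big_split /= -scaler_suml -mulr_sumr -/pos mulVf // scale1r.
  under [X in _ + (X + _)]eq_bigr => i _.
    rewrite (_ : pos^-1 * _ * _ = neg / pos * wp i); last by ring.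
    rewrite -scalerA; over.
  rewrite -scaler_sumr addrA -scalerDl subrK scale1r xE -big_split /=.
  by apply: eq_bigr => i _; rewrite wE scalerDl.
Qed.

Lemma polytope_halfspace_le P k (L : R) :
  polytope P -> (P `&` [set x | dot k x <= L]) !=set0 ->
  polytope (P `&` [set x | dot k x <= L]).
Proof.
have -> : [set x | dot k x <= L] = [set x | - L <= dot (- k) x].
  by apply/seteqP; split=> x /=; rewrite dotNl lerN2.
exact: polytope_halfspace.
Qed.

Lemma segment_level (k x y : V) (L : R) : dot k x <= L -> L <= dot k y ->
  exists s : R, [/\ 0 <= s <= 1, dot k (s *: x + (1 - s) *: y) = L,
    L < dot k y -> 0 < s & dot k x < L -> s < 1].
Proof.
move=> xL Ly; have [e|ne] := eqVneq (dot k x) (dot k y).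
  exists 1; rewrite ler01 lexx ltr01 scale1r subrr scale0r addr0; split=> //.
    by apply/eqP; rewrite eq_le xL e Ly.
  by rewrite e ltNge Ly.
have d0 : 0 < dot k y - dot k x.
  by rewrite subr_gt0 lt_neqAle ne (le_trans xL).
exists ((dot k y - L) / (dot k y - dot k x)); split.
- by rewrite divr_ge0 ?(ltW d0) ?subr_ge0 //= ler_pdivrMr // mul1r lerD2l lerN2.
- by rewrite dotDr !dotZr; field; rewrite gt_eqF.
- by move=> yL; rewrite divr_gt0 // subr_gt0.
- by move=> xL'; rewrite ltr_pdivrMr // mul1r ltrD2l ltrN2.
Qed.

(** On the section [v] is at most its maximum over [P], and [t *: k] at most [t * L]. Some point of
    the face attains both bounds, between [y] and [z] if [t > 0]; so the maximisers are exactly the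
    points attaining both. *)
Lemma max_face_cut P k (L : R) v (t : R) y :
  segment_closed P -> 0 <= t -> max_face v P y -> dot k y <= L ->
  (0 < t -> exists2 z, max_face v P z & L <= dot k z) ->
  let Q := P `&` [set x | dot k x <= L] in
  max_face (v + t *: k) Q !=set0 /\
  forall x, max_face (v + t *: k) Q x <->
    [/\ max_face v P x, dot k x <= L & 0 < t -> dot k x = L].
Proof.
move=> cP t0 yv yL zex Q.
have [x0 [x0v x0L x0E]] : exists x, [/\ max_face v P x, dot k x <= L &
    0 < t -> dot k x = L].
  have [->|tn] := eqVneq t 0; first by exists y; rewrite ltxx.
  have [|z zv zL] := zex; first by rewrite lt_neqAle eq_sym tn.
  have [s [s01 sL _ _]] := segment_level yL zL.
  exists (s *: y + (1 - s) *: z); rewrite sL; split=> //.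
  exact: segment_max_face.
have [Px0 x0M] := x0v.
have tE : t * dot k x0 = t * L.
  have [->|tn] := eqVneq t 0; first by rewrite !mul0r.
  by rewrite x0E // lt_neqAle eq_sym tn.
have suf x : [/\ max_face v P x, dot k x <= L & 0 < t -> dot k x = L] ->
    max_face (v + t *: k) Q x.
  move=> [xv xL xE]; split; first by case: xv.
  move=> w [Pw /= wL]; rewrite !dotDl !dotZl lerD //; first by case: xv => _; exact.
  move: t0; rewrite le_eqVlt => /predU1P[<-|tp]; first by rewrite !mul0r.
  by rewrite xE // ler_pM2l.
split; first by exists x0; exact: suf.
move=> x; split; last exact: suf.
move=> [[Px /= xL] xM]; have := xM x0 (conj Px0 x0L).
rewrite !dotDl !dotZl tE => H; have vx := x0M x Px.
have tx : t * dot k x <= t * L by rewrite ler_wpM2l.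
have vE : dot v x = dot v x0 by lra.
split=> //; first by split=> // w Pw; rewrite vE; exact: x0M.
move=> tp; have e : t * dot k x = t * L by lra.
by apply: (mulfI (lt0r_neq0 tp)).
Qed.

End HalfSpaces.

(** * Summands *)

Section FlagVectors.
Variables (R : realType) (n : nat).
Local Notation I := 'I_n.+1.
Local Notation T := {set I}.
Local Notation V := 'rV[R]_n.+1.
Implicit Types (a b : T -> R) (B D E : T) (g h : {set T}) (u v x y : V).

(* The sign turns the lower bounds that define the facets into maxima. *)
Definition flag_vec a : V := \row_i - rank_of a i.

Lemma flag_vecE a i : flag_vec a 0 i = - rank_of a i.
Proof. by rewrite mxE. Qed.

Lemma flag_vec_add_mul a (t : R) b :
  flag_vec (add_mul a t b) = flag_vec a + t *: flag_vec b.
Proof.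
apply/rowP => i; rewrite !mxE /rank_of big_split /= -mulr_sumr.
by rewrite opprD mulrN.
Qed.

Lemma add_mulK a (t : R) b : add_mul (add_mul a (- t) b) t b = a.
Proof. by apply/funext => B; rewrite /add_mul; ring. Qed.

Lemma dot_flag_vec a x :
  dot (flag_vec a) x = - \sum_(B : T) a B * \sum_(i in B) x 0 i.
Proof.
rewrite /dot -sumrN; under eq_bigr do rewrite mxE mulNr mulr_suml.
rewrite sumrN -sumrN; under [RHS]eq_bigr do rewrite mulr_sumr.
rewrite !sumrN (exchange_big_dep xpredT) //=.
Qed.

Lemma dot_indic g x : dot (flag_vec (indicator R g)) x = - kappa g x.
Proof.
rewrite dot_flag_vec /kappa [in RHS]big_mkcond /=; congr (- _).
by apply: eq_bigr => B _; rewrite /indicator; case: ifP => _; rewrite ?mul1r ?mul0r.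
Qed.

Lemma dot_const (s : R) x : dot (const_mx s : V) x = s * \sum_i x 0 i.
Proof. by rewrite /dot mulr_sumr; apply: eq_bigr => i _; rewrite mxE. Qed.

(** Induction on the number of coordinates below the maximum: with [S] the set of these, raise them
    by the gap [d] between the two largest values and record [S] with coefficient [d]. The third
    clause of the strengthened claim keeps the sets found later inside [S]. *)
Lemma flag_vec_ex v : exists a (s : R),
  flag_fun a /\ v = flag_vec a + const_mx s.
Proof.
suff [a [s [aF aE _]]] : exists a (s : R), [/\ flag_fun a,
    v = flag_vec a + const_mx s &
    forall B i, 0 < a B -> i \in B -> exists j, v 0 i < v 0 j] by exists a, s.
move: {2}(#|_|) (leqnn #|[set i | [exists j, v 0 i < v 0 j]]|) => m.
elim: m v => [|m IH] v.
  rewrite leqn0 cards_eq0 => /eqP v0; exists (fun=> 0), (v 0 0); split.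
  - by split=> // B D; rewrite ltxx.
  - apply/rowP => i; rewrite !mxE /rank_of big1 // oppr0 add0r.
    have le j k : v 0 j <= v 0 k.
      rewrite leNgt; apply/negP => kj; have := finset.in_set0 k.
      by rewrite -v0 inE => /existsP[]; exists j.
    by apply/eqP; rewrite eq_le !le.
  - by move=> B i; rewrite ltxx.
set S := [set i | _] => cS.
have [S0|/finset.set0Pn[i0 i0S]] := eqVneq S finset.set0.
  by apply: IH; rewrite -/S S0 cards0.
have [j jS jmax] := @Order.TotalTheory.arg_maxP _ R _ i0 (mem S) (fun i => v 0 i) i0S.
have [t _ tmax] := @Order.TotalTheory.arg_maxP _ R _ i0 xpredT (fun i => v 0 i) isT.
pose d := v 0 t - v 0 j.
have d0 : 0 < d.
  rewrite subr_gt0; have : j \in S by []; rewrite inE => /existsP[k jk].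
  by apply: lt_le_trans jk _; exact: tmax.
have tS : t \notin S.
  rewrite inE; apply/existsP => -[k]; rewrite ltNge => /negP[]; exact: tmax.
pose v' := v + \row_i (d * (i \in S)%:R).
have v'E i : v' 0 i = if i \in S then v 0 i + d else v 0 i.
  by rewrite !mxE; case: ifP; rewrite ?mulr1 ?mulr0 ?addr0.
have v't i : v' 0 i <= v' 0 t.
  rewrite !v'E (negPf tS); case: ifP => iS; last exact: tmax.
  by have := jmax i iS; rewrite /d /=; lra.
have S'S : [set i | [exists j, v' 0 i < v' 0 j]] \proper S.
  apply/properP; split; last first.
    exists j => //; rewrite inE; apply/existsP => -[k]; rewrite ltNge => /negP[].
    apply: le_trans (v't k) _; rewrite !v'E (negPf tS).
    by have -> : j \in S by []; rewrite /d addrC subrK.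
  apply/fintype.subsetP => i; rewrite inE => /existsP[k ik]; apply: contraT => iS.
  move: ik; rewrite ltNge => /negP[]; apply: le_trans (v't k) _.
  rewrite !v'E (negPf tS) (negPf iS) leNgt; apply: contra iS => it.
  by rewrite inE; apply/existsP; exists t.
have [|a [s [aF aE aS]]] := IH v'.
  by rewrite -ltnS; apply: leq_trans cS; exact: proper_card.
have [a0 ac a00 aT] := aF.
have aSub B : 0 < a B -> B \subset S.
  move=> aB; apply/fintype.subsetP => i iB; apply: (fintype.subsetP (proper_sub S'S)).
  by have [k ik] := aS B i aB iB; rewrite inE; apply/existsP; exists k.
pose e B : R := (B == S)%:R.
have S0 : S != finset.set0 by apply/finset.set0Pn; exists i0.
have ST : S != [set: I] by apply: contraNneq tS => ->; rewrite inE.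
have eS B : 0 < add_mul a d e B -> B \subset S.
  have [-> //|BS] := eqVneq B S.
  by rewrite /add_mul /e (negPf BS) mulr0 addr0; exact: aSub.
exists (add_mul a d e), s; split.
- split.
  + by move=> B; rewrite addr_ge0 // mulr_ge0 ?ler0n // ltW.
  + move=> B D; have [->|BS] := eqVneq B S; first by move=> _ /eS ->; rewrite orbT.
    have [->|DS] := eqVneq D S; first by move=> /eS ->.
    by rewrite /add_mul /e (negPf BS) (negPf DS) !mulr0 !addr0; exact: ac.
  + by rewrite /add_mul /e eq_sym (negPf S0) a00 mulr0 addr0.
  + by rewrite /add_mul /e eq_sym (negPf ST) aT mulr0 addr0.
- have -> : v = v' - \row_i (d * (i \in S)%:R) by rewrite addrK.
  rewrite aE flag_vec_add_mul addrAC; congr (_ + _ + _).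
  apply/rowP => i; rewrite !mxE mulrN /rank_of; congr (- (_ * _)).
  rewrite big_mkcond (bigD1 S) //= big1 ?addr0 => [|B /negPf BS].
    by rewrite /e eqxx; case: (i \in S).
  by rewrite /e BS; case: ifP.
- move=> B i /eS /fintype.subsetP BS /BS; rewrite inE => /existsP[k ik].
  by exists k.
Qed.

Lemma dot_delta v i : dot v (delta_mx 0 i) = v 0 i.
Proof.
rewrite /dot (bigD1 i) //= !mxE !eqxx mulr1 big1 ?addr0 // => j ji.
by rewrite mxE (negPf ji) mulr0.
Qed.

End FlagVectors.

Section Simplices.
Local Open Scope classical_set_scope.
Variables (R : realType) (n : nat).
Local Notation I := 'I_n.+1.
Local Notation T := {set I}.
Local Notation V := 'rV[R]_n.+1.
Local Notation simplex := (@simplex R n).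
Implicit Types (a b : T -> R) (B D E : T) (g h : {set T}) (u v x y : V).

Lemma simplexE B i0 : i0 \in B ->
  simplex B = convex_combs (fun i => delta_mx 0 (if i \in B then i else i0)).
Proof.
move=> i0B; rewrite -conv_hullE; congr conv_hull.
apply/seteqP; split=> [_ [i /= iB <-]|_ [i _ <-]].
  by exists i => //; rewrite iB.
by exists (if i \in B then i else i0) => //=; case: ifP.
Qed.

Lemma lattice_polytope_simplex B : B != finset.set0 -> lattice_polytope (simplex B).
Proof.
move=> /finset.set0Pn[i0 i0B].
exists I, (fun i => delta_mx 0 (if i \in B then i else i0)); split.
- exact: (inhabits i0).
- exact: simplexE.
- by move=> i j; rewrite mxE rpred_nat.
Qed.

Lemma polytope_simplex B : B != finset.set0 -> polytope (simplex B).
Proof. by move/lattice_polytope_simplex/lattice_polytopeW. Qed.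

Lemma max_face_simplex v B i : i \in B -> max_face v (simplex B) (delta_mx 0 i) <->
  forall j, j \in B -> v 0 j <= v 0 i.
Proof.
move=> iB; have gen j : j \in B -> simplex B (delta_mx 0 j).
  move=> jB; rewrite (simplexE iB).
  have := convex_combs_gen (fun i' => delta_mx 0 (if i' \in B then i' else i) : V) j.
  by rewrite /= jB.
split=> [[_ M] j jB|M]; first by have := M _ (gen j jB); rewrite !dot_delta.
split; first exact: gen.
rewrite (simplexE iB); apply: convex_combs_le => j; rewrite !dot_delta.
by case: ifP => // jB; exact: M.
Qed.

Lemma max_face_simplex_sub u v B : B != finset.set0 ->
  max_face v (simplex B) `<=` max_face u (simplex B) <->
  forall i, i \in B -> (forall j, j \in B -> v 0 j <= v 0 i) ->
    forall j, j \in B -> u 0 j <= u 0 i.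
Proof.
move=> /finset.set0Pn[i0 i0B]; split=> [H i iB vi|H].
  by apply/(max_face_simplex u iB)/H/max_face_simplex.
apply: contrapT; rewrite (simplexE i0B) => /max_face_sub_gen[i].
rewrite -(simplexE i0B); set k := if _ then _ else _.
have kB : k \in B by rewrite /k; case: ifP.
by rewrite max_face_simplex // => /(H k kB) ku; apply; apply/max_face_simplex.
Qed.

Lemma max_face_simplex_mono a b B : flag_fun a -> (forall D, 0 <= b D) ->
  (forall D, a D = 0 -> b D = 0) -> B != finset.set0 ->
  max_face (flag_vec a) (simplex B) `<=` max_face (flag_vec b) (simplex B).
Proof.
move=> aF b0 ab B0; apply/max_face_simplex_sub => // i iB ai j jB.
have := ai j jB; rewrite !flag_vecE !lerN2; exact: rank_of_le.
Qed.

(* Normally equivalent to the permutohedron. *)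
Definition permutohedral_sum : set V :=
  minksum (simplex [set: I]%SET)
    (\big[@minksum R n.+1/[set 0]]_(b in A1 n) simplex (finset.cover b)).

Lemma A1P g : reflect (exists2 B, B \in B0 n & g = [set B]%SET) (g \in A1 n).
Proof.
apply: (iffP idP) => [|[B BB ->]].
  rewrite inE => /andP[gB /cards1P[B gE]]; exists B => //.
  by move: gB; rewrite gE => /B1_C1; rewrite in_C1 finset.sub1set => /andP[].
by rewrite inE set1_B1 // cards1.
Qed.

Lemma cover_set1 B : finset.cover [set B]%SET = B.
Proof. by rewrite /finset.cover big_set1. Qed.

Lemma setT_neq0 : [set: I]%SET != finset.set0.
Proof. by apply/finset.set0Pn; exists ord0; rewrite inE. Qed.

Lemma cover_A1_neq0 g : g \in A1 n -> finset.cover g != finset.set0.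
Proof. by move=> /A1P[B BB ->]; rewrite cover_set1; move: BB; rewrite in_B0 => /andP[]. Qed.

Lemma polytope_permutohedral_sum : polytope permutohedral_sum.
Proof.
apply: polytope_minksum; first by apply: polytope_simplex; exact: setT_neq0.
by apply: polytope_big_minksum => b /cover_A1_neq0; exact: polytope_simplex.
Qed.

(** The segments spanned by two basis vectors compare any two coordinates; by [rank_of_unsep] and
    [rank_of_sep] these comparisons detect the support. *)
Lemma max_face_permutohedral_sub a b : flag_fun a -> flag_fun b ->
  max_face (flag_vec a) permutohedral_sum `<=`
    max_face (flag_vec b) permutohedral_sum <->
  forall B, a B = 0 -> b B = 0.
Proof.
move=> aF bF; have [b0 _ b00 bT] := bF.
have PT := polytope_simplex setT_neq0.
have PA g : g \in A1 n -> polytope (simplex (finset.cover g)).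
  by move=> /cover_A1_neq0; exact: polytope_simplex.
rewrite max_face_minksum_sub //; last exact: polytope_big_minksum.
rewrite max_face_big_minksum_sub //; split=> [[HT HA] D aD|ab]; last first.
  split=> [|g gA]; apply: max_face_simplex_mono => //; first exact: setT_neq0.
  exact: cover_A1_neq0.
have HB B : B != finset.set0 -> max_face (flag_vec a) (simplex B) `<=`
    max_face (flag_vec b) (simplex B).
  move=> B0'; have [->//|BT] := eqVneq B [set: I]%SET.
  rewrite -[B]cover_set1; apply: HA; apply/A1P; exists B => //.
  by rewrite in_B0 B0'.
have [-> //|D0] := eqVneq D finset.set0.
have [-> //|DT] := eqVneq D [set: I]%SET.
apply/eqP; rewrite -[_ == _]negbK -pos_neq0 //; apply/negP => bD.
have [i [j [iD jD ij]]] := rank_of_unsep aF D0 DT aD.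
have ijn0 : [set i; j]%SET != finset.set0 by apply/finset.set0Pn; exists i; rewrite finset.set21.
have /(max_face_simplex_sub _ _ ijn0) H := HB _ ijn0.
have ai k : k \in [set i; j]%SET -> flag_vec a 0 k <= flag_vec a 0 i.
  by move=> /finset.set2P[->//|->]; rewrite !flag_vecE lerN2.
have := H i (finset.set21 _ _) ai j (finset.set22 _ _).
by rewrite !flag_vecE lerN2 leNgt (rank_of_sep bF bD).
Qed.

End Simplices.

Section TruncatedSummands.
Local Open Scope classical_set_scope.
Variables (R : realType) (n : nat).
Local Notation I := 'I_n.+1.
Local Notation T := {set I}.
Local Notation V := 'rV[R]_n.+1.
Local Notation simplex := (@simplex R n).
Local Notation P_B := (@P_B R n).
Local Notation m_of := (@m_of R n).
Local Notation "''1_' g" := (flag_vec (indicator R g)) (at level 8, g at level 2).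
Implicit Types (a b : T -> R) (B D E : T) (g h : {set T}) (P : set V) (k u v w x y : V).

Lemma B_of_neq0 g B : B \in B_of g -> B != finset.set0.
Proof.
rewrite inE => /orP[|/imsetP[i _ ->]]; first by rewrite inE => /andP[].
by apply/finset.set0Pn; exists i; rewrite finset.set11.
Qed.

Lemma lattice_polytope_P_B g : lattice_polytope (P_B g).
Proof.
apply: lattice_polytope_big_minksum => B /B_of_neq0; exact: lattice_polytope_simplex.
Qed.

Lemma polytope_P_B g : polytope (P_B g).
Proof. exact/lattice_polytopeW/lattice_polytope_P_B. Qed.

Lemma max_face_P_B_sub g u v : max_face v (P_B g) `<=` max_face u (P_B g) <->
  forall B, B \in B_of g -> max_face v (simplex B) `<=` max_face u (simplex B).
Proof.
by apply: max_face_big_minksum_sub => B /B_of_neq0; exact: polytope_simplex.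
Qed.

Lemma max_face_P_B_mono g a b : flag_fun a -> (forall D, 0 <= b D) ->
  (forall D, a D = 0 -> b D = 0) ->
  max_face (flag_vec a) (P_B g) `<=` max_face (flag_vec b) (P_B g).
Proof.
move=> aF b0 ab; apply/max_face_P_B_sub => B /B_of_neq0.
exact: max_face_simplex_mono.
Qed.

(** The lowest face contains a vertex ([vertex_in_face]), so the infimum over the vertices is
    attained and is the minimum over the polytope. *)
Lemma m_of_min g : (exists2 z, max_face '1_g (P_B g) z & kappa g z = m_of g) /\
  forall x, P_B g x -> m_of g <= kappa g x.
Proof.
have [z zv zk] := vertex_in_face '1_g (polytope_P_B g).
suff zE : kappa g z = m_of g.
  split; first by exists z.
  by move=> x Px; rewrite -zE -lerN2 -!dot_indic; case: zk => _; exact.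
have zM x : vertices (P_B g) x -> kappa g z <= kappa g x.
  move=> [_ [v e]]; rewrite -lerN2 -!dot_indic; case: zk => _; apply.
  have : [set x] x by [].
  by rewrite e => -[].
apply/eqP; rewrite eq_le; apply/andP; split.
  apply: lb_le_inf; first by exists (kappa g z), z.
  by move=> _ [x xv <-]; exact: zM.
apply: ge_inf; last by exists z.
by exists (kappa g z) => _ [x xv <-]; exact: zM.
Qed.

(** A generator outside the face of [w] is outside that of [k] as well, and two distinct integers
    differ by at least 1. This gap of 1 is what [c <= 1] refers to. *)
Lemma lattice_gap P k v w : lattice_polytope P ->
  (forall j, k 0 j \is a Num.int) ->
  ~ (max_face v P `<=` max_face w P) -> max_face k P `<=` max_face w P ->
  exists y, [/\ max_face v P y, ~ max_face w P y &
    forall z, max_face k P z -> dot k y <= dot k z - 1].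
Proof.
move=> [S [p [S0 PE pZ]]] kZ nvw kw; move: nvw; rewrite PE.
move=> /max_face_sub_gen[i iv iw]; exists (p i); split=> // z zk.
have dZ j : dot k (p j) \is a Num.int by apply: rpred_sum => l _; rewrite rpredM.
have [j jk] := max_face_gen_ex p k S0.
rewrite (max_face_value zk jk).
have : dot k (p i) < dot k (p j).
  have [_ jM] := jk; rewrite lt_neqAle jM ?andbT; last exact: convex_combs_gen.
  apply/eqP => e; apply: iw; rewrite -PE; apply: kw; rewrite PE; split.
    exact: convex_combs_gen.
  by move=> x Px; rewrite e; exact: jM.
have /intrP[r ->] := dZ i; have /intrP[s ->] := dZ j.
by rewrite ltr_int -[1]/(1%:~R) -intrB ler_int lerBrDr lezD1.
Qed.

Section OneSummand.
Variables (g : {set T}) (c : R).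
Hypothesis gB : g \in B1 n.
Hypothesis c01 : 0 < c <= 1.

Definition truncated_summand : set V :=
  P_B g `&` [set x | m_of g + c <= kappa g x].

Local Notation L := (- (m_of g + c)).

Lemma truncated_summandE :
  truncated_summand = P_B g `&` [set x | dot '1_g x <= L].
Proof.
by congr (_ `&` _); apply/seteqP; split=> x /=; rewrite dot_indic lerN2.
Qed.

Lemma indic_ge0 h B : 0 <= indicator R h B. Proof. exact: ler0n. Qed.

(* At D the face cannot be contained in the facet of D, because some summand
   simplex that is not contained in D is minimised at a vertex of D. *)
Lemma max_face_P_B_unsep a D : flag_fun a -> D \in g -> a D = 0 ->
  (forall E i j, E \in g -> D \proper E -> i \in E -> j \notin E ->
    rank_of a j <= rank_of a i) ->
  ~ (max_face (flag_vec a) (P_B g) `<=` max_face '1_[set D]%SET (P_B g)).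
Proof.
move=> aF Dg aD sep /max_face_P_B_sub H.
have [_ gne gc gs] : saturated g by apply/B1P.
have /andP[D0 DT] := gne D Dg.
have [i [j [iD jD ij]]] := rank_of_unsep aF D0 DT aD.
have [i0 i0D imin] := @Order.TotalTheory.arg_minP _ R _ i (mem D) (rank_of a) iD.
have i0j : rank_of a i0 <= rank_of a j by apply: le_trans ij; exact: imin.
suff [E [EB DE Em]] : exists E, [/\ E \in B_of g, D \proper E &
    forall q, q \in E -> rank_of a i0 <= rank_of a q].
  have [/fintype.subsetP DsE [z zE zD]] := properP DE.
  have /(max_face_simplex_sub _ _ (B_of_neq0 EB)) := H E EB.
  move=> /(_ i0 (DsE _ i0D)) HE.
  have : '1_[set D]%SET 0 z <= '1_[set D]%SET 0 i0.
    by apply: HE => // q qE; rewrite !flag_vecE lerN2 Em.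
  rewrite !flag_vecE lerN2 /rank_of (bigD1 D) //= /indicator finset.set11.
  rewrite [leRHS]big1 => [|B zB].
    by rewrite leNgt ltr_wpDr ?ltr01 // sumr_ge0 // => *; rewrite ler0n.
  by rewrite inE; case: eqP => // BD; rewrite -BD zB in zD.
(* Below the top of [g] take the next member [E]. Its only new element is [j], or else [j] is
   outside [E] and [sep] bounds the rank of the new element from below. *)
case: (boolP [exists E in g, #|D| < #|E|]%N) => [/exists_inP[E' E'g DE']|].
  have [E Eg cE] := gs D E' #|D|.+1 Dg E'g (introT andP (conj (leqnSn _) DE')).
  have DE : D \proper E.
    rewrite properEcard cE ltnSn andbT; apply: (set_chain_leq gc) => //.
    by rewrite cE.
  exists E; split=> //.
    by rewrite !inE Eg; have /andP[-> _] := gne E Eg.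
  move=> q qE; have [qD|qD] := boolP (q \in D); first exact: imin.
  apply: (le_trans i0j); have [jE|jE] := boolP (j \in E); last exact: sep jE.
  suff -> : q = j by [].
  have : (#|E :\: D| == 1)%N.
    by rewrite cardsD (finset.setIidPr (proper_sub DE)) cE subSnn.
  move=> /cards1P[z Ez]; have := finset.in_set1 q z; have := finset.in_set1 j z.
  by rewrite -Ez !inE qD jD qE jE => /esym/eqP -> /esym/eqP ->.
(* If [D] is the top of [g], adding [j] gives a set properly containing [beta_max g], whose simplex
   is a summand. *)
move=> /exists_inPn Dmax; exists (j |: D)%SET; split.
- rewrite !inE; apply/orP; left; apply/andP; split.
    by apply/finset.set0Pn; exists j; rewrite setU11.
  apply/or3P/Or33/properP; split; last first.
    exists j; first by rewrite setU11.
    apply/negP => /bigcupP[B Bg jB]; case/negP: jD; apply: fintype.subsetP jB.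
    by apply: (set_chain_leq gc) => //; rewrite leqNgt Dmax.
  apply/bigcupsP => B Bg; apply: fintype.subset_trans (finset.subsetUr _ _).
  by apply: (set_chain_leq gc) => //; rewrite leqNgt Dmax.
- by rewrite properEcard finset.subsetUr cardsU1 jD /= add1n.
- by move=> q; rewrite !inE => /predU1P[->|] //; exact: imin.
Qed.

Section Face.
Variables (a : T -> R) (Z : T).
Hypothesis aF : flag_fun a.
Hypothesis Zm : argmin a g Z.
Let a' := add_mul a (- a Z) (indicator R g).

Lemma add_mul_indicE B : a' B = if B \in g then a B - a Z else a B.
Proof. by rewrite /a' /add_mul /indicator; case: ifP => _; rewrite ?mulr1 ?mulr0 ?addr0. Qed.

Lemma reduced_support B : a B = 0 -> a' B = 0.
Proof.
rewrite add_mul_indicE; case: ifP => // Bg aB; have [a0 _ _ _] := aF.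
have := a0 Z; have := (proj2 Zm) B Bg; rewrite aB => z1 z2.
by apply/eqP; rewrite subr_eq0 eq_le z1 z2.
Qed.

Lemma flag_fun_reduced : flag_fun a'.
Proof.
apply: (flag_funS aF) reduced_support => B; rewrite add_mul_indicE.
by case: ifP => [Bg|_]; [rewrite subr_ge0 (proj2 Zm)|case: aF].
Qed.

(** Since [a'] vanishes at [D], [max_face_P_B_unsep] provides a failing inclusion and [lattice_gap]
    turns it into a point at least 1 beyond the lowest [kappa]-level, which the half-space keeps
    because [c <= 1]. *)
Lemma reduced_gap D : D \in g -> a D = a Z ->
  (forall E, E \in g -> D \proper E -> 0 < a E) ->
  exists y, [/\ max_face (flag_vec a') (P_B g) y,
    ~ max_face '1_[set D]%SET (P_B g) y & dot '1_g y <= L].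
Proof.
move=> Dg aD pos.
have a'D : a' D = 0 by rewrite add_mul_indicE Dg aD subrr.
have [|||y [ya yD yL]] := lattice_gap (k := '1_g) (v := flag_vec a')
    (w := '1_[set D]%SET) (lattice_polytope_P_B g).
- move=> j; rewrite flag_vecE rpredN; apply: rpred_sum => B _.
  by rewrite rpred_nat.
- apply: max_face_P_B_unsep => //; first exact: flag_fun_reduced.
  move=> E i j Eg DE iE jE; apply: (rank_of_le aF).
  + by case: flag_fun_reduced.
  + exact: reduced_support.
  + by apply/ltW/(rank_of_sep aF (pos E Eg DE)).
- apply: max_face_P_B_mono; [exact: flag_fun_indic|exact: indic_ge0|].
  move=> B; rewrite /indicator inE; case: eqP => // ->; rewrite Dg => /eqP.
  by rewrite oner_eq0.
exists y; split=> //; have [[z zg zE] _] := m_of_min g.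
apply: le_trans (yL z zg) _; rewrite dot_indic zE; case/andP: c01 => *; lra.
Qed.

(** The largest minimiser of [a] in [g] qualifies as [D]: on larger members [a] exceeds [a Z], hence
    is positive. *)
Lemma reduced_gap_ex :
  exists2 y, max_face (flag_vec a') (P_B g) y & dot '1_g y <= L.
Proof.
have [a0 _ _ _] := aF.
pose p D := (D \in g) && (a D == a Z).
have [Zg _] := Zm; have pZ : p Z by rewrite /p Zg eqxx.
pose D := [arg max_(B > Z | p B) #|B|].
have [/andP[Dg /eqP aD] Dmax] : p D /\ forall E, p E -> (#|E| <= #|D|)%N.
  by rewrite /D; case: arg_maxnP.
have [|y [ya _ yL]] := reduced_gap Dg aD; last by exists y.
move=> E Eg DE; apply: le_lt_trans (a0 Z) _.
rewrite lt_neqAle (proj2 Zm) // andbT; apply/eqP => e.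
by have := proper_card DE; rewrite ltnNge Dmax // /p Eg e eqxx.
Qed.

(** Here [g] is in the support of [a], so the face of [a] lies in the lowest [kappa]-face, which is
    cut off because [c > 0]. Together with [reduced_gap_ex] this shows that the face of [a'] meets
    both sides of the hyperplane. *)
Lemma reduced_top : 0 < a Z -> exists2 x,
  max_face (flag_vec a') (P_B g) x & L < dot '1_g x.
Proof.
move=> aZ; have [x xa] := max_face_neq0 (flag_vec a) (polytope_P_B g).
exists x.
  apply: max_face_P_B_mono xa => //; last exact: reduced_support.
  by case: flag_fun_reduced.
have xg : max_face '1_g (P_B g) x.
  apply: max_face_P_B_mono xa => //.
  move=> B aB; rewrite /indicator; case: (boolP (B \in g)) => // Bg.
  by have := (proj2 Zm) B Bg; rewrite leNgt aB aZ.
have [[z zg zE] _] := m_of_min g.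
by rewrite (max_face_value xg zg) dot_indic zE; case/andP: c01 => *; lra.
Qed.

Lemma max_face_truncated_summand :
  max_face (flag_vec a) truncated_summand !=set0 /\
  forall x, max_face (flag_vec a) truncated_summand x <->
    [/\ max_face (flag_vec a') (P_B g) x, dot '1_g x <= L &
        0 < a Z -> dot '1_g x = L].
Proof.
rewrite -{1 2}[a](add_mulK a (a Z) (indicator R g)) flag_vec_add_mul.
rewrite truncated_summandE; have [y ya yL] := reduced_gap_ex.
apply: (max_face_cut _ _ ya yL); first exact: segment_polytope (polytope_P_B g).
  by case: aF.
by move=> /reduced_top[x xa /ltW xL]; exists x.
Qed.

End Face.

Lemma polytope_truncated_summand : polytope truncated_summand.
Proof.
rewrite truncated_summandE; apply: polytope_halfspace_le (polytope_P_B g) _.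
have F0 : flag_fun (fun _ : T => 0 : R).
  by split=> // B D; rewrite ltxx.
have [/finset.set0Pn[Z Zg] _ _ _] : saturated g by apply/B1P.
have [//|y [Py _] yL] := @reduced_gap_ex (fun=> 0) Z F0 _.
by exists y.
Qed.

Lemma max_face_truncated_summand_sub a b : flag_fun a -> flag_fun b ->
  (forall B, a B = 0 -> b B = 0) ->
  max_face (flag_vec a) truncated_summand `<=`
    max_face (flag_vec b) truncated_summand <->
  forall B, argmin a g B -> argmin b g B.
Proof.
move=> aF bF ab; have [a0 _ _ _] := aF; have [b0 _ _ _] := bF.
have [g0 _ _ _] : saturated g by apply/B1P.
have [Z Zm] := argmin_ex a g0; have [Y Ym] := argmin_ex b g0.
have [_ faceA] := max_face_truncated_summand aF Zm.
have [_ faceB] := max_face_truncated_summand bF Ym.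
pose a' := add_mul a (- a Z) (indicator R g).
have [a'F b'F] := (flag_fun_reduced aF Zm, flag_fun_reduced bF Ym).
split=> [H B Bm|H x]; last first.
  move=> /faceA[xa xL xE]; apply/faceB; split=> //.
    apply: max_face_P_B_mono xa => //; first by case: b'F.
    move=> B; rewrite !add_mul_indicE; case: ifP => Bg; last exact: ab.
    move=> /eqP; rewrite subr_eq0 => /eqP e; apply/eqP; rewrite subr_eq0.
    by apply/eqP/argmin_eq/Ym/H; split=> // D Dg; rewrite e; exact: (proj2 Zm).
  move=> bY; apply: xE; rewrite pos_neq0 //; apply/eqP => /ab bZ.
  by have := argmin_eq Ym (H Z Zm); rewrite bZ => e; rewrite e ltxx in bY.
have aB : a B = a Z by exact: argmin_eq Bm Zm.
have Bg : B \in g by case: Bm.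
suff bB : b B = b Y by split=> // D Dg; rewrite bB (proj2 Ym).
have [aZ|aZ] := eqVneq (a Z) 0.
  have bB : b B = 0 by apply: ab; rewrite aB.
  by apply/eqP; rewrite eq_le (proj2 Ym) // bB b0.
rewrite -pos_neq0 // in aZ; apply: contrapT => /eqP bBY.
(* Suppose that [B] does not minimise [b]. The segment from [y] to a point [z] beyond the cut meets
   the hyperplane in a point [x] of the face of [a], with positive weight on [y]. As the reduced [b]
   is positive at [B], the point [x], and with it [y], lies in the face in direction of the
   indicator of {B}, against the choice of [y]. *)
have [|y [ya yD yL]] := reduced_gap aF Zm Bg aB.
  by move=> E Eg _; apply: lt_le_trans aZ _; exact: (proj2 Zm).
have [z za zL] := reduced_top aF Zm aZ.
have [t [t01 tL /(_ zL) t0 _]] := segment_level yL (ltW zL).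
set x := _ *: _ + _ in tL.
have xa : max_face (flag_vec a') (P_B g) x.
  by apply: segment_max_face => //; exact: segment_polytope (polytope_P_B g).
have /H/faceB[xb _ _] : max_face (flag_vec a) truncated_summand x.
  by apply/faceA; rewrite tL.
apply: yD; apply: (max_face_segment (y := z) (t := t)).
- by case: ya.
- by case: za.
- by rewrite t0; case/andP: t01.
apply: max_face_P_B_mono xb => //.
move=> D; rewrite add_mul_indicE /indicator inE; case: eqP => // -> /eqP.
by rewrite Bg subr_eq0 (negPf bBY).
Qed.

End OneSummand.

End TruncatedSummands.

(** * Truncations *)

Section Dimension.
Local Open Scope classical_set_scope.
Variables (R : realType) (n : nat).
Local Notation V := 'rV[R]_n.+1.
Implicit Types (A P F : set V) (u v w x y : V).

Lemma affine_hull_sub A x : A x -> affine_hull A x.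
Proof.
move=> Ax; exists 1%N, (fun=> x), (fun=> 1); split=> //.
  by rewrite big_ord_recl big_ord0 addr0.
by rewrite big_ord_recl big_ord0 addr0 scale1r.
Qed.

Lemma direction_sub A x (U : 'M[R]_n.+1) p q :
  affine_hull A = [set x + u | u in [set u : V | (u <= U)%MS]] ->
  A p -> A q -> (p - q <= U)%MS.
Proof.
move=> e /affine_hull_sub + /affine_hull_sub; rewrite e.
move=> [u /= uU <-] [v /= vU <-].
by rewrite opprD addrACA subrr add0r addmx_sub // eqmx_opp.
Qed.

Lemma direction_orth A x (U : 'M[R]_n.+1) w (s : R) u :
  affine_hull A = [set x + u | u in [set u : V | (u <= U)%MS]] ->
  (forall p, A p -> dot w p = s) -> (u <= U)%MS -> dot w u = 0.
Proof.
move=> e As uU; have hs p : affine_hull A p -> dot w p = s.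
  move=> [m [q [c [Aq c1 ->]]]]; rewrite dot_sumr -[s]mul1r -c1 mulr_suml.
  by apply: eq_bigr => i _; rewrite As.
have /hs xs : affine_hull A x.
  by rewrite e; exists 0; rewrite /= ?sub0mx ?addr0.
have /hs : affine_hull A (x + u) by rewrite e; exists u.
by rewrite dotDr xs => h; lra.
Qed.

Lemma dot_indicator (D : {set 'I_n.+1}) x :
  dot (\row_i (i \in D)%:R) x = \sum_(i in D) x 0 i.
Proof.
rewrite /dot [RHS]big_mkcond /=; apply: eq_bigr => i _; rewrite mxE.
by case: ifP; rewrite ?mul1r ?mul0r.
Qed.

(** A translated standard simplex already spans the whole hyperplane of constant coordinate sum. *)
Lemma has_dim_simplices A (r : V) (s : R) : (forall p, A p -> \sum_i p 0 i = s) ->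
  (forall i, A (r + delta_mx 0 i)) -> has_dim A n.
Proof.
move=> As Ar; pose o : 'cV[R]_n.+1 := const_mx 1.
have mulo (u : V) : u *m o = (\sum_i u 0 i)%:M.
  apply/matrixP => i j; rewrite !ord1 !mxE eqxx mulr1n; apply: eq_bigr => k _.
  by rewrite mxE mulr1.
have inK (u : V) : (u <= kermx o)%MS = (\sum_i u 0 i == 0).
  apply/sub_kermxP/eqP => [|u0]; rewrite mulo; last rewrite u0.
    move=> /matrixP/(_ 0 0).
    by rewrite !mxE eqxx mulr1n.
  by apply/matrixP => i j; rewrite !mxE mul0rn.
have SE (u : V) : \sum_i u 0 i = dot (const_mx 1) u by rewrite dot_const mul1r.
have sum_delta j : dot (const_mx 1) (delta_mx 0 j : V) = 1 by rewrite dot_delta mxE.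
have sumr : dot (const_mx 1) r = s - 1.
  by have := As _ (Ar ord0); rewrite SE dotDr sum_delta => <-; rewrite addrK.
exists (r + delta_mx 0 ord0), (kermx o); split; last first.
  rewrite mxrank_ker; have -> : \rank o = 1%N; last by rewrite subn1.
  rewrite -mxrank_tr rank_rV; have -> // : o^T != 0.
  apply/eqP => /matrixP /(_ 0 0); rewrite !mxE => /eqP; rewrite oner_eq0 //.
apply/seteqP; split=> [x [m [p [w [Ap w1 ->]]]]|_ [u /= + <-]].
  exists (\sum_i w i *: p i - (r + delta_mx 0 ord0)); last by rewrite addrCA subrr addr0.
  rewrite /= inK SE dotDr dotNr dotDr sumr sum_delta subrK dot_sumr.
  under eq_bigr do rewrite -SE As //.
  by rewrite -mulr_suml w1 mul1r subrr.
rewrite inK => /eqP u0; set x := _ + u.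
have xr : \sum_i (x - r) 0 i = 1.
  rewrite /x addrAC [r + _]addrC addrK SE dotDr -SE -[X in _ + X]SE u0 addr0.
  by rewrite SE sum_delta.
exists n.+1, (fun i => r + delta_mx 0 i), (fun i => (x - r) 0 i); split=> //.
under eq_bigr do rewrite scalerDr.
by rewrite big_split /= -scaler_suml xr scale1r -row_sum_delta addrC subrK.
Qed.

(** The sums over [D], over [E] and over all coordinates are three independent functionals that are
    constant on [F], so [F] has dimension at most n - 2, while [P] has dimension at least n. *)
Lemma codim2_not_facet P F (r : V) (D E : {set 'I_n.+1}) (s t : R) :
  D != finset.set0 -> D \proper E -> E != [set: 'I_n.+1]%SET ->
  (forall i, P (r + delta_mx 0 i)) ->
  (exists s', forall p, F p -> \sum_i p 0 i = s') ->
  (forall p, F p -> \sum_(i in D) p 0 i = s) ->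
  (forall p, F p -> \sum_(i in E) p 0 i = t) -> ~ facet P F.
Proof.
move=> D0 DE ET Pr [s' Fs'] Fs Ft [_ [d [[x [U [eP rU]]] [y [W [eF rW]]]]]].
have big : (n <= d.+1)%N.
  have : (1%:M <= U + (delta_mx 0 ord0 : V))%MS.
    apply/row_subP => i; rewrite row1.
    have -> : delta_mx 0 i = (r + delta_mx 0 i) - (r + delta_mx 0 ord0)
        + delta_mx 0 ord0 :> V.
      by rewrite opprD addrACA subrr add0r subrK.
    by rewrite addmx_sub_adds // (direction_sub eP).
  move/mxrankS; rewrite mxrank1 => H.
  have := leq_trans H (mxrank_adds_leqif _ _).1.
  by rewrite rU rank_rV; case: (_ != 0); rewrite ?addn0 ?addn1 //; exact: leqW.
pose w (k : 'I_3) : {set 'I_n.+1} :=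
  match val k with 0%N => [set: 'I_n.+1]%SET | 1%N => D | _ => E end.
pose M : 'M[R]_(n.+1, 3) := \matrix_(i, k) (i \in w k)%:R.
have WM : W *m M = 0.
  apply/row_matrixP => i; rewrite row_mul row0; apply/rowP => k.
  have := row_sub i W; set u := row i W => uW.
  have -> : (u *m M) 0 k = dot (\row_i (i \in w k)%:R) u.
    by rewrite mxE /dot; apply: eq_bigr => j _; rewrite !mxE mulrC.
  rewrite [RHS]mxE.
  have wk p : F p -> dot (\row_i (i \in w k)%:R) p =
      match val k with 0%N => s' | 1%N => s | _ => t end.
    rewrite dot_indicator /w; case: k => -[|[|k]] /= _ Fp; [|exact: Fs|exact: Ft].
    by rewrite -(Fs' p Fp); apply: eq_bigl => j; rewrite inE.
  exact: direction_orth eF wk uW.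
have [i iD] := finset.set0Pn _ D0.
have [/fintype.subsetP DsE [j jE jD]] := properP DE.
have [l lE] : exists l, l \notin E.
  by move: ET; rewrite -finset.subTset => /subsetPn[l _ ?]; exists l.
have iE := DsE i iD.
have lD : l \notin D by apply: contra lE => /DsE.
(* The rows of [l], [j] and [i] are (1,0,0), (1,0,1) and (1,1,1). *)
have rM : (3 <= \rank M)%N.
  have : (1%:M <= M)%MS.
    apply/row_subP => k; rewrite row1.
    have r0 : delta_mx 0 k = row l M \/ delta_mx 0 k = row i M - row j M \/
        delta_mx 0 k = row j M - row l M.
      case: k => -[|[|[|//]]] klt; [left|right; left|right; right];
      apply/rowP => -[[|[|[|//]]] qlt]; rewrite !mxE /w /= ?inE;
      by rewrite ?iE ?iD ?jE ?(negPf jD) ?(negPf lE) ?(negPf lD) ?subrr ?subr0.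
    by case: r0 => [->|[->|->]]; rewrite ?addmx_sub ?eqmx_opp ?row_sub.
  by move/mxrankS; rewrite mxrank1.
have := mulmx0_rank_max WM; rewrite rW => H.
have : (d + 3 <= n.+1)%N by apply: leq_trans H; rewrite leq_add2l.
lia.
Qed.

End Dimension.

(** * One truncation step on a partial sum *)

Section TruncatorSummands.
Local Open Scope classical_set_scope.
Variables (R : realType) (n : nat) (c : R).
Hypothesis c01 : 0 < c <= 1.
Local Notation I := 'I_n.+1.
Local Notation T := {set I}.
Local Notation V := 'rV[R]_n.+1.
Local Notation "''1_' g" := (flag_vec (indicator R g)) (at level 8, g at level 2).
Local Notation le X := (argmin_le (test_set X)).
Implicit Types (a b : T -> R) (B D E : T) (g h k : {set T}) (X : {set {set T}})
  (P Q : set V) (u v w x y : V).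

Definition constant_sum P : Prop :=
  exists s : R, forall x, P x -> \sum_i x 0 i = s.

Definition contains_simplex P : Prop :=
  exists r : V, forall i, P (r + delta_mx 0 i).

Lemma constant_sum_minksum P Q :
  constant_sum P -> constant_sum Q -> constant_sum (minksum P Q).
Proof.
move=> [s Ps] [t Qt]; exists (s + t) => _ [x Px [y Qy <-]].
under eq_bigr do rewrite mxE.
by rewrite big_split /= Ps // Qt.
Qed.

Lemma constant_sum_big_minksum (K : finType) (A : {set K}) (f : K -> set V) :
  (forall j, j \in A -> constant_sum (f j)) ->
  constant_sum (\big[@minksum R n.+1/[set 0]]_(j in A) f j).
Proof.
move=> fs; elim/big_ind: _ => //; last exact: constant_sum_minksum.
by exists 0 => _ ->; rewrite big1 // => i _; rewrite mxE.
Qed.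

Lemma constant_sumS P Q : Q `<=` P -> constant_sum P -> constant_sum Q.
Proof. by move=> QP [s Ps]; exists s => x /QP; exact: Ps. Qed.

Lemma constant_sum_simplex B : B != finset.set0 -> constant_sum (simplex B : set V).
Proof.
move=> /finset.set0Pn[i iB]; exists 1 => x; rewrite (simplexE R iB).
move=> [w [_ w1 ->]]; rewrite -[LHS]mul1r -dot_const dot_sumr -[RHS]w1.
by apply: eq_bigr => j _; rewrite dot_delta mxE mulr1.
Qed.

Lemma constant_sum_truncated_summand g : constant_sum (truncated_summand g c).
Proof.
apply: (@constant_sumS (P_B g)); first by move=> x [].
by apply: constant_sum_big_minksum => B /B_of_neq0; exact: constant_sum_simplex.
Qed.

Lemma max_face_shift P v (s : R) : constant_sum P ->
  max_face (v + const_mx s) P = max_face v P.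
Proof.
move=> [t Pt]; apply/seteqP; split=> x [Px xM]; split=> // z Pz;
  have := xM z Pz; rewrite !dotDl !dot_const !Pt //; last by rewrite lerD2r.
by rewrite lerD2r.
Qed.

Lemma normally_equivalent_flags P Q : constant_sum P -> constant_sum Q ->
  (forall v, max_face v P !=set0) -> (forall v, max_face v Q !=set0) ->
  (forall a b, flag_fun a -> flag_fun b ->
    max_face (flag_vec a) P `<=` max_face (flag_vec b) P <->
    max_face (flag_vec a) Q `<=` max_face (flag_vec b) Q) ->
  normally_equivalent P Q.
Proof.
move=> Ps Qs Pn Qn H; apply: normally_equivalentP => // u v.
have [b [s [bF ->]]] := flag_vec_ex u; have [a [t [aF ->]]] := flag_vec_ex v.
by rewrite !max_face_shift //; exact: H.
Qed.

(** The invariant of the partial sums: the last clause describes the normal fan by the tests [X],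
    and the translated simplex ensures full dimension, which the facet condition of a truncation
    needs. *)
Definition ordered_by P X : Prop :=
  [/\ polytope P, constant_sum P, contains_simplex P &
    forall a b, flag_fun a -> flag_fun b ->
      max_face (flag_vec a) P `<=` max_face (flag_vec b) P <-> le X b a].

Lemma contains_simplex_minksum P Q : polytope Q -> contains_simplex P ->
  contains_simplex (minksum P Q).
Proof.
move=> /polytope_neq0[q Qq] [r Pr]; exists (r + q) => i.
by exists (r + delta_mx 0 i) => //; exists q => //; rewrite addrAC.
Qed.

Lemma le_setU1 X g a b : flag_fun a -> flag_fun b ->
  le (g |: X)%SET b a <-> le X b a /\ forall B, argmin a g B -> argmin b g B.
Proof.
move=> aF bF; rewrite !argmin_leP //; split=> [[ab H]|[[ab HX] Hg]].
  split; last by apply: H; rewrite setU11.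
  by split=> // h hX; apply: H; rewrite inE hX orbT.
by split=> // h /finset.setU1P[->|]; [exact: Hg|exact: HX].
Qed.

Lemma ordered_by_permutohedral : ordered_by (@permutohedral_sum R n) finset.set0.
Proof.
have PA := @polytope_big_minksum R n.+1 _ (fun g => @simplex R n (finset.cover g)) (A1 n)
  (fun g gA => @polytope_simplex R n _ (cover_A1_neq0 gA)).
split.
- exact: polytope_permutohedral_sum.
- apply: constant_sum_minksum; first by apply: constant_sum_simplex; exact: setT_neq0.
  by apply: constant_sum_big_minksum => g /cover_A1_neq0; exact: constant_sum_simplex.
- apply: contains_simplex_minksum => //; exists 0 => i; rewrite add0r.
  have iT : i \in [set: I]%SET by rewrite inE.
  rewrite (simplexE R iT).
  have := convex_combs_gen (fun j => delta_mx 0 (if j \in [set: I]%SET then j else i) : V) i.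
  by rewrite /= inE.
- move=> a b aF bF; rewrite max_face_permutohedral_sub // argmin_leP //.
  by split=> [ab|[]//]; split=> // h; rewrite inE.
Qed.

Lemma ordered_by_minksum P X g : g \in B1 n -> ordered_by P X ->
  ordered_by (minksum P (truncated_summand g c)) (g |: X)%SET.
Proof.
move=> gB [PP Ps Pi PX]; have PT := polytope_truncated_summand gB c01; split.
- exact: polytope_minksum.
- by apply: constant_sum_minksum => //; exact: constant_sum_truncated_summand.
- exact: contains_simplex_minksum.
- move=> a b aF bF; rewrite max_face_minksum_sub // PX // le_setU1 //.
  split=> -[ab H]; split=> //; have sup := argmin_le_support aF bF ab.
    by apply/(max_face_truncated_summand_sub gB c01 aF bF sup).
  by apply/(max_face_truncated_summand_sub gB c01 aF bF sup).
Qed.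

Lemma A2_B1 g : g \in A2 n -> g \in B1 n.
Proof. by move/A2P => []. Qed.

Lemma ordered_by_PA_c : ordered_by (PA_c R n c) (A2 n).
Proof.
have [PP Ps Pi PX] := ordered_by_permutohedral.
have PT g : g \in A2 n -> polytope (truncated_summand g c).
  by move=> /A2_B1 gB; exact: polytope_truncated_summand.
have PTs : polytope (\big[@minksum R n.+1/[set 0]]_(g in A2 n) truncated_summand g c).
  exact: polytope_big_minksum.
have -> : PA_c R n c = minksum (@permutohedral_sum R n)
    (\big[@minksum R n.+1/[set 0]]_(g in A2 n) truncated_summand g c) by [].
split.
- exact: polytope_minksum.
- apply: constant_sum_minksum => //; apply: constant_sum_big_minksum => g _.
  exact: constant_sum_truncated_summand.
- exact: contains_simplex_minksum.
- move=> a b aF bF; rewrite max_face_minksum_sub // PX //.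
  rewrite max_face_big_minksum_sub // argmin_leP // argmin_leP //.
  split=> [[[ab _] H]|[ab H]].
    split=> // g gA; apply/(max_face_truncated_summand_sub _ c01 aF bF ab).
      exact: A2_B1.
    exact: H.
  split; first by split=> // g; rewrite inE.
  move=> g gA; apply/(max_face_truncated_summand_sub (A2_B1 gA) c01 aF bF ab).
  exact: H.
Qed.

(* X can be the set of the members of A_2 before g in an order of truncation. *)
Definition precede X g : Prop :=
  (forall h, h \in X -> [/\ h \in B1 n, h != g & (#|g| <= #|h|)%N]) /\
  (forall h, h \in B1 n -> (#|g| < #|h|)%N -> h \in X).

Section Stage.
Variables (X : {set {set T}}) (g : {set T}).
Hypothesis gA : g \in A2 n.
Hypothesis gX : precede X g.

Let gB : g \in B1 n. Proof. exact: A2_B1. Qed.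

Let gS : saturated g. Proof. exact/B1P. Qed.

(** The order by decreasing size enters here: a member of [X] is no smaller than [g] and different
    from it, so if it meets [g] within a common chain, the union is a larger member of [B1] and
    belongs to [X]. *)
Lemma stage_join h : test_set X h -> (h :&: g != finset.set0)%SET ->
  ~~ (h \subset g) /\ test_set X (h :|: g)%SET.
Proof.
move=> th /finset.set0Pn[B /finset.setIP[Bh Bg]]; have [g0 gne gc gs] := gS.
have nhg : ~~ (h \subset g).
  case/or3P: th => [hX|h0|hc].
  - have [_ hg gh] := gX.1 h hX; apply: contra hg => hg.
    by rewrite eqEcard hg.
  - by apply/negP => /fintype.subsetP/(_ _ h0)/gne; rewrite eqxx.
  - by apply: contra hc => /set_chainS; exact.
split=> //; rewrite /test_set; case: (boolP (set_chain _)) => [hgc|]; last by rewrite !orbT.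
case: (boolP (finset.set0 \in h)) => [h0|h0]; first by rewrite inE h0 orbT.
have hX : h \in X.
  case/or3P: th => //; first by rewrite (negPf h0).
  by rewrite (set_chainS (finset.subsetUl h g)).
have [hB _ _] := gX.1 h hX; apply/orP; left; apply: gX.2.
  exact: (meeting_B1 hB gB hgc Bh Bg).
apply: proper_card; apply/properP; split; first exact: finset.subsetUr.
by have [D Dh Dg] := subsetPn nhg; exists D; rewrite ?inE ?Dh.
Qed.

Lemma stage_union h k : test_set X h -> test_set X k -> g \subset h ->
  g \subset k -> test_set X (h :|: k)%SET.
Proof.
move=> th tk gh gk; have [/finset.set0Pn[B Bg] _ _ _] := gS.
rewrite /test_set; case: (boolP (set_chain _)) => [hkc|]; last by rewrite !orbT.
case: (boolP (finset.set0 \in _)) => [|hk0]; first by rewrite orbT.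
have [h0 k0] : finset.set0 \notin h /\ finset.set0 \notin k.
  by move: hk0; rewrite inE negb_or => /andP[].
have hX : h \in X.
  case/or3P: th => //; first by rewrite (negPf h0).
  by rewrite (set_chainS (finset.subsetUl h k)).
have kX : k \in X.
  case/or3P: tk => //; first by rewrite (negPf k0).
  by rewrite (set_chainS (finset.subsetUr h k)).
have [[hB hg gh'] [kB _ _]] := (gX.1 h hX, gX.1 k kX).
apply/orP; left; apply: gX.2.
  by apply: (meeting_B1 hB kB hkc (fintype.subsetP gh B Bg) (fintype.subsetP gk B Bg)).
apply: (@leq_trans #|h|); last exact/subset_leq_card/finset.subsetUl.
by rewrite ltn_neqAle gh' andbT; apply: contra hg => /eqP e; rewrite eq_sym (eqEcard g h) gh e /=.
Qed.

(** The empty set serves as [z] in [subdivision], because flag functions vanish there. *)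
Lemma stage_zero : test_set X (finset.set0 |: g)%SET.
Proof. by rewrite /test_set setU11 orbT. Qed.

(** Writes [a] as [a'] plus [t] times the ray, with [a'] off the star of [g]. Outside the star [t]
    is 0; inside, [subdivision] gives [t] and compatible decompositions of all [b] in the subdivided
    cone of [a]. *)
Lemma stage_face a : flag_fun a -> exists t : R, let a' := add_mul a (- t) (indicator R g) in
  [/\ 0 <= t, 0 < t -> le X (indicator R g) a, flag_fun a' /\ le X a' a,
      ~ le X (indicator R g) a' &
      forall b, flag_fun b -> le X b a -> (forall B, argmin a g B -> argmin b g B) ->
        exists s : R, let b' := add_mul b (- s) (indicator R g) in
          [/\ 0 <= s, t = 0 -> s = 0, flag_fun b' & le X b' a']].
Proof.
move=> aF; have [a0 _ a00 _] := aF.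
have add0 b : add_mul b (- 0) (indicator R g) = b.
  by apply/funext => B; rewrite /add_mul oppr0 mul0r addr0.
have flag_sub b (s : R) : flag_fun b -> 0 <= s -> (forall B, B \in g -> s <= b B) ->
    flag_fun (add_mul b (- s) (indicator R g)).
  move=> bF s0 sb; have [b0 _ _ _] := bF.
  have bE B : add_mul b (- s) (indicator R g) B = if B \in g then b B - s else b B.
    by rewrite /add_mul /indicator; case: ifP => _; rewrite ?mulr1 ?mulr0 ?addr0.
  apply: (flag_funS bF) => B; rewrite bE; case: ifP => // Bg.
    by rewrite subr_ge0 sb.
  by have := sb B Bg => sB bB; rewrite bB in sB *; lra.
have [ga|nga] := pselect (le X (indicator R g) a); last first.
  exists 0; rewrite add0 ltxx; split=> //; first by split.
  by move=> b bF ba _; exists 0; rewrite add0.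
have [g0 _ _ _] := gS.
have [t [t0 tg ta nt H]] := subdivision g0 stage_join stage_union stage_zero a0 a00 ga.
exists t; split=> //; first exact: ltW.
  by split=> //; apply: flag_sub => //; exact: ltW.
move=> b bF ba bg; have [b0 _ _ _] := bF.
have [s [s0 sg sb]] := H b b0 ba bg; exists s; split=> //.
  by move=> t00; rewrite t00 ltxx in t0.
exact: flag_sub.
Qed.

Variable P : set V.
Hypothesis PX : ordered_by P X.

Lemma max_face_order a b : flag_fun a -> flag_fun b ->
  max_face (flag_vec a) P `<=` max_face (flag_vec b) P <-> le X b a.
Proof. by case: PX => _ _ _; exact. Qed.

Lemma max_face_le a b x : flag_fun a -> flag_fun b -> le X b a ->
  max_face (flag_vec a) P x -> max_face (flag_vec b) P x.
Proof. by move=> aF bF /(max_face_order aF bF); exact. Qed.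

Lemma stage_not_le : ~ le X (indicator R g) (fun=> 0).
Proof.
have F0 : flag_fun (fun _ : T => 0 : R) by split=> // B D; rewrite ltxx.
have [/finset.set0Pn[B Bg] _ _ _] := gS.
move=> /(argmin_le_support F0 (flag_fun_indic R gB)) /(_ B erefl).
by rewrite /indicator Bg => /eqP; rewrite oner_eq0.
Qed.

Lemma stage_nonconstant : ~ (P `<=` max_face '1_g P).
Proof.
have F0 : flag_fun (fun _ : T => 0 : R) by split=> // B D; rewrite ltxx.
move=> H; apply: stage_not_le.
by apply/(max_face_order F0 (flag_fun_indic R gB)) => x [Px _]; exact: H.
Qed.

Section Cut.
Variables (S : finType) (p : S -> V) (m L : R).
Hypothesis PE : P = convex_combs p.
Hypothesis mP : forall x, max_face '1_g P x -> dot '1_g x = m.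
Hypothesis Lm : L < m.
Hypothesis Lp : forall i, dot '1_g (p i) < m -> dot '1_g (p i) < L.

Let Q : set V := P `&` [set x | dot '1_g x <= L].

Let PP : polytope P. Proof. by case: PX. Qed.

Let gF : flag_fun (indicator R g) := flag_fun_indic R gB.

Lemma stage_gen_lt i : ~ max_face '1_g P (p i) -> dot '1_g (p i) < L.
Proof.
move=> ni; apply: Lp; have [z zg] := max_face_neq0 '1_g PP.
have Pi : P (p i) by rewrite PE; exact: convex_combs_gen.
rewrite -(mP zg) lt_neqAle (proj2 zg) // andbT; apply/eqP => e; apply: ni.
by split=> // x Px; rewrite e; exact: (proj2 zg).
Qed.

Lemma stage_low a : flag_fun a -> ~ le X (indicator R g) a ->
  exists2 y, max_face (flag_vec a) P y & dot '1_g y < L.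
Proof.
move=> aF nga; have : ~ (max_face (flag_vec a) P `<=` max_face '1_g P).
  by move/(max_face_order aF gF).
rewrite PE => /max_face_sub_gen[i ia ig]; exists (p i) => //.
by apply: stage_gen_lt; rewrite PE.
Qed.

(** The counterpart of [max_face_truncated_summand]: since [a'] is off the star, its face reaches
    below [L], and if [t > 0] the face of [a] inside it lies at the top level [m]. *)
Lemma stage_cut_face a (t : R) : let a' := add_mul a (- t) (indicator R g) in
  flag_fun a -> 0 <= t -> (0 < t -> le X (indicator R g) a) -> flag_fun a' ->
  le X a' a -> ~ le X (indicator R g) a' ->
  max_face (flag_vec a) Q !=set0 /\
  forall x, max_face (flag_vec a) Q x <->
    [/\ max_face (flag_vec a') P x, dot '1_g x <= L & 0 < t -> dot '1_g x = L].
Proof.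
move=> a' aF t0 tg a'F a'a nga'.
rewrite -{1 2}[a](add_mulK a t (indicator R g)) flag_vec_add_mul.
have [y ya yL] := stage_low a'F nga'.
apply: (max_face_cut _ _ ya (ltW yL)) => //; first exact: segment_polytope.
move=> /tg ga; have [z za] := max_face_neq0 (flag_vec a) PP.
exists z; first exact: max_face_le za.
by rewrite (mP (max_face_le aF gF ga za)) ltW.
Qed.

Lemma stage_cut_neq0 v : max_face v Q !=set0.
Proof.
apply/max_face_neq0/polytope_halfspace_le => //.
have F0 : flag_fun (fun _ : T => 0 : R) by split=> // B D; rewrite ltxx.
by have [y [Py _] yL] := stage_low F0 stage_not_le; exists y; split=> //; exact: ltW.
Qed.

Lemma stage_cut_order a b : flag_fun a -> flag_fun b ->
  max_face (flag_vec a) Q `<=` max_face (flag_vec b) Q <->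
  le X b a /\ forall B, argmin a g B -> argmin b g B.
Proof.
move=> aF bF; have cP := segment_polytope PP.
have [t [t0 tg [a'F a'a] nga' Hb]] := stage_face aF.
set a' := add_mul _ _ _ in a'F a'a nga' Hb.
have [_ faceA] := stage_cut_face aF t0 tg a'F a'a nga'.
have [y ya yL] := stage_low a'F nga'; split; last first.
  move=> [ba bg]; have [s [s0 st b'F b'a']] := Hb b bF ba bg.
  move=> x /faceA[xa xL xE]; split.
    by split=> //; case: xa.
  move=> w [Pw /= wL]; rewrite -[b](add_mulK b s (indicator R g)) flag_vec_add_mul.
  rewrite !dotDl !dotZl lerD //.
    have /(max_face_order a'F b'F) := b'a'.
    by move=> /(_ x xa) [_]; apply.
  have [t00|tn] := eqVneq t 0; first by rewrite st // !mul0r.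
  by rewrite xE ?ler_wpM2l // lt_neqAle eq_sym tn.
move=> H; have [s [s0 sg [b'F b'b] ngb' _]] := stage_face bF.
set b' := add_mul _ _ _ in b'F b'b ngb'.
have [_ faceB] := stage_cut_face bF s0 sg b'F b'b ngb'.
(* With [t = 0] the point [y], strictly below the hyperplane, is in the face of [a], whereas [s > 0]
   confines the face of [b] to the hyperplane. *)
have st : 0 < s -> 0 < t.
  move=> sp; rewrite lt_neqAle t0 andbT; apply/eqP => t00.
  have /H/faceB[_ _ /(_ sp) e] : max_face (flag_vec a) Q y.
    by apply/faceA; split=> [//||]; [exact: ltW yL|rewrite -t00 ltxx].
  by rewrite e ltxx in yL.
have b'a' : le X b' a'.
  apply/(max_face_order a'F b'F) => w wa.
  (* To see that [w] is in the face of [b'], join it inside the face of [a'] to a point [z] so that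
     some point with positive weight on [w] lies in the face of the section. *)
  have key z r : max_face (flag_vec a') P z -> 0 < r <= 1 ->
      dot '1_g (r *: w + (1 - r) *: z) <= L ->
      (0 < t -> dot '1_g (r *: w + (1 - r) *: z) = L) ->
      max_face (flag_vec b') P w.
    move=> za r01 rL rE; have [r0 r1] := andP r01.
    have xa : max_face (flag_vec a') P (r *: w + (1 - r) *: z).
      by apply: segment_max_face => //; rewrite (ltW r0).
    have /H/faceB[xb _ _] : max_face (flag_vec a) Q (r *: w + (1 - r) *: z).
      by apply/faceA.
    by apply: max_face_segment xb => //; [case: wa|case: za].
  have [wL|/ltW Lw] := leP (dot '1_g w) L.
    have [t00|tn] := eqVneq t 0.
      apply: (key y 1) => //; rewrite ?ltr01 ?lexx ?t00 ?ltxx //.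
      by rewrite scale1r subrr scale0r addr0.
    have tp : 0 < t by rewrite lt_neqAle eq_sym tn.
    have [z za] := max_face_neq0 (flag_vec a) PP.
    have zg : dot '1_g z = m by apply: mP; exact: (max_face_le aF gF (tg tp) za).
    have za' : max_face (flag_vec a') P z by exact: (max_face_le aF a'F a'a za).
    have [|r [/andP[r0 r1] rL /(_ _) rp _]] := segment_level wL (y := z); first by rewrite zg ltW.
    by apply: (key z r) => //; rewrite ?rL // r1 rp // zg.
  have [r [/andP[r0 r1] rL _ rp]] := segment_level (ltW yL) Lw.
  have e : r *: y + (1 - r) *: w = (1 - r) *: w + (1 - (1 - r)) *: y.
    by rewrite subKr addrC.
  apply: (key y (1 - r)) => //; rewrite -?e ?rL //.
  by rewrite subr_gt0 rp //= lerBlDr lerDl.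
(* Off the star the condition for [g] comes for free; adding back a multiple of the indicator,
   constant on [g], preserves it. *)
have b'g := refine_of_le stage_join nga' b'a'.
have a'g B : argmin a g B -> argmin a' g B.
  move=> [Bg BM]; split=> // D Dg.
  by rewrite /a' /add_mul /indicator Bg Dg !mulr1 lerD2r BM.
have [b'a b'ag] : le X b' a /\ forall B, argmin a g B -> argmin b' g B.
  by split=> [|B /a'g/b'g //]; exact: argmin_le_trans b'a' a'a.
rewrite -[b](add_mulK b s (indicator R g)) -/b'.
have [s00|sn] := eqVneq s 0.
  have -> // : add_mul b' s (indicator R g) = b'.
  by apply/funext => B; rewrite s00 /add_mul mul0r addr0.
have ga : le X (indicator R g) a by apply/tg/st; rewrite lt_neqAle eq_sym sn.
split; first exact: argmin_le_add.
move=> B Bm; have [Bg BM] := b'ag B Bm; split=> // D Dg.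
by rewrite /add_mul /indicator Bg Dg !mulr1 lerD2r BM.
Qed.

End Cut.

Lemma gap_ex (S : finType) (f : S -> R) (m : R) :
  exists2 L, L < m & forall i, f i < m -> f i < L.
Proof.
case: (pickP (fun i => f i < m)) => [i0 i0m|none]; last first.
  by exists (m - 1); [lra|move=> i; rewrite none].
have [i im imax] := @Order.TotalTheory.arg_maxP _ R S i0 (fun i => f i < m) f i0m.
exists ((f i + m) / 2); first by lra.
by move=> j jm; have := imax j jm; rewrite /=; lra.
Qed.

Lemma stage_truncator_summand : truncator_summand P (truncated_summand g c).
Proof.
have [PP Ps [r Pr] _] := PX.
have /polytopeP[S [p [S0 PE]]] := PP.
have [z zg] := max_face_neq0 '1_g PP; pose m := dot '1_g z.
have mP x : max_face '1_g P x -> dot '1_g x = m by move=> xg; exact: max_face_value xg zg.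
have [L Lm Lp] := gap_ex (fun i => dot '1_g (p i)) m.
pose Q : set V := P `&` [set x | dot '1_g x <= L].
have Qn v : max_face v Q !=set0 := stage_cut_neq0 PE mP Lp v.
have QP : polytope Q.
  apply: polytope_halfspace_le => //; have [x [Qx _]] := Qn 0; by exists x.
have FP : max_face '1_g P <> P by move=> e; apply: stage_nonconstant; rewrite e.
have [PX' Ps' _ PO] := ordered_by_minksum gB PX.
exists (max_face '1_g P), Q; split; last first.
  apply: normally_equivalent_flags => //.
  - by apply: constant_sumS Ps => x [].
  - by move=> v; exact: max_face_neq0.
  - move=> a b aF bF; rewrite PO // le_setU1 //.
    by rewrite (stage_cut_order PE mP Lm Lp).
have k0 : '1_g != 0.
  apply/eqP => k0; apply: stage_nonconstant => x Px; split=> // y _.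
  by rewrite k0 /dot !big1 // => i _; rewrite !mxE mul0r.
split=> //.
- exact: face_max_face.
(* A chain in [A2] has two members, and on the face the coordinate sum over each of them is
   constant, so [codim2_not_facet] applies. *)
- have [_ gne gc _] := gS; have /A2P[_ /card_gt1P[D0 [E0 [D0g E0g DE0]]]] := gA.
  have cst B : B \in g -> exists s : R,
      forall x, max_face '1_g P x -> \sum_(i in B) x 0 i = s.
    move=> Bg; have BB : [set B]%SET \in B1 n.
      by apply: set1_B1; rewrite in_B0; exact: gne.
    have BF := flag_fun_indic R BB; have gF := flag_fun_indic R gB.
    (* No test of [X] is contained in [g], so the minimisers of the indicator of [g] avoid [g], in
       particular [B]. *)
    have gle : le X (indicator R [set B]%SET) (indicator R g).
      apply/argmin_leP => //; split=> [D|h hX D [Dh DM]].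
        by rewrite /indicator inE; case: eqP => // ->; rewrite Bg => /eqP; rewrite oner_eq0.
      split=> // D' _; have [hB hg gh] := gX.1 h hX.
      have /subsetPn[D1 D1h D1g] : ~~ (h \subset g).
        by apply: contra hg => hg; rewrite eqEcard hg.
      have := DM D1 D1h; rewrite /indicator (negPf D1g) lern0 eqb0 => Dg.
      rewrite [D \in _]inE; case: eqP => [DB|_]; last exact: ler0n.
      by rewrite DB Bg in Dg.
    exists (- dot '1_[set B]%SET z) => x xg.
    have H y : max_face '1_g P y -> max_face '1_[set B]%SET P y.
      exact: max_face_le.
    rewrite -(max_face_value (H _ xg) (H _ zg)) dot_indic opprK /kappa.
    by rewrite big_set1.
  have [D [E [Dg Eg DE]]] : exists D E, [/\ D \in g, E \in g & D \proper E].
    have /set_chainP/(_ _ _ D0g E0g)/orP[DE|ED] := gc.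
      by exists D0, E0; rewrite finset.properEneq DE0 DE.
    by exists E0, D0; rewrite finset.properEneq eq_sym DE0 ED.
  have [[sD DF] [sE EF]] := (cst D Dg, cst E Eg).
  have [/andP[D00 _] /andP[_ ET]] := (gne D Dg, gne E Eg).
  apply: (codim2_not_facet D00 DE ET Pr _ DF EF).
  by have [s sP] := Ps; exists s => x [Px _]; exact: sP.
- exists (- '1_g), (- L); split.
  + by rewrite oppr_eq0.
  + by congr (_ `&` _); apply/seteqP; split=> x /=; rewrite dotNl lerN2.
  (* A vertex is one of the generators, and generators off the face are strictly below [L] by the
     choice of [L]. *)
  + move=> v [_ [u e]] nv.
    have [i im] := max_face_gen_ex p u S0.
    have : [set v] (p i) by rewrite e PE.
    move=> /= ei; rewrite -ei dotNl ltrN2; apply: (stage_gen_lt PE mP Lp).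
    by rewrite ei.
  + move=> v [[x vx] [u e]].
    have : [set v] v by [].
    by rewrite e => -[/mP vm _]; rewrite dotNl lerN2 vm leNgt Lm.
Qed.

End Stage.

End TruncatorSummands.

(** * The permutoassociahedron *)

Section PermutoassociahedronInequalities.
Variables (R : realType) (n : nat).
Local Notation I := 'I_n.+1.
Local Notation T := {set I}.
Local Notation V := 'rV[R]_n.+1.
Implicit Types (B D E : T) (g h : {set T}) (x : V).

Definition eta (k : nat) : R := (3 ^+ k - 3 * k%:R) / (3 ^+ n - n%:R - 1).

(** [kappa_kl] in terms of the chain ([bound_chain]): its first fraction is the geometric sum of 3^j
    over the sizes j of the members. *)
Definition bound g : R := \sum_(B in g) 3 ^+ #|B| + eta #|g|.

Lemma drop_set_inj k (i : seq I) (a b : 'I_k) : (k <= size i)%N -> uniq i ->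
  [set y in drop a i]%SET = [set y in drop b i]%SET -> a = b.
Proof.
move=> ki ui e; have ai (m : 'I_k) : (m <= size i)%N := leq_trans (ltnW (ltn_ord m)) ki.
apply/val_inj; rewrite /= -(subKn (ai a)) -(subKn (ai b)) -!card_set_drop //.
by rewrite e.
Qed.

Lemma sum_chain (U : zmodType) (F : T -> U) k (i : seq I) : (k <= size i)%N -> uniq i ->
  \sum_(B in Defs.chain k i) F B = \sum_(j < k) F [set y in drop j i]%SET.
Proof.
move=> ki ui; by rewrite big_imset //= => a b _ _; exact: drop_set_inj.
Qed.

Lemma card_chain k (i : seq I) : (k <= size i)%N -> uniq i -> #|Defs.chain k i| = k.
Proof.
move=> ki ui; by rewrite card_in_imset ?card_ord // => a b _ _; exact: drop_set_inj.
Qed.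

Lemma mem_drop_tnth m (i : m.-tuple I) j (l : 'I_m) : uniq i ->
  (tnth i l \in drop j i) = (j <= l)%N.
Proof.
move=> ui; have li : (l < size i)%N by rewrite size_tuple.
have [jl|lj] := leqP j l.
  rewrite (tnth_nth ord0); have -> : nth ord0 i l = nth ord0 (drop j i) (l - j).
    by rewrite nth_drop subnKC.
  by rewrite mem_nth // size_drop ltn_sub2r // (leq_ltn_trans jl).
apply/negP => H; have : tnth i l \in take j i.
  by rewrite (tnth_nth ord0) -(nth_take _ lj) mem_nth // size_take_min leq_min lj.
move=> H'; move: ui; rewrite -{1}(cat_take_drop j i) cat_uniq.
by move=> /and3P[_ /hasPn/(_ _ H)]; rewrite /= H'.
Qed.

(** The entry of index m lies in the members [drop j i] with j <= m and j < k, hence in min(m + 1,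
    k) of them. *)
Lemma kappa_chain k l (i : (k + l).-tuple I) x : uniq i ->
  kappa (Defs.chain k i) x = \sum_(j < k + l) (minn j.+1 k)%:R * x 0 (tnth i j).
Proof.
move=> ui; rewrite /kappa sum_chain ?size_tuple ?leq_addr //.
have inner (j : 'I_k) : \sum_(y in [set y in drop j i]%SET) x 0 y =
    \sum_(m < k + l) (j <= m)%N%:R * x 0 (tnth i m).
  have -> : [set y in drop j i]%SET =
      [set tnth i m | m in [set m : 'I_(k + l) | (j <= m)%N]]%SET.
    apply/setP => y; rewrite inE; apply/idP/imsetP => [yi|[m]].
      have /tnthP[m ym] : y \in i by exact: mem_drop yi.
      by exists m => //; rewrite inE -(mem_drop_tnth _ _ ui) -ym.
    by rewrite inE -(mem_drop_tnth _ _ ui) => mi ->.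
  rewrite big_imset => [|a b _ _ e] /=; last by apply/(tuple_uniqP _ ui).
  rewrite big_mkcond /=; apply: eq_bigr => m _; rewrite inE.
  by case: ifP; rewrite ?mul1r ?mul0r.
under eq_bigr do rewrite inner.
rewrite exchange_big; apply: eq_bigr => m _ /=.
rewrite -mulr_suml -natr_sum; congr (_%:R * _).
rewrite -(big_mkord xpredT (fun j => (j <= m)%N : nat)).
suff H q r : (\sum_(0 <= j < q) (j <= r) = minn r.+1 q)%N by exact: H.
elim: q => [|q IH]; first by rewrite big_geq // minn0.
by rewrite big_nat_recr //= IH; case: leqP => ? /=; lia.
Qed.

Lemma bound_chain k (i : seq I) : (k <= size i)%N -> uniq i ->
  bound (Defs.chain k i) = kappa_kl R n k (size i - k).
Proof.
move=> ki ui; rewrite /bound sum_chain // card_chain // /kappa_kl /eta; congr (_ + _).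
under eq_bigr do rewrite card_set_drop //.
have -> : (k + (size i - k) + 1 = (size i).+1)%N by lia.
rewrite -(big_mkord xpredT (fun j => 3 ^+ (size i - j))).
elim: k ki => [|k IH] ki; first by rewrite big_geq // subn0 addn1 subrr mul0r.
rewrite big_nat_recr //= IH ?(ltnW ki) //.
have -> : (size i - k + 1 = (size i - k.+1 + 1).+1)%N by lia.
have -> : (size i - k = (size i - k.+1 + 1))%N by lia.
by rewrite !exprS; field.
Qed.

Lemma PAP x : PA R n x <-> \sum_j x 0 j = 3 ^+ n.+1 /\
  forall g, g \in B1 n -> bound g <= kappa g x.
Proof.
split=> [[sx H]|[sx H]]; split=> //.
  move=> g /B1_chainP[k [i [/andP[k0 ki] sn ui ->]]].
  have si : size i == (k + (size i - k))%N by rewrite subnKC.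
  have kn : (k + (size i - k) <= n)%N by rewrite subnKC.
  have := H k (size i - k)%N (Tuple si) k0 kn ui.
  by rewrite -kappa_chain // bound_chain.
move=> k l i k0 kl ui; rewrite -kappa_chain //.
have ki : (k <= size i)%N by rewrite size_tuple leq_addr.
have <- : bound (Defs.chain k i) = kappa_kl R n k l.
  by rewrite bound_chain // size_tuple addKn.
apply: H; apply/B1_chainP; exists k, i.
by rewrite k0 ki size_tuple.
Qed.

Lemma eta_denominator_gt0 : (2 <= n)%N -> 0 < 3 ^+ n - n%:R - 1 :> R.
Proof.
case: n => [|[|m]] // _; rewrite -natrX -addrA -opprD subr_gt0 natr1 ltr_nat.
elim: m => // m IH; rewrite expnS; apply: leq_ltn_trans (_ : 3 * m.+3 < _)%N; lia.
Qed.

(** From k = 1 on, 3^k - 3k does not decrease, and 3n > n + 1 makes the numerator at n smaller than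
    the denominator. *)
Lemma eta_lt1 k : (2 <= n)%N -> (0 < k <= n)%N -> eta k < 1.
Proof.
move=> n2 /andP[k0 kn].
rewrite ltr_pdivrMr ?eta_denominator_gt0 // mul1r.
have : 3 ^+ k - 3 * k%:R <= 3 ^+ n - 3 * n%:R :> R.
  rewrite lerBlDr addrAC lerBrDr -!natrX -!natrM -!natrD ler_nat.
  move: kn; elim: n => [|m IH]; first by rewrite leqn0 => /eqP ->.
  rewrite leq_eqVlt => /predU1P[->|]; first by rewrite addnC.
  rewrite ltnS => km; have := IH km; have : (3 <= 3 ^ m)%N.
    by case: m km {IH} => [|m] km; [lia|rewrite expnS leq_pmulr // expn_gt0].
  by rewrite expnS; lia.
have : (2 <= n%:R :> R) by rewrite ler_nat.
lra.
Qed.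

End PermutoassociahedronInequalities.

(** * A point of [PA] that is tight exactly at a given nested set *)

Section TightPoint.
Variables (R : realType) (n : nat).
Hypothesis n2 : (2 <= n)%N.
Local Notation I := 'I_n.+1.
Local Notation T := {set I}.
Local Notation V := 'rV[R]_n.+1.
Local Notation eta := (@eta R n).
Local Notation bound := (@bound R n).
Implicit Types (B D E : T) (g h : {set T}) (x : V).
Variable M : {set {set T}}.
Hypothesis MC : M \in C n.
Variable s : seq I.
Hypothesis us : uniq s.
Hypothesis ss : size s = n.+1.
Hypothesis sM : forall D, 0 < count_of R M D -> D = prefix_set s #|D|.

Let n0 : (0 < n)%N. Proof. exact: ltnW. Qed.

Let flag : {set T} := prefixes s.

Let mins h : {set T} :=
  [set B in h | [forall D in h, count_of R M B <= count_of R M D]]%SET.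

Let denom : R := 3 ^+ n - n%:R - 1.

(* Each interval h of the flag has mass weight #|h|, spread uniformly over the
   members where the number of nested sets containing them is minimal; then an
   interval g receives at least the mass of its subintervals, that is eta #|g|,
   with equality iff g is in M by [indic_le_count]. *)
Definition excess B : R :=
  \sum_(h in A2 n | h \subset flag)
    weight R #|h| / denom * ((B \in mins h)%:R / #|mins h|%:R)
  + ((B \in flag) && (count_of R M B == 0))%:R.

Let denom_gt0 : 0 < denom. Proof. exact: eta_denominator_gt0. Qed.

Lemma minsP h B : reflect (argmin (count_of R M) h B) (B \in mins h).
Proof.
rewrite inE; apply: (iffP andP) => [[Bh /forall_inP Bm]|[Bh Bm]]; split=> //.
exact/forall_inP.
Qed.

Lemma weight_denom_ge0 h : h \in A2 n -> 0 < weight R #|h| / denom.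
Proof. by move=> /A2P[_ h1]; rewrite divr_gt0 // weight_gt0. Qed.

Lemma excess_ge0 B : 0 <= excess B.
Proof.
rewrite addr_ge0 ?ler0n // sumr_ge0 // => h /andP[hA _].
by rewrite mulr_ge0 ?(ltW (weight_denom_ge0 hA)) // divr_ge0 ?ler0n.
Qed.

Lemma eta_weight g : g \in B1 n -> eta #|g| =
  \sum_(h in A2 n) (h \subset g)%:R * (weight R #|h| / denom).
Proof.
move=> /B1P gS; rewrite /eta -(weight_belowE R gS) mulr_suml.
by apply: eq_bigr => h _; rewrite mulrA.
Qed.

(** The slack at [g] as a sum of nonnegative terms: an interval inside [g] gives it all its mass,
    any other interval only the share of its minimisers in [g]. *)
Lemma sum_excess g : g \in B1 n -> g \subset flag ->
  \sum_(B in g) excess B - eta #|g| =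
  \sum_(h in A2 n | h \subset flag) weight R #|h| / denom *
    (#|mins h :&: g|%:R / #|mins h|%:R - (h \subset g)%:R) +
  \sum_(B in g) (count_of R M B == 0)%:R.
Proof.
move=> gB gflag; rewrite big_split /= exchange_big /= eta_weight // addrAC.
congr (_ + _); last first.
  by apply: eq_bigr => B Bg; rewrite (fintype.subsetP gflag B Bg).
rewrite [X in _ - X](bigID (fun h => h \subset flag)) /= [X in _ - (_ + X)]big1.
  rewrite addr0 -sumrB; apply: eq_bigr => h _.
  rewrite -mulr_sumr mulrBr [(h \subset g)%:R * _]mulrC -mulr_suml -natr_sum.
  congr (_ * (_%:R / _) - _); rewrite -sum1_card big_mkcond [RHS]big_mkcond /=.
  by apply: eq_bigr => B _; rewrite finset.in_setI; case: (B \in g); case: (B \in mins h).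
move=> h /andP[_ nh]; case: (boolP (h \subset g)) => [hg|_]; last by rewrite mul0r.
by rewrite (fintype.subset_trans hg gflag) in nh.
Qed.

Lemma mins_gt0 h : h \in A2 n -> (0 < #|mins h|)%N.
Proof.
move=> /A2P[/B1P[h0 _ _ _] _]; rewrite card_gt0.
have [B Bm] := argmin_ex (count_of R M) h0; apply/finset.set0Pn; exists B.
exact/minsP.
Qed.

Lemma mins_term_ge0 g h : h \in A2 n ->
  0 <= weight R #|h| / denom *
    (#|mins h :&: g|%:R / #|mins h|%:R - (h \subset g)%:R).
Proof.
move=> hA; rewrite mulr_ge0 ?(ltW (weight_denom_ge0 hA)) //.
case: (boolP (h \subset g)) => hg; last by rewrite subr0 divr_ge0 ?ler0n.
have -> : mins h :&: g = mins h.
  apply/finset.setIidPl; apply: fintype.subset_trans hg.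
  by apply/fintype.subsetP => B; rewrite inE => /andP[].
by rewrite divff ?subrr // pnatr_eq0 -lt0n mins_gt0.
Qed.

Lemma sum_excess_ge g : g \in B1 n -> g \subset flag ->
  eta #|g| <= \sum_(B in g) excess B.
Proof.
move=> gB gflag; rewrite -subr_ge0 sum_excess // addr_ge0 // sumr_ge0 // => h /andP[hA _].
exact: mins_term_ge0.
Qed.

Lemma cover_flag : finset.cover M \subset flag.
Proof.
apply/fintype.subsetP => B; rewrite -(count_of_gt0 R) => Bp.
have [_ _ c0 cT] := flag_fun_count R MC.
rewrite /flag (in_prefixes us ss) -(sM Bp) eqxx andbT; apply/andP.
by split; apply: contraTneq Bp => ->; rewrite ?c0 ?cT ltxx.
Qed.

Lemma sum_excess_eq g : g \in B1 n -> g \subset flag ->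
  \sum_(B in g) excess B = eta #|g| <-> g \in M.
Proof.
move=> gB gflag; have c0 B : 0 <= count_of R M B by exact: ler0n.
have gF := flag_fun_indic R gB; have MF := flag_fun_count R MC.
split=> [/eqP|gM].
  rewrite -subr_eq0 sum_excess // paddr_eq0; last 2 first.
  - by rewrite sumr_ge0 // => h /andP[hA _]; exact: mins_term_ge0.
  - by rewrite sumr_ge0 // => B _; exact: ler0n.
  move=> /andP[]; rewrite psumr_eq0 => [/allP H1|h /andP[hA _]]; last exact: mins_term_ge0.
  rewrite psumr_eq0 => [/allP H2|B _]; last exact: ler0n.
  (* The extra 1 in [excess] at uncovered sets is there for this: zero slack forces all of [g] to be
     covered by [M]. *)
  have gpos B : B \in g -> 0 < count_of R M B.
    move=> Bg; rewrite pos_neq0 //; apply/negP => e.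
    by have := H2 B (mem_index_enum B); rewrite Bg e /= oner_eq0.
  apply/(indic_le_count R MC gB)/argmin_leP => //; split=> [B /eqP|h hA B Bm].
    apply: contraTeq; rewrite /indicator; case: (boolP (B \in g)) => [/gpos Bp _|_].
      by rewrite gt_eqF.
    by rewrite eqxx.
  have [Bh BM] := Bm; split=> // D Dh; rewrite /indicator.
  case: (boolP (B \in g)) => Bg; last exact: ler0n.
  case: (boolP (D \in g)) => // Dg.
  (* The minimum of the count over [h] is attained in [g] and so is positive; hence all of [h] is
     covered by [M]. *)
  have hflag : h \subset flag.
    apply/fintype.subsetP => E Eh; apply: (fintype.subsetP cover_flag).
    by rewrite -(count_of_gt0 R); apply: lt_le_trans (gpos B Bg) (BM E Eh).
  have := H1 h (mem_index_enum h); rewrite hA hflag /=.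
  have /negPf -> : ~~ (h \subset g).
    by apply/negP => /fintype.subsetP/(_ D Dh); rewrite (negPf Dg).
  rewrite subr0 mulf_eq0 gt_eqF ?weight_denom_ge0 //= mulf_eq0 invr_eq0.
  rewrite !pnatr_eq0 cards_eq0 => /orP[/eqP e|]; last first.
    by rewrite -leqn0 leqNgt mins_gt0.
  have := finset.in_set0 B; rewrite -e inE Bg andbT => /negP[].
  exact/minsP.
apply/eqP; rewrite -subr_eq0 sum_excess // !big1 ?addr0 // => [B Bg|h /andP[hA _]].
  have Bp : 0 < count_of R M B by rewrite count_of_gt0; apply/bigcupP; exists g.
  by rewrite gt_eqF.
case: (boolP (h \subset g)) => hg.
  have -> : mins h :&: g = mins h.
    apply/finset.setIidPl; apply: fintype.subset_trans hg.
    by apply/fintype.subsetP => B; rewrite inE => /andP[].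
  by rewrite divff ?subrr ?mulr0 // pnatr_eq0 -lt0n mins_gt0.
have -> : mins h :&: g = finset.set0.
  apply/setP => B; rewrite finset.in_set0 inE; apply/negP => /andP[/minsP Bm Bg].
  have /(indic_le_count R MC gB) gle := gM.
  have := indic_le_argmin gle _ hg Bm; rewrite Bg /test_set hA => /(_ isT) //.
by rewrite cards0 mul0r subr0 mulr0.
Qed.

(** All intervals of the flag together have mass [eta n], which is below 1, and the term for
    uncovered sets adds at most 1. *)
Lemma excess_lt2 B : excess B < 2.
Proof.
have fB : flag \in B1 n := prefixes_B1 us ss n0.
have : eta #|flag| < 1.
  by rewrite (card_prefixes us ss); apply: eta_lt1 => //; rewrite n0 leqnn.
rewrite eta_weight // => H.
suff : excess B <= \sum_(h in A2 n) (h \subset flag)%:R * (weight R #|h| / denom) + 1.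
  by move: H; lra.
rewrite lerD //; last by rewrite -[leRHS]/(1%:R) ler_nat leq_b1.
rewrite big_mkcondr /=; apply: ler_sum => h hA; case: ifP => _; rewrite ?mul0r //.
rewrite mul1r -[leRHS]mulr1 ler_pM2l ?weight_denom_ge0 //.
by rewrite ler_pdivrMr ?ltr0n ?mins_gt0 // mul1r ler_nat (leq_trans (leq_b1 _)) ?mins_gt0.
Qed.

Lemma excess_out B : B \notin flag -> excess B = 0.
Proof.
move=> Bf; rewrite /excess (negPf Bf) addr0 big1 // => h /andP[_ /fintype.subsetP hf].
suff /negPf -> : B \notin mins h by rewrite mul0r mulr0.
by apply: contra Bf; rewrite inE => /andP[/hf].
Qed.

(** The prescribed coordinate sum over the prefix of size [j]. It must be 0, not 3^0, at the empty
    prefix; at the full one the excess vanishes and 3^(n+1) remains. *)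
Let G (j : nat) : R := if j is 0 then 0 else 3 ^+ j + excess (prefix_set s j).

Definition tight_point : V := \row_i (G (index i s).+1 - G (index i s)).

Lemma sum_tight_prefix j : (j <= n.+1)%N ->
  \sum_(i in prefix_set s j) tight_point 0 i = G j.
Proof.
move=> jn; under eq_bigr do rewrite mxE.
by rewrite sum_prefix // subr0.
Qed.

Lemma prefix_full : prefix_set s n.+1 = [set: I]%SET.
Proof.
apply/eqP; rewrite eqEcard finset.subsetT cardsT card_ord (card_prefix_set us ss) //=.
Qed.

Lemma sum_tight : \sum_i tight_point 0 i = 3 ^+ n.+1.
Proof.
have := sum_tight_prefix (leqnn n.+1); rewrite prefix_full.
under eq_bigl do rewrite inE.
move=> ->; rewrite /G prefix_full excess_out ?addr0 //.
by rewrite /flag (in_prefixes us ss) eqxx andbF.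
Qed.

Lemma sum_tight_flag B : B \in flag ->
  \sum_(i in B) tight_point 0 i = 3 ^+ #|B| + excess B.
Proof.
move=> /(prefix_setP _ _)[[//|j] jn ->].
by rewrite sum_tight_prefix ?(card_prefix_set us ss) // leqW.
Qed.

Lemma tight_point_ge i : (0 < index i s)%N ->
  2 * 3 ^+ index i s - 2 < tight_point 0 i.
Proof.
case e : (index i s) => [//|m] _; rewrite mxE e /G.
have := excess_lt2 (prefix_set s m.+1); have := excess_ge0 (prefix_set s m.+2).
by rewrite !exprS; lra.
Qed.

Lemma exp3_ge3 m : (0 < m)%N -> 3 <= 3 ^+ m :> R.
Proof.
case: m => // m _; by rewrite exprS ler_pMr // exprn_ege1 // ler1n.
Qed.

Lemma tight_point_ge0 i : 0 <= tight_point 0 i.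
Proof.
case e : (index i s) => [|m].
  rewrite mxE e /G subr0; have := excess_ge0 (prefix_set s 1).
  by have := @exp3_ge3 1 isT; lra.
have := @tight_point_ge i; rewrite e => /(_ isT).
by have := @exp3_ge3 m.+1 isT; lra.
Qed.

(** A set that is not a prefix has an element of index at least its size m, whose coordinate alone
    exceeds 2 * 3^m - 2; this is at least 3^m + 1 as 3^m >= 3. *)
Lemma sum_tight_nonflag B : B \in B0 n -> B \notin flag ->
  3 ^+ #|B| + 1 < \sum_(i in B) tight_point 0 i.
Proof.
rewrite in_B0 => /andP[B00 BT] Bf.
have cB : (0 < #|B|)%N by rewrite card_gt0.
have Bn : (#|B| <= n.+1)%N by rewrite (leq_trans (max_card _)) // card_ord.
have [i iB il] : exists2 i, i \in B & (#|B| <= index i s)%N.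
  case: (boolP (B \subset prefix_set s #|B|)) => [BP|/subsetPn[i iB]]; last first.
    by rewrite (in_prefix_set us ss) -leqNgt; exists i.
  case/negP: Bf; rewrite /flag (in_prefixes us ss) B00 BT /=.
  by rewrite eqEcard BP (card_prefix_set us ss) /=.
rewrite (bigD1 i) //=; have i0 := leq_trans cB il.
have := tight_point_ge i0; have : 3 ^+ #|B| <= 3 ^+ index i s :> R.
  by rewrite ler_eXn2l // ltr1n.
have := exp3_ge3 i0.
have : 0 <= \sum_(j in B | j != i) tight_point 0 j.
  by apply: sumr_ge0 => j _; exact: tight_point_ge0.
lra.
Qed.

(** On the flag this is the comparison of [excess] with [eta]. Off the flag, one member gains more
    than 1, which outweighs [eta], and [g] is not in [M] because the flag contains [cover M]. *)
Lemma kappa_tight g : g \in B1 n ->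
  bound g <= kappa g tight_point /\ (kappa g tight_point = bound g <-> g \in M).
Proof.
move=> gB; have [g0 gne gc _] : saturated g by apply/B1P.
case: (boolP (g \subset flag)) => gf.
  have -> : kappa g tight_point = \sum_(B in g) 3 ^+ #|B| + \sum_(B in g) excess B.
    rewrite /kappa -big_split /=; apply: eq_bigr => B Bg.
    by rewrite sum_tight_flag // (fintype.subsetP gf).
  rewrite /bound lerD2l; split; first exact: sum_excess_ge.
  by rewrite -(sum_excess_eq gB gf); split=> [/addrI|->].
have [B Bg Bf] := subsetPn gf.
suff lt : bound g < kappa g tight_point.
  split; first exact: ltW.
  split=> [e|gM]; first by rewrite e ltxx in lt.
  case/negP: gf; apply: fintype.subset_trans cover_flag; exact: sub_cover.
have gn : (0 < #|g| <= n)%N.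
  rewrite card_gt0 g0; move: gB => /B1_chainP[k [i [/andP[k0 ki] sn ui ->]]].
  by rewrite card_chain // (leq_trans ki).
have ge D : D \in g -> 3 ^+ #|D| <= \sum_(i in D) tight_point 0 i.
  move=> Dg; have [Df|Df] := boolP (D \in flag).
    by rewrite sum_tight_flag // lerDl excess_ge0.
  have : 3 ^+ #|D| + 1 < \sum_(i in D) tight_point 0 i.
    by apply: sum_tight_nonflag => //; rewrite in_B0 gne.
  by lra.
have := @eta_lt1 R n #|g| n2 gn.
have : 3 ^+ #|B| + 1 < \sum_(i in B) tight_point 0 i.
  by apply: sum_tight_nonflag => //; rewrite in_B0 gne.
have : \sum_(D in g | D != B) 3 ^+ #|D| <=
    \sum_(D in g | D != B) \sum_(i in D) tight_point 0 i.
  by apply: ler_sum => D /andP[Dg _]; exact: ge.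
have -> : kappa g tight_point = \sum_(i in B) tight_point 0 i +
    \sum_(D in g | D != B) \sum_(i in D) tight_point 0 i.
  by rewrite /kappa (bigD1 B Bg).
by rewrite /bound (bigD1 B Bg) /=; lra.
Qed.

End TightPoint.

Section NormalFan.
Local Open Scope classical_set_scope.
Variables (R : realType) (n : nat).
Hypothesis n2 : (2 <= n)%N.
Local Notation I := 'I_n.+1.
Local Notation T := {set I}.
Local Notation V := 'rV[R]_n.+1.
Implicit Types (a b : T -> R) (g h : {set T}) (M : {set {set T}}) (x : V).

Lemma PA_tight_point M : M \in C n -> exists2 x, PA R n x &
  forall g, g \in B1 n -> kappa g x = bound R g <-> g \in M.
Proof.
move=> MC; have [s [us ss sM]] := flag_seq_ex (flag_fun_count R MC).
exists (tight_point R M s).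
  apply/PAP; split; first exact: sum_tight.
  by move=> g /(kappa_tight n2 MC us ss sM)[].
by move=> g /(kappa_tight n2 MC us ss sM)[].
Qed.

(** Complementary slackness: the functional is a negative combination of the [kappa g] with [g] in
    [M], and the tight point attains all these lower bounds at once; so the maximisers are the
    points tight on [M]. *)
Lemma max_face_PA M l a : M \in C n -> (forall g, g \in M -> 0 < l g) ->
  (forall B, a B = \sum_(g in M) l g * indicator R g B) ->
  forall x, max_face (flag_vec a) (PA R n) x <->
    PA R n x /\ forall g, g \in M -> kappa g x = bound R g.
Proof.
move=> MC lp aE; have /in_C[MB _ _] := MC.
have dotE x : dot (flag_vec a) x = - \sum_(g in M) l g * kappa g x.
  rewrite dot_flag_vec; congr (- _).
  under eq_bigr do rewrite aE mulr_suml.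
  rewrite exchange_big; apply: eq_bigr => g _ /=.
  under eq_bigr do rewrite -mulrA.
  rewrite -mulr_sumr; congr (_ * _); rewrite /kappa [RHS]big_mkcond /=.
  by apply: eq_bigr => B _; rewrite /indicator; case: ifP; rewrite ?mul1r ?mul0r.
have [x0 Px0 x0E] := PA_tight_point MC.
have x0B : dot (flag_vec a) x0 = - \sum_(g in M) l g * bound R g.
  rewrite dotE; congr (- _); apply: eq_bigr => g gM.
  by congr (_ * _); apply/x0E => //; exact: (fintype.subsetP MB).
have up x : PA R n x -> dot (flag_vec a) x <= - \sum_(g in M) l g * bound R g.
  move=> /PAP[_ xb]; rewrite dotE lerN2; apply: ler_sum => g gM.
  by rewrite ler_pM2l ?lp // xb // (fintype.subsetP MB).
move=> x; split=> [[Px xM]|[Px xE]]; last first.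
  split=> // z /up; suff -> : dot (flag_vec a) x = - \sum_(g in M) l g * bound R g by [].
  by rewrite dotE; congr (- _); apply: eq_bigr => g gM; rewrite xE.
split=> // g gM; have /PAP[_ xb] := Px; have bM h : h \in M -> h \in B1 n.
  exact: (fintype.subsetP MB).
have term0 h : h \in M -> 0 <= l h * (kappa h x - bound R h).
  by move=> hM; rewrite mulr_ge0 ?(ltW (lp h hM)) // subr_ge0 xb // bM.
have : \sum_(h in M) l h * (kappa h x - bound R h) == 0.
  rewrite eq_le sumr_ge0 // andbT; have := xM x0 Px0; rewrite x0B dotE lerN2 => le.
  by under eq_bigr do rewrite mulrBr; rewrite sumrB subr_le0.
rewrite psumr_eq0 // => /allP /(_ g (mem_index_enum g)); rewrite gM /=.
by rewrite mulf_eq0 gt_eqF ?lp //= subr_eq0 => /eqP.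
Qed.

Lemma PA_equivalent c : 0 < c <= 1 -> normally_equivalent (PA_c R n c) (PA R n).
Proof.
move=> c01; have [PP Ps _ PO] := ordered_by_PA_c n c01.
have PAs : constant_sum (PA R n) by exists (3 ^+ n.+1) => x [].
apply: normally_equivalent_flags => // [v|v|a b aF bF].
- exact: max_face_neq0.
- have [a [s [aF ->]]] := flag_vec_ex v; rewrite max_face_shift //.
  have [M [l [MC lp aE]]] := flag_fun_decomp aF.
  have [x Px xE] := PA_tight_point MC; exists x.
  apply/(max_face_PA MC lp aE); split=> // g gM.
  by have /in_C[MB _ _] := MC; apply/xE => //; exact: (fintype.subsetP MB).
have [M [l [MC lp aE]]] := flag_fun_decomp aF.
have [M' [l' [M'C l'p bE]]] := flag_fun_decomp bF.
rewrite PO // (le_decomp MC M'C lp l'p aE bE).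
have /in_C[MB _ _] := MC; have /in_C[M'B _ _] := M'C.
split=> [/fintype.subsetP M'M x /(max_face_PA MC lp aE)[Px xE]|H].
  by apply/(max_face_PA M'C l'p bE); split=> // g /M'M; exact: xE.
(* The point tight exactly on [M] lies in the face of [a], hence in that of [b], so it is tight on
   [M']. *)
have [x Px xE] := PA_tight_point MC; apply/fintype.subsetP => g gM'.
have gB : g \in B1 n by exact: (fintype.subsetP M'B).
apply/(xE g gB); have /H : max_face (flag_vec a) (PA R n) x.
  apply/(max_face_PA MC lp aE); split=> // h hM.
  by apply/xE => //; exact: (fintype.subsetP MB).
by move=> /(max_face_PA M'C l'p bE)[_]; apply.
Qed.

Lemma PA_c_realises c : 0 < c <= 1 -> realises (PA_c R n c) (C n).
Proof.
move=> c01; have [PP Ps _ PO] := ordered_by_PA_c n c01.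
pose f M : set V := max_face (flag_vec (count_of R M)) (PA_c R n c).
have fE M M' : M \in C n -> M' \in C n -> f M `<=` f M' <-> M' \subset M.
  move=> MC M'C; rewrite PO; [exact: count_of_sub|exact: flag_fun_count|].
  exact: flag_fun_count.
exists f; split; last exact: fE.
split=> [M _|M M' /set_mem MC /set_mem M'C e|F [_ [v ->]]].
- exact: face_max_face.
- apply/eqP; rewrite finset.eqEsubset; apply/andP; split; apply/fE => //; rewrite e //.
- have [a [s [aF ->]]] := flag_vec_ex v.
  have [M [l [MC lp aE]]] := flag_fun_decomp aF.
  exists M => //; have [aM Ma] := le_count_decomp MC lp aE.
  have cF := flag_fun_count R MC.
  have -> : [set y | maximizes (flag_vec a + const_mx s) (PA_c R n c) y] =
      max_face (flag_vec a) (PA_c R n c) by rewrite -(max_face_shift _ s Ps).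
  by apply/seteqP; split; apply PO.
Qed.

End NormalFan.

Section TruncatorSet.
Local Open Scope classical_set_scope.
Variables (R : realType) (n : nat) (c : R).
Hypothesis c01 : 0 < c <= 1.
Local Notation T := {set 'I_n.+1}.
Variables (m : nat) (x : nat -> {set T}).
Hypothesis xbij : set_bij `I_m [set` A2 n] x.
Hypothesis xsize : forall i j, (i < j < m)%N -> (#|x j| <= #|x i|)%N.

Let prior i : {set {set T}} := [set x j | j : 'I_i]%SET.

Lemma mem_A2 i : (i < m)%N -> x i \in A2 n.
Proof. by have [xA _ _] := xbij; move=> im; apply: xA. Qed.

(** A chain larger than a member of [A2] is in [A2] as well, so it is listed, and necessarily
    earlier because sizes do not increase. *)
Lemma prior_precede i : (i < m)%N -> precede (prior i) (x i).
Proof.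
move=> im; have [_ xinj xsurj] := xbij; split=> [h /imsetP[[j ji] _ ->] /=|h hB gh].
  have jm := ltn_trans ji im; split; first exact/A2_B1/mem_A2.
    apply/eqP => /(xinj j i (mem_set jm) (mem_set im)) e; by rewrite e ltnn in ji.
  by apply: xsize; rewrite ji.
have /A2P[_ g1] := mem_A2 im.
have hA : h \in A2 n by apply/A2P; rewrite (ltn_trans g1 gh).
have [j jm jh] := xsurj h hA; have ji : (j < i)%N.
  rewrite ltnNge leq_eqVlt; apply/negP => /predU1P[e|ij].
    by rewrite e jh ltnn in gh.
  have := xsize (introT andP (conj ij jm)); rewrite jh leqNgt gh //.
by apply/imsetP; exists (Ordinal ji).
Qed.

Lemma ordered_by_partial (phi : {set T} -> set 'rV[R]_n.+1) i :
  (forall g, g \in A2 n -> phi g = truncated_summand g c) -> (i <= m)%N ->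
  ordered_by (partial_minksum (@permutohedral_sum R n) (fun j => phi (x j)) i) (prior i).
Proof.
move=> phiE; elim: i => [_|i IH im] /=.
  have -> : prior 0 = finset.set0.
    by apply/setP => g; rewrite finset.in_set0; apply/imsetP => -[[]].
  exact: ordered_by_permutohedral.
have -> : prior i.+1 = (x i |: prior i)%SET.
  apply/setP => g; rewrite in_setU1; apply/imsetP/predU1P.
    move=> [[j ji] _ ->] /=; move: ji; rewrite ltnS leq_eqVlt => /predU1P[->|ji].
      by left.
    by right; apply/imsetP; exists (Ordinal ji).
  move=> [->|/imsetP[j _ ->]]; first by exists ord_max.
  by exists (widen_ord (leqnSn i) j).
rewrite phiE ?mem_A2 //; apply: ordered_by_minksum => //; last exact: IH (ltnW im).
exact/A2_B1/mem_A2.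
Qed.

Lemma truncator_set_permutohedral (phi : {set T} -> set 'rV[R]_n.+1) :
  (forall g, g \in A2 n -> phi g = truncated_summand g c) ->
  truncator_set (@permutohedral_sum R n) m (fun i => phi (x i)).
Proof.
move=> phiE i im; rewrite /= (phiE _ (mem_A2 im)).
apply: (stage_truncator_summand c01 (mem_A2 im) (prior_precede im)).
exact: ordered_by_partial phiE (ltnW im).
Qed.

End TruncatorSet.

Theorem theorem5p24 (R : realType) (n : nat) (c : R) :
  (2 <= n)%N -> 0 < c <= 1 ->
  minkowski_realisation (C1 n) (B1 n) (C n) (PA_c R n c) /\
  normally_equivalent (PA_c R n c) (PA R n).
Proof.
move=> n2 c01; split; last exact: PA_equivalent.
have [PP [s Ps] [r Pr] _] := ordered_by_PA_c n c01.
split=> //.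
- by split=> //; exact: building_set_B1.
- exact: has_dim_simplices Ps Pr.
- exact: PA_c_realises.
pose phi g : set 'rV[R]_n.+1 :=
  if g \in A1 n then simplex (finset.cover g) else truncated_summand g c.
have phi1 g : g \in A1 n -> phi g = simplex (finset.cover g).
  by rewrite /phi => ->.
have phi2 g : g \in A2 n -> phi g = truncated_summand g c.
  by rewrite /phi finset.in_setD => /andP[/negPf ->].
have sum1 : \big[@minksum R n.+1/[set 0]%classic]_(b in A1 n) phi b =
    \big[@minksum R n.+1/[set 0]%classic]_(b in A1 n) simplex (finset.cover b).
  by apply: eq_bigr => g; exact: phi1.
have sum2 : \big[@minksum R n.+1/[set 0]%classic]_(b in (B1 n :\: A1 n)%SET) phi b =
    \big[@minksum R n.+1/[set 0]%classic]_(b in A2 n) truncated_summand b c.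
  by apply: eq_bigr => g; exact: phi2.
exists phi; split.
- move=> g gB; rewrite /phi; case: ifP => [gA|_].
    by apply: polytope_simplex; exact: cover_A1_neq0.
  exact: polytope_truncated_summand.
- rewrite (finset.big_setID (A1 n)) /=.
  have -> : (B1 n :&: A1 n)%SET = A1 n.
    by apply/finset.setIidPr/fintype.subsetP => g; rewrite inE => /andP[].
  by rewrite sum1 sum2 minksumA.
- move=> m x xbij xsize; rewrite sum1.
  exact: (truncator_set_permutohedral c01 xbij xsize phi2).
Qed.
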